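(* Let the setting be as fixed in the context (space dimension $1$, nonlinearity $F(w)=-R(w\,\partial w)$, exponent $\gamma\in[\tfrac12,\infty)$). Let $(e_n)_{n\in\mathbb{N}}\subseteq\mathbb{H}$, and assume for all $n\in\mathbb{N}$, $v\in H_\gamma$ that $e_n$ is the equivalence class of $(0,1)\ni x\mapsto\sqrt2\sin(n\pi x)\in\mathbb{R}$, that $\lambda_{e_n}=-\pi^2n^2$, and that $$r(v)\ge\max\big\{\sqrt\vartheta+\varepsilon\|v\|_H^2,\ \tfrac1{\sqrt3}\|v\|_{H_\gamma}^2\big\}.$$ Then $$\sup_{\theta\in\varpi_T}\ \sup_{I\in\mathcal{P}_0(\mathbb{H})}\ \sup_{J\in\mathcal{P}_0(\mathbb{U})}\ \sup_{t\in[0,T]}\ \mathbb{E}\Big[\exp\Big(\tfrac{\varepsilon\|Y^{\theta,I,J}_t\|_H^2}{e^{2\varepsilon\vartheta t}}\Big)\Big]<\infty.$$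
   Context: Setting. $\mathcal{D}=(0,1)$, $\mu_{\mathcal D}$ is Lebesgue measure on $\mathcal D$, $\gamma\in[\tfrac12,\infty)$, $T,\varepsilon\in(0,\infty)$, $\delta\in(0,\tfrac1{18})$, $U=L^2(\mu_{\mathcal D};\mathbb{R})$ with its usual scalar product and norm, $\mathbb{U}$ is an orthonormal basis of $U$, $H\subseteq U$ is a closed subspace of $U$ (with the induced scalar product), $\mathbb{H}\subseteq H$ is a non-empty orthonormal basis of $H$, $\lambda\colon\mathbb{H}\to\mathbb{R}$, $h\mapsto\lambda_h$, satisfies $\sup_{h\in\mathbb{H}}\lambda_h<0$. $(\Omega,\mathcal{F},\mathbb{P},(\mathcal{F}_t)_{t\in[0,T]})$ is a filtered probability space, $(W_t)_{t\in[0,T]}$ is an $\mathrm{Id}_U$-cylindrical $(\mathcal{F}_t)_{t\in[0,T]}$-Wiener process, $Q\in L(U)$ is a non-negative symmetric trace class operator. $A\colon D(A)\subseteq H\to H$ is the linear operator with $D(A)=\{w\in H:\sum_{h\in\mathbb{H}}|\lambda_h\langle h,w\rangle_H|^2<\infty\}$, $Av=\sum_{h\in\mathbb{H}}\lambda_h\langle h,v\rangle_Hh$. $H_s$, $s\in\mathbb{R}$, are the interpolation spaces associated to $-A$; for $s\ge0$: $H_s=\{v\in H:\sum_{h\in\mathbb{H}}|\lambda_h|^{2s}|\langle h,v\rangle_H|^2<\infty\}$, $\|v\|_{H_s}=\|(-A)^sv\|_H$. $r\colon H_\gamma\to[0,\infty)$ and $b\colon\mathcal{D}\times\mathbb{R}\to\mathbb{R}$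 are Borel measurable with $\sup_{x\in\mathcal D,\,y\in\mathbb{R},\,z\in\mathbb{R}\setminus\{y\}}\big(|b(x,y)|+\tfrac{|b(x,y)-b(x,z)|}{|y-z|}\big)<\infty$. $\vartheta=\operatorname{trace}_U(Q)\,\sup_{x\in\mathcal D,y\in\mathbb{R}}|b(x,y)|^2$ and $c\in[2\max\{1,\varepsilon\sqrt\vartheta,\varepsilon\},\infty)$. For $I\subseteq\mathbb{H}$, $J\subseteq\mathbb{U}$: $P_I(v)=\sum_{h\in I}\langle h,v\rangle_Hh$ for $v\in H$, and $\hat P_J(w)=\sum_{u\in J}\langle u,w\rangle_Uu$ for $w\in U$. $R\in L(U)$ is the orthogonal projection of $U$ on $H$. $\partial$ denotes the weak derivative on $W^{1,2}(\mathcal D,\mathbb{R})$. $F\colon H_\gamma\to H$, $B\colon H_\gamma\to\mathrm{HS}(U,H)$ (Hilbert–Schmidt operators) are functions and $\xi\colon\Omega\to H_\gamma$ is $\mathcal{F}_0/\mathcal{B}(H_\gamma)$-measurable such that: $\mathbb{E}[e^{\varepsilon\|\xi\|_H^2}]<\infty$; for every Borel function $v\colon\mathcal D\to\mathbb{R}$ whose equivalence class $[v]$ lies in $H_\gamma$ and every $u\in U$, $B([v])u=R\big([x\mapsto b(x,v(x))]\cdot(\sqrt Qu)\big)$ (pointwise product); and $F(w)=-R(w\,\partial w)$ for all $w\in H_\gamma\cap W^{1,2}(\mathcal D,\mathbb{R})\cap L^\infty(\mu_{\mathcal D};\mathbb{R})$. Scheme. $Y^{\theta,I,J}\colon[0,T]\times\Omega\to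 P_I(H)$, $\theta\in\varpi_T$, $I\in\mathcal{P}_0(\mathbb{H})$, $J\in\mathcal{P}_0(\mathbb{U})$, are $(\mathcal{F}_t)_{t\in[0,T]}$-adapted stochastic processes with continuous sample paths such that for all $t\in(0,T]$, $\theta,I,J$: $Y^{\theta,I,J}_0=P_I(\xi)$ and, $\mathbb{P}$-almost surely, with $\tau=\llcorner t\lrcorner_\theta$ and $\chi=1$ if $r(Y^{\theta,I,J}_\tau)\le c\,[|\theta|_T]^{-\delta}$, $\chi=0$ otherwise, $$Y^{\theta,I,J}_t=e^{(t-\tau)A}\big(Y^{\theta,I,J}_\tau+\chi\,P_IF(Y^{\theta,I,J}_\tau)(t-\tau)\big)+\frac{\int_\tau^te^{(t-\tau)A}\,\chi\,P_IB(Y^{\theta,I,J}_\tau)\hat P_J\,dW_s}{1+\big\|\int_\tau^tP_IB(Y^{\theta,I,J}_\tau)\hat P_J\,dW_s\big\|_H^2}.$$ Notation. $\mathcal{P}_0(X)$: set of finite subsets of $X$. $\varpi_T$: set of all finite $\theta\subseteq[0,T]$ with $\{0,T\}\subseteq\theta$; $|\theta|_T$: maximal distance between consecutive points of $\theta$; $\llcorner t\lrcorner_\theta=\max([0,t)\cap\theta)$ for $t\in(0,T]$. *)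

(* Defs.v *)
From HB Require Import structures.
From mathcomp Require Import all_boot all_order all_algebra.
From mathcomp Require Import all_classical all_reals all_analysis.
From mathcomp Require Import measurable_realfun ess_sup_inf.
From mathcomp Require summability.

Set Implicit Arguments.
Unset Strict Implicit.
Unset Printing Implicit Defensive.
Import Order.TTheory GRing.Theory Num.Theory.
Import numFieldNormedType.Exports.

Local Open Scope classical_set_scope.
Local Open Scope ring_scope.
Local Open Scope quotient_scope.

(* The library's LspaceType (equivalence classes of p-integrable functions)
   carries no algebraic structure; here it is made a normed module whose norm
   is the L^p norm. *)
Section Lspace_normedModule.
Context d (T : measurableType d) (R : realType).
Variables (mu : {measure set T -> \bar R}) (p : \bar R) (p1 : (1 <= p)%E).

Lemma ae_eq_Lnorm (f g : T -> R) :
  measurable_fun setT f -> measurable_fun setT g -> f = g %[ae mu] ->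
  'N[mu]_p[EFin \o f]%E = 'N[mu]_p[EFin \o g]%E.
Proof.
move=> mf mg fg; rewrite unlock /Lnorm; case: p p1 => [r _|_|//].
- congr (_ `^ _)%E; apply: ae_eq_integral => //.
  + apply/measurable_EFinP; apply: (measurableT_comp (measurable_powR _)) => //.
    exact: measurableT_comp.
  + apply/measurable_EFinP; apply: (measurableT_comp (measurable_powR _)) => //.
    exact: measurableT_comp.
  + by apply: filterS fg => x /= /[apply] ->.
- case: ifP => // _; apply: eq_ess_sup.
  by apply: filterS fg => x /= -> //.
Qed.

Local Notation V := (LspaceType mu p1).

(* The library's quotient uses measurableTypeR R, which has the same carrier
   and the same measurable sets as R. *)
Section to_mfun.
Variable f : LfunType mu p1.
Let g : T -> measurableTypeR R := f.
Let mg : measurable_fun setT g.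
Proof. exact: (@measurable_funPT _ _ _ _ f). Qed.
HB.instance Definition _ := isMeasurableFun.Build _ _ T (measurableTypeR R) g mg.
Definition Lmfun : {mfun T >-> measurableTypeR R} := g.
End to_mfun.

Lemma measurable_mfunR (f : {mfun T >-> measurableTypeR R}) :
  measurable_fun setT (f : T -> R).
Proof. by move=> mT Y mY; exact: (@measurable_funPT _ _ _ _ f mT Y mY). Qed.

Lemma Lclass_ae (f : LfunType mu p1) :
  (repr (\pi_({mfun_ mu, T >-> measurableTypeR R}) (Lmfun f)) : T -> R)
  = f %[ae mu].
Proof.
apply: ae_eq_sym; apply/asboolP.
rewrite -[`[< _ >]]/(ae_eq_op mu (Lmfun f) _).
by rewrite -eqmodE reprK.
Qed.

Lemma Lclass_subproof (f : LfunType mu p1) :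
  finite_norm mu p
    (\pi_({mfun_ mu, T >-> measurableTypeR R}) (Lmfun f)
      : {mfun_ mu, T >-> measurableTypeR R}).
Proof.
rewrite /finite_norm (ae_eq_Lnorm _ _ (Lclass_ae f)) //; last first.
  exact: measurable_mfunR.
exact: Lfunction_finite.
Qed.

Definition Lclass (f : LfunType mu p1) : V :=
  LebesgueSpace.Pack (LebesgueSpace.Class
    (isFinLebesgue.phant_Build p1 (Lclass_subproof f))).

Definition Lfun_of (u : V) : T -> R := LebesgueSpace.sort u.

Lemma Lrepr_subproof (u : V) : Lfun_of u \in Lfun mu p.
Proof.
rewrite inE; apply/andP; split; rewrite inE/=; last exact: Lebesgue_finite.
exact: measurable_mfunR.
Qed.

Definition Lrepr (u : V) : LfunType mu p1 := Lfun_Sub p1 (Lrepr_subproof u).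

Lemma LclassK (f : LfunType mu p1) : Lrepr (Lclass f) = f %[ae mu].
Proof. exact: Lclass_ae. Qed.

Lemma Lspace_inj : injective (@LebesgueSpace.sort _ _ _ mu p p1).
Proof.
move=> [u [[hu]]] [v [[hv]]] /= uv; subst v.
by rewrite (Prop_irrelevance hu hv).
Qed.

Lemma eq_Lclass (f g : LfunType mu p1) : f = g %[ae mu] -> Lclass f = Lclass g.
Proof.
move=> fg; apply: Lspace_inj => /=; apply/eqP; rewrite eqmodE.
exact/asboolP.
Qed.

Lemma LreprK : cancel Lrepr Lclass.
Proof.
move=> u; apply: Lspace_inj => /=.
rewrite -[RHS]reprK; apply/eqP; rewrite eqmodE; apply/asboolP.
exact: ae_eq_refl.
Qed.

HB.instance Definition _ := gen_eqMixin V.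
HB.instance Definition _ := gen_choiceMixin V.

Definition Ladd (u v : V) : V := Lclass (Lrepr u + Lrepr v).
Definition Lopp (u : V) : V := Lclass (- Lrepr u).
Definition Lscale (a : R) (u : V) : V := Lclass (a *: Lrepr u).
Definition Lnorm_of (u : V) : R := fine 'N[mu]_p[EFin \o u]%E.

Lemma LaddE (f g : LfunType mu p1) : Ladd (Lclass f) (Lclass g) = Lclass (f + g).
Proof.
apply: eq_Lclass; have := LclassK f; have := LclassK g.
by apply: filterS2 => x gx fx I; rewrite -[LHS]/(Lrepr (Lclass f) x + Lrepr (Lclass g) x) -[RHS]/(f x + g x) fx // gx.
Qed.

Lemma LoppE (f : LfunType mu p1) : Lopp (Lclass f) = Lclass (- f).
Proof.
apply: eq_Lclass; have := LclassK f.
by apply: filterS => x fx I; rewrite -[LHS]/(- Lrepr (Lclass f) x) fx.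
Qed.

Lemma LscaleE a (f : LfunType mu p1) : Lscale a (Lclass f) = Lclass (a *: f).
Proof.
apply: eq_Lclass; have := LclassK f.
by apply: filterS => x fx I; rewrite -[LHS]/(a * Lrepr (Lclass f) x) fx.
Qed.

Lemma LaddA : associative Ladd.
Proof.
by move=> u v w; rewrite -[u]LreprK -[v]LreprK -[w]LreprK !LaddE addrA.
Qed.
Lemma LaddC : commutative Ladd.
Proof. by move=> u v; rewrite -[u]LreprK -[v]LreprK !LaddE addrC. Qed.
Lemma Ladd0 : left_id (Lclass 0) Ladd.
Proof. by move=> u; rewrite -[u]LreprK LaddE add0r. Qed.
Lemma LaddN : left_inverse (Lclass 0) Lopp Ladd.
Proof. by move=> u; rewrite -[u]LreprK LoppE LaddE addNr. Qed.

HB.instance Definition _ := GRing.isZmodule.Build V LaddA LaddC Ladd0 LaddN.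

Lemma LscaleA a b u : Lscale a (Lscale b u) = Lscale (a * b) u.
Proof. by rewrite -[u]LreprK !LscaleE scalerA. Qed.
Lemma Lscale1 : left_id 1 Lscale.
Proof. by move=> u; rewrite -[u]LreprK LscaleE scale1r. Qed.
Lemma LscaleDr : right_distributive Lscale +%R.
Proof.
move=> a u v; rewrite -[u]LreprK -[v]LreprK.
have addE x y : x + y = Ladd x y by [].
by rewrite !(addE, LaddE, LscaleE) scalerDr.
Qed.
Lemma LscaleDl v : {morph Lscale^~ v : a b / a + b}.
Proof.
move=> a b; rewrite -[v]LreprK.
have addE x y : x + y = Ladd x y by [].
by rewrite !(addE, LaddE, LscaleE) scalerDl.
Qed.

HB.instance Definition _ :=
  GRing.Zmodule_isLmodule.Build R V LscaleA Lscale1 LscaleDr LscaleDl.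

Lemma Lnorm_ofE (f : LfunType mu p1) :
  Lnorm_of (Lclass f) = fine 'N[mu]_p[EFin \o f]%E.
Proof.
rewrite /Lnorm_of; congr fine.
rewrite (@ae_eq_Lnorm (Lfun_of (Lclass f)) f) //.
- exact: measurable_mfunR.
- exact: LclassK.
Qed.

Lemma ler_Lnorm_ofD (u v : V) : Lnorm_of (u + v) <= Lnorm_of u + Lnorm_of v.
Proof.
rewrite -[u]LreprK -[v]LreprK [X in Lnorm_of X]LaddE !Lnorm_ofE.
exact: ler_LnormD.
Qed.

Lemma Lnorm_ofZ (a : R) (u : V) : Lnorm_of (a *: u) = `|a| * Lnorm_of u.
Proof.
rewrite -[u]LreprK [X in Lnorm_of X]LscaleE !Lnorm_ofE.
by apply: EFin_inj; rewrite EFinM !finite_norm_fine LnormZ.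
Qed.

Lemma Lnorm_of_eq0 (u : V) : Lnorm_of u = 0 -> u = 0.
Proof.
rewrite -[u]LreprK Lnorm_ofE => /fine_Lnormr_eq0 u0.
exact: eq_Lclass.
Qed.

HB.instance Definition _ :=
  Lmodule_isNormed.Build R V ler_Lnorm_ofD Lnorm_ofZ Lnorm_of_eq0.

End Lspace_normedModule.

Section L2_unit_interval.
Variable R : realType.

Definition D01 : set R := `]0, 1[.

(* The Lebesgue measure on (0, 1), seen as a measure on the real line. *)
Definition mu01 : {measure set (measurableTypeR R) -> \bar R} :=
  mrestr lebesgue_measure (measurable_itv `]0%R, 1%R[).

Definition L2 : normedModType R := LspaceType2 mu01.

Definition L2fun (u : L2) : R -> R := @Lfun_of _ _ _ mu01 _ (lee1n 2) u.

Definition inL2 (f : R -> R) : Prop := f \_ D01 \in Lfun mu01 2%:E.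

Definition L2rep := LfunType mu01 (lee1n 2).

(* The class of the restriction of f to (0, 1) if that restriction is square
   integrable, and 0 otherwise; the values of f off (0, 1) play no role. *)
Definition cls (f : R -> R) : L2 := Lclass (insubd (0 : L2rep) (f \_ D01)).

Definition ip (u v : L2) : R := \int[mu01]_x (L2fun u x * L2fun v x).

Lemma cls_ae (f : R -> R) : inL2 f -> L2fun (cls f) = f \_ D01 %[ae mu01].
Proof.
move=> hf; rewrite /cls /L2fun.
have := @LclassK _ _ _ mu01 _ (lee1n 2) (insubd (0 : L2rep) (f \_ D01)).
apply: filterS => x /= /[apply]; rewrite -[LHS]/(Lfun_of _ x) => ->.
by rewrite -[LHS]/(val (insubd (0 : L2rep) (f \_ D01)) x) insubdK.
Qed.

Lemma ip_norm (u : L2) : ip u u = `|u| ^+ 2.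
Proof.
have -> : `|u| = fine 'N[mu01]_2%:E[EFin \o Lrepr (u : LspaceType2 mu01)]%E by [].
rewrite -powR_mulrn ?fine_ge0 ?Lnorm_ge0 //.
apply: EFin_inj; rewrite -poweR_EFin finite_norm_fine poweR_Lnorm //.
rewrite /ip /Rintegral.
have -> : (\int[mu01]_x (L2fun u x * L2fun u x)%:E)%E =
          (\int[mu01]_x (`|(EFin \o Lrepr (u : LspaceType2 mu01)) x| `^ 2))%E.
  apply: eq_integral => x _ /=.
  by rewrite powR_mulrn // real_normK ?num_real.
rewrite fineK // -poweR_Lnorm //.
by rewrite -finite_norm_fine poweR_EFin.
Qed.

Definition in_Linfty (u : L2) : Prop := finite_norm mu01 +oo%E (L2fun u).

Definition test_function (phi : R -> R) : Prop :=
  let K := closure [set x | phi x != 0] in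
  [/\ forall n x, derivable (phi^`(n))%classic x 1, compact K & K `<=` D01].

Definition is_weak_derivative (u du : L2) : Prop :=
  forall phi, test_function phi ->
    \int[mu01]_x (L2fun u x * (phi^`())%classic x)
    = - \int[mu01]_x (L2fun du x * phi x).

End L2_unit_interval.
Arguments D01 {R}.
Arguments mu01 {R}.

Section hilbert_space.
Variable R : realType.
Local Notation U := (L2 R).
Implicit Types (u v w h : U) (E V H I : set U).

Definition closed_subspace H : Prop :=
  [/\ H 0, forall a u v, H u -> H v -> H (a *: u + v) & closed H].

Definition lin_span E : set U :=
  [set v | exists (A : set U) (c : U -> R),
    fsets E A /\ v = \sum_(h \in A) c h *: h].

Definition orthonormal_basis V E : Prop :=
  [/\ E `<=` V, forall u v, E u -> E v -> ip u v = (u == v)%:R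
    & V `<=` closure (lin_span E)].

(* P_I for a finite set I (a sum of infinite support evaluates to 0) *)
Definition fproj I v : U := \sum_(h \in I) ip h v *: h.

Definition orthogonal_projection H (Rproj : U -> U) : Prop :=
  forall v, H (Rproj v) /\ forall w, H w -> ip (v - Rproj v) w = 0.

Definition nonneg_symmetric (Q : U -> U) : Prop :=
  (forall u v, ip (Q u) v = ip u (Q v)) /\ (forall u, 0 <= ip (Q u) u).

(* The trace of a nonnegative symmetric operator Q; since |Q| = Q, such an
   operator is trace class iff its trace is finite. *)
Definition trace (UU : set U) (Q : U -> U) : \bar R :=
  \esum_(u in UU) (ip (Q u) u)%:E.

Definition vartheta (UU : set U) (Q : U -> U) (b : R -> R -> R) : R :=
  fine (trace UU Q) * sup [set `|b x y| ^+ 2 | x in D01 & y in setT].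

Definition is_sqrt (Q S : U -> U) : Prop :=
  nonneg_symmetric S /\ forall u, S (S u) = Q u.

Definition hilbert_schmidt (UU H : set U) (T : U -> U) : Prop :=
  [/\ linear T, continuous T, forall u, H (T u)
    & (\esum_(u in UU) (`|T u| ^+ 2)%:E < +oo)%E].

(* The unconditional sum of the f h over h in E, i.e. the limit of the finite
   partial sums along the directed set of finite subsets of E *)
Definition hsum E (f : U -> U) : U := summability.sum (f \_ E).

(* A = sum_h lam_h <h, .> h is diagonal, and e^(tA) and (-A)^s are given by
   the diagonal functional calculus (lam_h < 0, hence -lam_h = |lam_h|). *)
Definition semigroup (HH : set U) (lam : U -> R) (t : R) (v : U) : U :=
  hsum HH (fun h => (expR (t * lam h) * ip h v) *: h).

Definition frac_power (HH : set U) (lam : U -> R) (s : R) (v : U) : U :=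
  hsum HH (fun h => (`|lam h| `^ s * ip h v) *: h).

(* H_s is only needed for s >= 0, where it is a subspace of H. *)
Definition Hspace (H HH : set U) (lam : U -> R) (s : R) : set U :=
  [set v | H v /\
    (\esum_(h in HH) (`|lam h| `^ (2 * s) * `|ip h v| ^+ 2)%:E < +oo)%E].

Definition Hnorm (HH : set U) (lam : U -> R) (s : R) (v : U) : R :=
  `|frac_power HH lam s v|.

(* The Borel sigma-algebra of the space V normed by N *)
Definition borel (V : set U) (N : U -> R) : set (set U) :=
  <<s V, [set G | G `<=` V /\ forall u, G u ->
    exists2 e, 0 < e & forall v, V v -> N (v - u) < e -> G v] >>.

End hilbert_space.

Section time_grids.
Variable R : realType.
Implicit Types (T t : R) (theta : set R).

Definition grids T : set (set R) :=
  [set theta | [/\ finite_set theta, theta `<=` `[0, T], theta 0 & theta T]].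

Definition mesh theta : R :=
  sup [set x | exists a b, [/\ theta a, theta b, a < b, x = b - a
                             & forall s, theta s -> ~~ (a < s < b)]].

Definition grid_floor theta t : R := sup (`[0, t[ `&` theta).

End time_grids.

Section probability_setting.
Context d (Omega : measurableType d) (R : realType).
Variable P : probability Omega R.
Local Notation U := (L2 R).

Definition filtration (T : R) (F : R -> set (set Omega)) : Prop :=
  (forall t : R, t \in `[0, T] -> sigma_algebra setT (F t) /\ F t `<=` measurable)
  /\ (forall s t : R, 0 <= s -> s <= t -> t <= T -> F s `<=` F t).

(* X : Omega -> V is measurable from G to the Borel sigma-algebra of (V, N). *)
Definition measurable_into (G : set (set Omega)) (V : set U) (N : U -> R)
    (X : Omega -> U) : Prop :=
  (forall omega, V (X omega)) /\ forall S, borel V N S -> G (X @^-1` S).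

(* Id_U-cylindrical F-Wiener process on [0, T]; W t u stands for <u, W_t>. *)
Record cylindrical_wiener (T : R) (F : R -> set (set Omega))
    (W : R -> U -> Omega -> R) : Prop := {
  wiener0 : forall u, {ae P, forall omega, W 0 u omega = 0};
  wiener_linear : forall t : R, t \in `[0, T] -> forall a u v,
    {ae P, forall omega, W t (a *: u + v) omega = a * W t u omega + W t v omega};
  wiener_adapted : forall t : R, t \in `[0, T] -> forall u (S : set R),
    measurable S -> F t (W t u @^-1` S);
  wiener_continuous : forall u,
    {ae P, forall omega, {within `[0, T], continuous (fun t => W t u omega)}};
  (* increments along orthonormal vectors are independent centred Gaussians
     of variance t - s, jointly independent of F s *)
  wiener_increments : forall s t : R, 0 <= s -> s < t -> t <= T ->
    forall n (u : 'I_n -> U), (forall i j, ip (u i) (u j) = (i == j)%:R) ->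
    forall (A : set Omega) (S : 'I_n -> set R), F s A ->
    (forall i, measurable (S i)) ->
    (P (A `&` \bigcap_(i in [set: 'I_n])
                [set omega | S i (W t (u i) omega - W s (u i) omega)%R])
     = P A * \prod_(i < n) normal_prob 0 (Num.sqrt (t - s)%R) (S i))%E }.

(* The Ito integral over (s, t] of a time-independent F s-measurable integrand
   Psi with values in the operators that vanish at all but finitely many
   elements of the orthonormal basis UU. *)
Definition ito_const (UU : set U) (W : R -> U -> Omega -> R) (s t : R)
    (Psi : Omega -> U -> U) (omega : Omega) : U :=
  \sum_(u \in UU) (W t u omega - W s u omega) *: Psi omega u.

End probability_setting.

(* Main.v *)
(* In each step of the scheme, conditionally on the past, the increment of the
   noise is Gaussian and independent of the current state x = Y_tau. Where
   chi = 0 the scheme contracts. Where chi = 1, the quantities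
   |x| sqrt(t - tau) and |F x| sqrt(t - tau) are bounded (the H_gamma bound
   controls |F x|, since |w w'| <= |w'|^2 for sine polynomials w), one has
   <x, F x> = - int w^2 w' = 0, and replacing the tamed noise Z / (1 + |Z|^2)
   by Z in the exponential costs an error of order
   (t - tau) exp(|Z|^2 / (4 th (t - tau))), whose expectation is of order t - tau
   by Jensen's inequality. The Gaussian term
   E exp(2 rho <x, Z>) <= exp(2 rho^2 (t - tau) vartheta |x|^2) is absorbed by
   the decay of the weight eps / e^(2 eps vartheta t). Hence the exponential
   moment grows at most by a factor e^(C (t - tau)) per step, with C independent
   of the grid, I and J, and induction along the grid bounds it on [0, T]. The
   sines are complete in L^2(0, 1), so HH = {e_n} and every element of the span
   of I is a sine polynomial. *)

Require Import Defs.
From HB Require Import structures.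
From mathcomp Require Import all_boot all_order all_algebra.
From mathcomp Require Import finmap.
From mathcomp Require Import all_classical all_reals all_analysis.
From mathcomp Require Import measurable_realfun ess_sup_inf ring lra.

Set Implicit Arguments.
Unset Strict Implicit.
Unset Printing Implicit Defensive.
Import Order.TTheory GRing.Theory Num.Theory.
Import numFieldNormedType.Exports.

Local Open Scope classical_set_scope.
Local Open Scope ring_scope.

(** The hypotheses only place the e_n inside HH. A further element of HH could be rough, and nothing
    would then be known about F on the span of I; hence completeness comes before the scheme. It is
    proved by duality: if h is orthogonal to all sines, then the integral of h sin(pi x) p(cos(pi
    x)) vanishes for every polynomial p, and suitable p approximate indicators of intervals.

    In a single step the noise coefficients are random, while linearity of W holds only almost
    surely for fixed vectors. The coefficients are therefore frozen by Tonelli on Omega x Omega, one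
    factor carrying F_s and the other the increments.

    The taming error is of order h = t - s although Z has size sqrt h, because 2 <x, Z> is kept
    exactly in the exponent: taming changes it by 2 <x, Z> |Z|^2 / (1 + |Z|^2), and |Z|^2 is of
    order h. The factors in |Z| / sqrt h that remain are absorbed by exp(|Z|^2 / (4 th h)), where 4
    is chosen because E exp(N^2 / (4 v)) = sqrt 2 for a centred Gaussian N of variance v. *)

(** * The inner product of L^2(0, 1), Cauchy-Schwarz and Bessel inequalities *)

Section L2_theory.
Variable R : realType.
Local Notation U := (L2 R).
Implicit Types (u v w : U) (f g : R -> R).

Lemma L2fun_Lfun u : L2fun u \in Lfun mu01 2%:E.
Proof. exact: Lrepr_subproof. Qed.

Lemma measurable_L2fun u : measurable_fun setT (L2fun u).
Proof. by have := L2fun_Lfun u; rewrite inE => /andP[]; rewrite inE. Qed.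

Lemma L2funD u v : L2fun (u + v) = (fun x => L2fun u x + L2fun v x) %[ae mu01].
Proof. exact: (@LclassK _ _ _ mu01 _ (lee1n 2) (Lrepr u + Lrepr v)). Qed.

Lemma L2funZ a u : L2fun (a *: u) = (fun x => a * L2fun u x) %[ae mu01].
Proof. exact: (@LclassK _ _ _ mu01 _ (lee1n 2) (a *: Lrepr u)). Qed.

Lemma integrable_L2M u v :
  mu01.-integrable setT (EFin \o (fun x => L2fun u x * L2fun v x)).
Proof.
apply/Lfun1_integrable.
exact: Lfun2_mul_Lfun1 (L2fun_Lfun u) (L2fun_Lfun v).
Qed.

#[global] Instance ae01_filter : Filter (almost_everywhere (@mu01 R)).
Proof. exact: ae_filter_ringOfSetsType. Qed.

Lemma ae_eq_Rintegral01 f g : measurable_fun setT f -> measurable_fun setT g ->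
  f = g %[ae mu01] -> \int[mu01]_x f x = \int[mu01]_x g x.
Proof.
move=> mf mg fg; rewrite /Rintegral; congr fine; apply: ae_eq_integral => //.
- exact/measurable_EFinP.
- exact/measurable_EFinP.
- by apply: filterS fg => x /= /[apply] ->.
Qed.

Lemma ipC u v : ip u v = ip v u.
Proof. by apply: eq_Rintegral => x _; rewrite mulrC. Qed.

Lemma ipDl u v w : ip (u + v) w = ip u w + ip v w.
Proof.
rewrite /ip -RintegralD //; [|exact: integrable_L2M|exact: integrable_L2M].
apply: ae_eq_Rintegral01.
- by apply: measurable_funM; exact: measurable_L2fun.
- by apply: measurable_funD; apply: measurable_funM; exact: measurable_L2fun.
- by apply: filterS (L2funD u v) => x /= /[apply] ->; rewrite mulrDl.
Qed.

Lemma ipZl a u w : ip (a *: u) w = a * ip u w.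
Proof.
rewrite /ip -RintegralZl //; last exact: integrable_L2M.
apply: ae_eq_Rintegral01.
- by apply: measurable_funM; exact: measurable_L2fun.
- by apply: measurable_funM => //; apply: measurable_funM; exact: measurable_L2fun.
- by apply: filterS (L2funZ a u) => x /= /[apply] ->; rewrite mulrA.
Qed.

Lemma ipDr u v w : ip w (u + v) = ip w u + ip w v.
Proof. by rewrite ipC ipDl !(ipC w). Qed.

Lemma ipZr a u w : ip w (a *: u) = a * ip w u.
Proof. by rewrite ipC ipZl ipC. Qed.

Lemma ip0l w : ip 0 w = 0.
Proof. by rewrite -(scale0r 0) ipZl mul0r. Qed.

Lemma ip0r w : ip w 0 = 0.
Proof. by rewrite ipC ip0l. Qed.

Lemma ipNl u w : ip (- u) w = - ip u w.
Proof. by rewrite -scaleN1r ipZl mulN1r. Qed.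

Lemma ipNr u w : ip w (- u) = - ip w u.
Proof. by rewrite ipC ipNl ipC. Qed.

Lemma ipBl u v w : ip (u - v) w = ip u w - ip v w.
Proof. by rewrite ipDl ipNl. Qed.

Lemma ipBr u v w : ip w (u - v) = ip w u - ip w v.
Proof. by rewrite ipDr ipNr. Qed.

Lemma ip_suml (I : Type) (s : seq I) (F : I -> U) w :
  ip (\sum_(i <- s) F i) w = \sum_(i <- s) ip (F i) w.
Proof.
elim: s => [|i s IH]; first by rewrite !big_nil ip0l.
by rewrite !big_cons ipDl IH.
Qed.

Lemma ip_sumr (I : Type) (s : seq I) (F : I -> U) w :
  ip w (\sum_(i <- s) F i) = \sum_(i <- s) ip w (F i).
Proof. by rewrite ipC ip_suml; apply: eq_bigr => i _; rewrite ipC. Qed.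

Lemma normD_sqr u v : `|u + v| ^+ 2 = `|u| ^+ 2 + 2 * ip u v + `|v| ^+ 2.
Proof. by rewrite -!ip_norm !ipDl !ipDr (ipC v u); ring. Qed.

Lemma ip_le u v : ip u v <= `|u| * `|v|.
Proof.
have [->|v0] := eqVneq v 0; first by rewrite ip0r normr0 mulr0.
have nv : 0 < `|v| by rewrite normr_gt0.
(* This square equals 2 |u| |v| (|u| |v| - <u, v>). *)
have h : 0 <= `| `|v| *: u - `|u| *: v| ^+ 2 by exact: sqr_ge0.
move: h; rewrite -ip_norm !(ipBl, ipBr, ipZl, ipZr) !ip_norm (ipC v u) => h.
have [->|u0] := eqVneq u 0; first by rewrite ip0l normr0 mul0r.
have nu : 0 < `|u| by rewrite normr_gt0.
rewrite -subr_ge0 -(pmulr_rge0 _ (_ : 0 < 2 * `|u| * `|v|)); last by rewrite !mulr_gt0.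
by apply: le_trans h _; rewrite le_eqVlt; apply/orP; left; apply/eqP; ring.
Qed.

Lemma normr_ip_le u v : `|ip u v| <= `|u| * `|v|.
Proof. by rewrite ler_norml ip_le andbT lerNl -ipNl (le_trans (ip_le _ _)) ?normrN. Qed.

Lemma ip_eq0 u : ip u u = 0 -> u = 0.
Proof. by move/eqP; rewrite ip_norm sqrf_eq0 normr_eq0 => /eqP. Qed.

(** Finite orthonormal families are kept as duplicate-free lists, so that sums over them are
    ordinary iterated sums; finite subsets of the bases enter through [fset_set]. *)
Definition onseq (s : seq U) := uniq s /\
  forall u v, u \in s -> v \in s -> ip u v = (u == v)%:R.

Lemma norm_lincomb (s : seq U) (c : U -> R) : onseq s ->
  `|\sum_(u <- s) c u *: u| ^+ 2 = \sum_(u <- s) c u ^+ 2.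
Proof.
move=> [us os]; rewrite -ip_norm ip_suml big_seq [RHS]big_seq.
apply: eq_bigr => u us'; rewrite ip_sumr (bigD1_seq u) //= big_seq_cond big1.
  by rewrite addr0 ipZl ipZr os // eqxx mulr1 expr2.
by move=> v /andP[vs vu]; rewrite ipZl ipZr os // eq_sym (negbTE vu) !mulr0.
Qed.

Lemma ip_lincomb (s : seq U) (c : U -> R) v : onseq s -> v \in s ->
  ip v (\sum_(u <- s) c u *: u) = c v.
Proof.
move=> [us os] vs; rewrite ip_sumr (bigD1_seq v) //= ipZr os // eqxx mulr1.
rewrite big_seq_cond big1 ?addr0 // => w /andP[ws wv].
by rewrite ipZr os // eq_sym (negbTE wv) mulr0.
Qed.

Lemma bessel (s : seq U) v : onseq s -> \sum_(u <- s) ip u v ^+ 2 <= `|v| ^+ 2.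
Proof.
move=> os; have := norm_lincomb (fun u => ip u v) os.
set p := \sum_(u <- s) _ => pE.
have ipp : ip p v = `|p| ^+ 2.
  by rewrite pE ip_suml; apply: eq_bigr => u _; rewrite ipZl expr2.
have : 0 <= `|v - p| ^+ 2 by exact: sqr_ge0.
rewrite -ip_norm !(ipBl, ipBr) !ip_norm (ipC v p) ipp -pE; lra.
Qed.

Lemma norm_proj (s : seq U) v : onseq s -> `|\sum_(u <- s) ip u v *: u| <= `|v|.
Proof.
move=> os; rewrite -(@ler_pXn2r _ 2) ?nnegrE // norm_lincomb //; exact: bessel.
Qed.

Lemma inL2P f : measurable_fun D01 f ->
  (\int[mu01]_x ((f \_ D01) x ^+ 2)%:E < +oo)%E -> inL2 f.
Proof.
move=> mf foo; have mf' : measurable_fun setT (f \_ D01).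
  by apply/(measurable_restrictT _ _).1 => //; exact: measurable_itv.
rewrite /inL2 inE; apply/andP; split; rewrite inE //= /finite_norm.
rewrite unlock /Lnorm poweR_lty //.
apply: le_lt_trans foo; rewrite le_eqVlt; apply/orP; left; apply/eqP.
apply: eq_integral => x _ /=.
by rewrite powR_mulrn // real_normK ?num_real.
Qed.

Lemma mu01_finite : (mu01 [set: R] < +oo)%E.
Proof.
have -> : mu01 [set: R] = lebesgue_measure (`]0%R, 1%R[%classic : set R).
  by rewrite /mu01 -[LHS]/(lebesgue_measure ([set: R] `&` _)) setTI.
by rewrite lebesgue_measure_itv /= lte_fin ltr01 sube0 ltry.
Qed.

End L2_theory.

(** * Integration over (0, 1) of continuous functions, and classes of functions in L^2 *)

Section C1_integrals.
Variable R : realType.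
Local Notation U := (L2 R).
Implicit Types (u v w : U) (f g : R -> R).

Lemma measurable_D01 : measurable (@D01 R).
Proof. exact: measurable_itv. Qed.

Lemma meas_patch01e (f : R -> \bar R) :
  measurable_fun D01 f -> measurable_fun setT (f \_ D01).
Proof. by move=> mf; apply/(measurable_restrictT _ _).1 => //; exact: measurable_itv. Qed.

Lemma meas_patch01 f : measurable_fun D01 f -> measurable_fun setT (f \_ D01).
Proof. by move=> mf; apply/(measurable_restrictT _ _).1 => //; exact: measurable_itv. Qed.

(** [mu01] is a measure on the whole line; facts that hold on [D01] reach its integrals as almost
    everywhere statements. *)
Lemma ae01_D : {ae mu01, forall x : R, D01 x}.
Proof.
exists (~` D01); split.
- exact: measurableC measurable_D01.
- by rewrite -[LHS]/(lebesgue_measure (~` D01 `&` D01)) setICl measure0.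
- by [].
Qed.

Lemma ae_eq_patch01 f : f \_ D01 = f %[ae mu01].
Proof.
by apply: filterS ae01_D => x Dx _; rewrite patchE mem_set.
Qed.

Lemma integral01E (f : R -> \bar R) : measurable_fun setT f ->
  (\int[mu01]_x f x = \int[lebesgue_measure]_(x in D01) f x)%E.
Proof.
move=> mf; transitivity (\int[mu01]_(x in D01) f x)%E; last first.
  apply: eq_measure_integral => A mA AD.
  by rewrite -[LHS]/(lebesgue_measure (A `&` D01)) setIidl.
rewrite [RHS]integral_mkcond; apply: ae_eq_integral => //.
- apply: meas_patch01e; exact: (measurable_funS measurableT _ mf).
- by apply: filterS ae01_D => x Dx _; rewrite patchE mem_set.
Qed.

Lemma cont_meas f : continuous f -> measurable_fun setT f.
Proof. exact: continuous_measurable_fun. Qed.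

Lemma integral01_cont f : continuous f ->
  (\int[mu01]_x (f x)%:E = \int[lebesgue_measure]_(x in `[0%R, 1%R]) (f x)%:E)%E.
Proof.
move=> cf; rewrite integral01E; last by apply/measurable_EFinP; exact: cont_meas.
rewrite (@integral_itv_bndoo _ _ _ _ true false) //.
by apply: measurable_funTS; apply/measurable_EFinP; exact: cont_meas.
Qed.

Lemma integrable01_cont f : continuous f -> mu01.-integrable setT (EFin \o f).
Proof.
move=> cf; apply/integrableP; split.
  by apply/measurable_EFinP; exact: cont_meas.
rewrite (_ : (fun _ => _) = (fun x => (`|f x|)%:E)) //.
have cnf : continuous (fun x => `|f x|).
  by move=> x; apply: continuous_comp; [exact: cf|exact: norm_continuous].
rewrite integral01_cont //.
have /integrableP[_] : lebesgue_measure.-integrable `[0%R, 1%R] (EFin \o f).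
  apply: continuous_compact_integrable; first exact: segment_compact.
  exact: continuous_subspaceT.
by [].
Qed.

Lemma deriv_cont f (F : R -> R) : (forall x : R, is_derive x 1 F (f x)) -> continuous F.
Proof.
move=> dF x; apply: differentiable_continuous; apply/derivable1_diffP.
by have := dF x => -[].
Qed.

Lemma deriv_oo f (F : R -> R) : (forall x : R, is_derive x 1 F (f x)) ->
  derivable_oo_LRcontinuous F 0 1.
Proof.
move=> dF; have cF := deriv_cont dF; split.
- by move=> x _; have := dF x => -[].
- by apply: cvg_at_right_filter; exact: cF.
- by apply: cvg_at_left_filter; exact: cF.
Qed.

Lemma derive1_is f (F : R -> R) (x : R) : is_derive x 1 F (f x) -> (F^`())%classic x = f x.
Proof. by rewrite derive1E => -[_ ->]. Qed.

Lemma FTC01 f F : (forall x : R, is_derive x 1 F (f x)) -> continuous f ->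
  \int[mu01]_x f x = F 1 - F 0.
Proof.
move=> dF cf; rewrite /Rintegral integral01_cont // (@continuous_FTC2 _ f F) //.
- exact: continuous_subspaceT.
- exact: deriv_oo.
- by move=> x _; exact: derive1_is.
Qed.

Lemma parts01 f F g G : (forall x : R, is_derive x 1 F (f x)) -> continuous f ->
  (forall x : R, is_derive x 1 G (g x)) -> continuous g ->
  \int[mu01]_x (F x * g x) = F 1 * G 1 - F 0 * G 0 - \int[mu01]_x (f x * G x).
Proof.
move=> dF cf dG cg; have cF := deriv_cont dF; have cG := deriv_cont dG.
have cFg : continuous (fun x => F x * g x).
  by move=> x; apply: continuousM; [exact: cF|exact: cg].
have cfG : continuous (fun x => f x * G x).
  by move=> x; apply: continuousM; [exact: cf|exact: cG].
have dFG (x : R) : is_derive x 1 (fun x => F x * G x) (F x * g x + f x * G x).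
  apply: is_derive_eq (@is_deriveM _ _ F G x 1 _ _ (dF x) (dG x)) _.
  by rewrite /GRing.scale /= [f x * G x]mulrC.
have := FTC01 dFG; rewrite RintegralD //; [|exact: integrable01_cont|exact: integrable01_cont].
move=> <-; first by rewrite addrK.
by move=> x; exact: (cvgD (cFg x) (cfG x)).
Qed.

Lemma L2_eq u v : L2fun u = L2fun v %[ae mu01] -> u = v.
Proof.
move=> uv; rewrite -[u](@LreprK _ _ _ mu01 _ (lee1n 2)) -[v](@LreprK _ _ _ mu01 _ (lee1n 2)).
exact: eq_Lclass.
Qed.

Lemma clsE f : inL2 f -> L2fun (cls f) = f %[ae mu01].
Proof.
by move=> /cls_ae cf; apply: filterS2 cf (ae_eq_patch01 f) => x h1 h2 I; rewrite h1 // h2.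
Qed.

Lemma cls_eq f g : (forall x, D01 x -> f x = g x) -> cls f = cls g.
Proof.
move=> fg; rewrite /cls; suff -> : f \_ D01 = g \_ D01 by [].
by apply/funext => x; rewrite !patchE; case: ifPn => // /set_mem /fg.
Qed.

Lemma cls_ae_eq f g : inL2 f -> inL2 g -> f = g %[ae mu01] -> cls f = cls g.
Proof.
move=> f2 g2 fg; apply: L2_eq.
by apply: filterS3 (clsE f2) (clsE g2) fg => x h1 h2 h3 I; rewrite h1 // h2 // h3.
Qed.

Lemma inL2_L2fun u : inL2 (L2fun u).
Proof.
apply: inL2P; first exact: measurable_funTS (measurable_L2fun u).
have -> : (\int[mu01]_x ((L2fun u \_ D01) x ^+ 2)%:E = \int[mu01]_x (L2fun u x * L2fun u x)%:E)%E.
  apply: ae_eq_integral => //.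
  - apply/measurable_EFinP; apply: measurable_funX.
    by apply: meas_patch01; apply: measurable_funTS; exact: measurable_L2fun.
  - by apply/measurable_EFinP; apply: measurable_funM; exact: measurable_L2fun.
  - by apply: filterS (ae_eq_patch01 (L2fun u)) => x /= h I; rewrite h // expr2.
have /integrableP[_] := integrable_L2M u u.
apply: le_lt_trans; apply: ge0_le_integral => //.
- by move=> x _; rewrite lee_fin -expr2 sqr_ge0.
- by apply/measurable_EFinP; apply: measurable_funM; exact: measurable_L2fun.
- by apply: measurableT_comp => //; apply/measurable_EFinP; apply: measurable_funM; exact: measurable_L2fun.
- by move=> x _ /=; rewrite lee_fin ler_norm.
Qed.

Lemma cls_L2fun u : cls (L2fun u) = u.
Proof. by apply: L2_eq; exact: clsE (inL2_L2fun u). Qed.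

Lemma inL2_meas f : inL2 f -> measurable_fun D01 f.
Proof.
rewrite /inL2 inE => /andP[]; rewrite inE => mf _.
by apply/(measurable_restrictT _ _).2 => //; exact: measurable_itv.
Qed.

(** Measurability of [f] is a separate hypothesis because almost everywhere equality does not
    transfer Borel measurability. *)
Lemma inL2_ae f g : measurable_fun D01 f -> inL2 g -> f = g %[ae mu01] -> inL2 f.
Proof.
move=> mf g2 fg; apply: (inL2P mf).
have -> : (\int[mu01]_x ((f \_ D01) x ^+ 2)%:E = \int[mu01]_x (L2fun (cls g) x * L2fun (cls g) x)%:E)%E.
  apply: ae_eq_integral => //.
  - by apply/measurable_EFinP; apply: measurable_funX; exact: meas_patch01.
  - by apply/measurable_EFinP; apply: measurable_funM; exact: measurable_L2fun.
  - apply: filterS3 (ae_eq_patch01 f) fg (clsE g2) => x h1 h2 h3 I.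
    by rewrite h1 // h2 // h3 // expr2.
have /integrableP[_] := integrable_L2M (cls g) (cls g).
apply: le_lt_trans; apply: ge0_le_integral => //.
- by move=> x _; rewrite lee_fin -expr2 sqr_ge0.
- by apply/measurable_EFinP; apply: measurable_funM; exact: measurable_L2fun.
- by apply: measurableT_comp => //; apply/measurable_EFinP; apply: measurable_funM; exact: measurable_L2fun.
- by move=> x _ /=; rewrite lee_fin ler_norm.
Qed.

(** Since [cls] takes the default value 0 off the square integrable functions, it is linear only on
    these, and membership has to be carried along. *)
Lemma cls_lin a f g : inL2 f -> inL2 g ->
  inL2 (fun x => a * f x + g x) /\ cls (fun x => a * f x + g x) = a *: cls f + cls g.
Proof.
move=> f2 g2; have E : (fun x => a * f x + g x) = L2fun (a *: cls f + cls g) %[ae mu01].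
  apply: filterS (filterI (filterI (clsE f2) (clsE g2)) (filterI (L2funD (a *: cls f) (cls g)) (L2funZ a (cls f)))).
  by move=> x [[h1 h2] [h3 h4]] I; rewrite h3 // h4 // h1 // h2.
have i2 : inL2 (fun x => a * f x + g x).
  apply: inL2_ae (inL2_L2fun _) E; apply: measurable_funD; last exact: inL2_meas.
  by apply: measurable_funM => //; exact: inL2_meas.
by split => //; rewrite (cls_ae_eq i2 (inL2_L2fun _) E) cls_L2fun.
Qed.

(** Applied to products of [sqrtQ u] with a bounded function, where [M] bounds that function. *)
Lemma inL2_dom f u M : measurable_fun D01 f ->
  (forall x, D01 x -> `|f x| <= M * `|L2fun u x|) -> 0 <= M ->
  inL2 f /\ `|cls f| <= M * `|u|.
Proof.
move=> mf fM M0.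
have mr : measurable_fun setT (f \_ D01).
  by exact: meas_patch01.
have iu := integrable_L2M u u.
have le : (\int[mu01]_x ((f \_ D01) x ^+ 2)%:E <= \int[mu01]_x (M ^+ 2 * (L2fun u x * L2fun u x))%:E)%E.
  apply: ge0_le_integral => //.
  - by move=> x _; rewrite lee_fin sqr_ge0.
  - by apply/measurable_EFinP; apply: measurable_funX.
  - apply/measurable_EFinP; apply: measurable_funM => //.
    by apply: measurable_funM; exact: measurable_L2fun.
  - move=> x _; rewrite lee_fin -expr2 -exprMn patchE; case: ifPn => [/set_mem /fM xM|_].
      rewrite -[leLHS]real_normK ?num_real // -[leRHS]real_normK ?num_real //.
      by rewrite ler_sqr ?nnegrE // normrM (ger0_norm M0).
    by rewrite expr0n sqr_ge0.
have E : (\int[mu01]_x (M ^+ 2 * (L2fun u x * L2fun u x))%:E = ((M * `|u|) ^+ 2)%:E)%E.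
  rewrite exprMn -ip_norm /ip /Rintegral EFinM fineK; last exact: integrable_fin_num.
  by rewrite -integralZl.
have f2 : inL2 f by apply: (inL2P mf); apply: le_lt_trans le _; rewrite E ltry.
split=> //; rewrite -(@ler_pXn2r _ 2) ?nnegrE ?mulr_ge0 // -lee_fin -E.
apply: le_trans le; rewrite -ip_norm /ip /Rintegral fineK; last exact: integrable_fin_num (integrable_L2M _ _).
rewrite le_eqVlt; apply/orP; left; apply/eqP; apply: ae_eq_integral => //.
- by apply/measurable_EFinP; apply: measurable_funM; exact: measurable_L2fun.
- by apply/measurable_EFinP; apply: measurable_funX.
- by apply: filterS (cls_ae f2) => x h I; rewrite h // expr2.
Qed.

Lemma ip_clsE f u : inL2 f -> ip (cls f) u = \int[mu01]_x ((f \_ D01) x * L2fun u x).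
Proof.
move=> f2; apply: ae_eq_Rintegral01.
- by apply: measurable_funM; exact: measurable_L2fun.
- apply: measurable_funM; last exact: measurable_L2fun.
  by apply: meas_patch01; exact: inL2_meas.
- by apply: filterS (cls_ae f2) => x h I; rewrite h.
Qed.

Lemma ip_cls f g : inL2 f -> inL2 g -> measurable_fun setT f -> measurable_fun setT g ->
  ip (cls f) (cls g) = \int[mu01]_x (f x * g x).
Proof.
move=> f2 g2 mf mg; apply: ae_eq_Rintegral01.
- by apply: measurable_funM; exact: measurable_L2fun.
- exact: measurable_funM.
- by apply: filterS2 (clsE f2) (clsE g2) => x h1 h2 I; rewrite h1 // h2.
Qed.

Lemma inL2_cont f : continuous f -> inL2 f.
Proof.
move=> cf; apply: inL2P; first exact: measurable_funTS (cont_meas cf).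
have cff : continuous (fun x => f x * f x).
  by move=> x; apply: continuousM; exact: cf.
have /integrableP[_] := integrable01_cont cff.
apply: le_lt_trans; apply: ge0_le_integral => //.
- by move=> x _; rewrite lee_fin sqr_ge0.
- apply/measurable_EFinP; apply: measurable_funX.
  by apply: meas_patch01; apply: measurable_funTS; exact: cont_meas.
- by apply: measurableT_comp => //; apply/measurable_EFinP; exact: cont_meas.
- move=> x _ /=; rewrite lee_fin -expr2 ger0_norm ?sqr_ge0 // patchE.
  by case: ifP => // _; rewrite expr0n sqr_ge0.
Qed.

Lemma ip_cls_cont f g : continuous f -> continuous g ->
  ip (cls f) (cls g) = \int[mu01]_x (f x * g x).
Proof. by move=> cf cg; apply: ip_cls; (exact: inL2_cont || exact: cont_meas). Qed.

End C1_integrals.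

(* The polynomials (1 - s^n)^(2^n) of Brosowski and Deutsch's proof of the
   Stone-Weierstrass theorem. *)
Section step_polynomials.
Variable R : realType.
Implicit Types (s y z : R).

Lemma bernoulli_ge y n : 0 <= 1 + y -> 1 + n%:R * y <= (1 + y) ^+ n.
Proof.
move=> y1; elim: n => [|n IH]; first by rewrite mul0r addr0 expr0.
rewrite exprS; apply: (@le_trans _ _ ((1 + y) * (1 + n%:R * y))).
  have : 0 <= n%:R * y ^+ 2 by rewrite mulr_ge0 // sqr_ge0.
  by rewrite -natr1; nra.
by rewrite ler_wpM2l.
Qed.

(** Bernoulli's inequality gives the lower bound 1 - (2 s)^n. *)
Lemma step_cvg1 s : 0 <= s -> 2 * s < 1 -> (1 - s ^+ n) ^+ (2 ^ n) @[n --> \oo] --> (1 : R).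
Proof.
move=> s0 s1; have s1' : s <= 1 by lra.
apply: (@squeeze_cvgr _ _ _ _ (fun n => 1 - (2 * s) ^+ n) (fun=> 1)).
- apply: nearW => n; have sn0 : 0 <= s ^+ n by exact: exprn_ge0.
  have sn1 : s ^+ n <= 1 by exact: exprn_ile1.
  apply/andP; split; last by rewrite exprn_ile1 ?subr_ge0 // gerBl.
  have := @bernoulli_ge (- s ^+ n) (2 ^ n); rewrite subr_ge0 => /(_ sn1).
  by rewrite natrX mulrN -exprMn.
- rewrite -[X in _ --> X]subr0; apply: cvgB; first exact: cvg_cst.
  by apply: cvg_expr; rewrite ger0_norm // mulr_ge0.
- exact: cvg_cst.
Qed.

Lemma step_cvg0 s : s <= 1 -> 1 < 2 * s -> (1 - s ^+ n) ^+ (2 ^ n) @[n --> \oo] --> (0 : R).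
Proof.
move=> s1 s2; have s0 : 0 < s by lra.
apply: (@squeeze_cvgr _ _ _ _ (fun=> 0) (fun n => ((2 * s)^-1) ^+ n)).
- apply: nearW => n; have sn0 : 0 < s ^+ n by exact: exprn_gt0.
  have sn1 : s ^+ n <= 1 by apply: exprn_ile1 => //; exact: ltW.
  apply/andP; split; first by rewrite exprn_ge0 // subr_ge0.
  rewrite exprVn -[leRHS]mul1r ler_pdivlMr ?exprn_gt0 //; last by lra.
  (* Bernoulli's inequality gives (2 s)^n <= (1 + s^n)^(2^n), and (1 - a) (1 + a) <= 1. *)
  apply: (@le_trans _ _ ((1 - s ^+ n) ^+ (2 ^ n) * (1 + s ^+ n) ^+ (2 ^ n))).
    apply: ler_wpM2l; first by rewrite exprn_ge0 // subr_ge0.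
    have := @bernoulli_ge (s ^+ n) (2 ^ n) _; rewrite natrX -exprMn => h.
    by apply: le_trans (h _); [rewrite lerDr|rewrite addr_ge0 // ltW].
  rewrite -exprMn; apply: exprn_ile1.
    by rewrite mulr_ge0 ?subr_ge0 // addr_ge0 // ltW.
  by have := sqr_ge0 (s ^+ n); nra.
- exact: cvg_cst.
- by apply: cvg_expr; rewrite ger0_norm ?invr_ge0; [rewrite invf_lt1; lra|lra].
Qed.
End step_polynomials.

(** * Completeness of the sines in L^2(0, 1) *)

Section sine_system.
Variable R : realType.
Local Notation U := (L2 R).
Implicit Types (x a : R).
Local Notation mu := (@lebesgue_measure R).

Definition sn (n : nat) (x : R) : R := sin (n%:R * pi * x).
Definition cn (n : nat) (x : R) : R := cos (n%:R * pi * x).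

Lemma is_derive_scale (k x : R) : is_derive x 1 (fun y : R => k * y) k.
Proof.
rewrite -[X in is_derive _ _ _ X](mulr1 k).
exact: (@is_deriveZ R R R id k x 1 1 (is_derive_id x 1)).
Qed.

Lemma is_derive_sn n x : is_derive x 1 (sn n) (n%:R * pi * cn n x).
Proof.
rewrite mulrC.
exact: (@is_derive1_comp _ sin (fun y : R => n%:R * pi * y) x _ _ _ (is_derive_scale _ x)).
Qed.

Lemma is_derive_cn n x : is_derive x 1 (cn n) (- (n%:R * pi) * sn n x).
Proof.
rewrite mulrC mulrN -mulNr.
exact: (@is_derive1_comp _ cos (fun y : R => n%:R * pi * y) x _ _ _ (is_derive_scale _ x)).
Qed.

Lemma cont_sn n : continuous (sn n).
Proof. exact: deriv_cont (is_derive_sn n). Qed.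

Lemma cont_cn n : continuous (cn n).
Proof. exact: deriv_cont (is_derive_cn n). Qed.

Lemma sn_bound n x : `|sn n x| <= 1.
Proof. by rewrite ler_norml sin_geN1 sin_le1. Qed.

Lemma cn_bound n x : `|cn n x| <= 1.
Proof. by rewrite ler_norml cos_geN1 cos_le1. Qed.

Lemma sn0 n : sn n 0 = 0.
Proof. by rewrite /sn mulr0 sin0. Qed.

Lemma sn1 n : sn n 1 = 0.
Proof.
rewrite /sn mulr1; elim: n => [|n IH]; first by rewrite mul0r sin0.
by rewrite -natr1 mulrDl mul1r sinD IH mul0r sinpi mulr0 addr0.
Qed.

(** Multiplication by cos(pi x) preserves the span of the sines; this drives the induction in
    [orth_sncn]. *)
Lemma snS_cos n x : sn n.+1 x * cn 1 x = 2^-1 * sn n.+2 x + 2^-1 * sn n x.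
Proof.
rewrite /sn /cn.
have -> : n.+2%:R * pi * x = n.+1%:R * pi * x + 1%:R * pi * x :> R by rewrite -[n.+2%:R]natr1; ring.
have -> : n%:R * pi * x = n.+1%:R * pi * x - 1%:R * pi * x :> R by rewrite -[n.+1%:R]natr1; ring.
by rewrite sinD sinB; field.
Qed.

Variable h : U.
Hypothesis h_orth : forall n, (0 < n)%N -> \int[mu01]_x (L2fun h x * sn n x) = 0.

Lemma integrable_hM (f : R -> R) : measurable_fun setT f -> (exists M, forall x, `|f x| <= M) ->
  mu01.-integrable setT (EFin \o (fun x => L2fun h x * f x)).
Proof.
move=> mf [M fM].
(* The dominating function: |h| M <= h^2 + M^2, and [mu01] is finite. *)
have i2 : mu01.-integrable setT (fun x : R => ((L2fun h x * L2fun h x)%:E + (M ^+ 2)%:E)%E).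
  apply: integrableD => //; first exact: integrable_L2M.
  apply/integrableP; split => //.
  have -> : (fun=> `|(M ^+ 2)%:E|)%E = cst (M ^+ 2)%:E :> (R -> \bar R).
    by apply/funext => x /=; rewrite ger0_norm ?sqr_ge0.
  rewrite integral_cst // -ge0_fin_numE; last by rewrite mule_ge0 // lee_fin sqr_ge0.
  by rewrite fin_numM // ge0_fin_numE // mu01_finite.
apply: le_integrable i2 => //.
- by apply/measurable_EFinP; apply: measurable_funM => //; exact: measurable_L2fun.
- move=> x _ /=; rewrite lee_fin [leRHS]ger0_norm ?addr_ge0 -?expr2 ?sqr_ge0 // normrM.
  have := fM x; rewrite -[L2fun h x ^+ 2]real_normK ?num_real //.
  have := normr_ge0 (f x); have := normr_ge0 (L2fun h x).
  move: `|L2fun h x| `|f x| => u v u0 v0 vM.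
  have : 0 <= u * (M - v) by rewrite mulr_ge0 // subr_ge0.
  have := sqr_ge0 (u - M); have := sqr_ge0 u; have := sqr_ge0 M; nra.
Qed.

Lemma meas_sn n : measurable_fun setT (sn n).
Proof. exact: cont_meas (@cont_sn n). Qed.

Lemma meas_cn n : measurable_fun setT (cn n).
Proof. exact: cont_meas (@cont_cn n). Qed.

Lemma integrable_h_sncn n m :
  mu01.-integrable setT (EFin \o (fun x => L2fun h x * (sn n x * cn 1 x ^+ m))).
Proof.
apply: integrable_hM.
  by apply: measurable_funM; [exact: meas_sn|apply: measurable_funX; exact: meas_cn].
exists 1 => x; rewrite normrM normrX mulr_ile1 ?exprn_ge0 ?sn_bound //.
by rewrite exprn_ile1 ?cn_bound.
Qed.

Lemma orth_sncn m n : \int[mu01]_x (L2fun h x * (sn n x * cn 1 x ^+ m)) = 0.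
Proof.
elim: m n => [|m IH] [|n].
- under eq_Rintegral do rewrite /sn !mul0r sin0 mul0r mulr0.
  by rewrite Rintegral_cst // mul0r.
- by under eq_Rintegral do rewrite expr0 mulr1; exact: h_orth.
- under eq_Rintegral do rewrite /sn !mul0r sin0 mul0r mulr0.
  by rewrite Rintegral_cst // mul0r.
- under eq_Rintegral => x _.
    have -> : L2fun h x * (sn n.+1 x * cn 1 x ^+ m.+1) =
      2^-1 * (L2fun h x * (sn n.+2 x * cn 1 x ^+ m)) +
      2^-1 * (L2fun h x * (sn n x * cn 1 x ^+ m)).
      by rewrite exprS (mulrA (sn _ _)) snS_cos; ring.
    over.
  rewrite RintegralD //.
  + rewrite !RintegralZl ?IH ?mulr0 ?addr0 //; exact: integrable_h_sncn.
  + exact: (integrableZl _ _ (integrable_h_sncn _ _)).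
  + exact: (integrableZl _ _ (integrable_h_sncn _ _)).
Qed.

Lemma horner_bound (p : {poly R}) : exists M, forall y : R, `|y| <= 1 -> `|p.[y]| <= M.
Proof.
elim/poly_ind: p => [|p c [M pM]]; first by exists 0 => y _; rewrite horner0 normr0.
exists (M + `|c|) => y y1; rewrite hornerMXaddC (le_trans (ler_normD _ _)) // lerD2r normrM.
by apply: le_trans (pM y y1); rewrite ler_piMr.
Qed.

Lemma cont_horner_cn (p : {poly R}) : continuous (fun x => p.[cn 1 x]).
Proof.
by move=> x; apply: continuous_comp; [exact: cont_cn|exact: continuous_horner].
Qed.

Lemma integrable_h_poly (p : {poly R}) m :
  mu01.-integrable setT (EFin \o (fun x => L2fun h x * (sn 1 x * cn 1 x ^+ m * p.[cn 1 x]))).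
Proof.
apply: integrable_hM.
  apply: measurable_funM; last exact: cont_meas (@cont_horner_cn p).
  by apply: measurable_funM; [exact: meas_sn|apply: measurable_funX; exact: meas_cn].
have [M pM] := horner_bound p; exists M => x; rewrite normrM.
apply: le_trans (pM _ (cn_bound 1 x)); rewrite ler_piMl //.
rewrite normrM normrX mulr_ile1 ?exprn_ge0 ?sn_bound //.
by rewrite exprn_ile1 ?cn_bound.
Qed.

(** The extra power [m] lets the induction on [p] absorb the factor 'X into the power of the
    cosine. *)
Lemma orth_poly (p : {poly R}) m :
  \int[mu01]_x (L2fun h x * (sn 1 x * cn 1 x ^+ m * p.[cn 1 x])) = 0.
Proof.
elim/poly_ind: p m => [|p c IH] m.
  under eq_Rintegral do rewrite horner0 !mulr0.
  by rewrite Rintegral_cst // mul0r.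
under eq_Rintegral => x _.
  have -> : L2fun h x * (sn 1 x * cn 1 x ^+ m * (p * 'X + c%:P).[cn 1 x]) =
     L2fun h x * (sn 1 x * cn 1 x ^+ m.+1 * p.[cn 1 x]) +
     c * (L2fun h x * (sn 1 x * cn 1 x ^+ m)).
    by rewrite hornerMXaddC exprSr; ring.
  over.
rewrite RintegralD //; last 2 first.
- exact: integrable_h_poly.
- exact: (integrableZl _ _ (integrable_h_sncn _ _)).
rewrite IH RintegralZl //; last exact: integrable_h_sncn.
by rewrite orth_sncn mulr0 addr0.
Qed.

End sine_system.

Section sine_complete.
Variable R : realType.
Local Notation U := (L2 R).
Implicit Types (x a : R).
Local Notation mu := (@lebesgue_measure R).
Variable h : U.
Hypothesis h_orth : forall n, (0 < n)%N -> \int[mu01]_x (L2fun h x * sn n x) = 0.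

Local Instance ae_lebesgue_filter : Filter (almost_everywhere mu).
Proof. exact: ae_filter_ringOfSetsType. Qed.

(** The factor [sn 1] is the one in [orth_poly] and is positive on (0, 1), so it suffices that [g]
    vanishes almost everywhere. Extension by 0 makes Lebesgue differentiation on the line
    available. *)
Let g : R -> R := (fun x => L2fun h x * sn 1 x) \_ D01.

Let mg0 : measurable_fun setT (fun x : R => L2fun h x * sn 1 x).
Proof. by apply: measurable_funM; [exact: measurable_L2fun|exact: meas_sn]. Qed.

Let mg : measurable_fun setT g.
Proof. by apply: meas_patch01; exact: measurable_funTS. Qed.

Let int_patch (f : R -> R) : measurable_fun setT f ->
  (\int[mu01]_x (f x)%:E = \int[mu]_x ((f \_ D01) x)%:E)%E.
Proof.
move=> mf; rewrite integral01E; last exact/measurable_EFinP.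
by rewrite integral_mkcond; under eq_integral do rewrite restrict_EFin.
Qed.

Let ig : mu.-integrable setT (EFin \o g).
Proof.
apply/integrableP; split; first exact/measurable_EFinP.
have /integrableP[_] := integrable_hM h (@meas_sn R 1) (ex_intro _ 1 (@sn_bound R 1)).
rewrite (_ : (\int[mu01]_x _)%E = (\int[mu01]_x (`|L2fun h x * sn 1 x|)%:E)%E); last by [].
rewrite int_patch; last exact: measurableT_comp.
apply: le_lt_trans; rewrite le_eqVlt; apply/orP; left; apply/eqP.
apply: eq_integral => x _ /=.
by rewrite /g !patchE; case: ifP => //; rewrite normr0.
Qed.

(** The base 1/2 + (cos(pi a) - cos(pi x)) / 4 lies in [0, 1] and, since the cosine decreases on
    [0, pi], is below 1/2 for x < a and above 1/2 for x > a. So these polynomials in cos(pi x) tend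
    to the indicator of x < a on (0, 1), away from a. *)
Let step a (n : nat) x : R := (1 - (2^-1 + (cos (pi * a) - cn 1 x) / 4) ^+ n) ^+ (2 ^ n).

Let step_orth a n : (\int[mu]_x (g x * step a n x)%:E = 0)%E.
Proof.
pose p : {poly R} := (1 - ((2^-1 + cos (pi * a) / 4)%:P - (4^-1)%:P * 'X) ^+ n) ^+ (2 ^ n).
have pE x : p.[cn 1 x] = step a n x.
  rewrite /p /step !(hornerE, horner_exp); by congr ((1 - _ ^+ _) ^+ _); field.
have H : (\int[mu01]_x (L2fun h x * (sn 1 x * cn 1 x ^+ 0 * p.[cn 1 x]))%:E = 0)%E.
  by rewrite -[LHS]fineK ?(integrable_fin_num measurableT (integrable_h_poly h p 0)) // [X in X%:E](orth_poly h_orth p 0).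
rewrite -H int_patch.
  apply: eq_integral => x _; rewrite -pE /g !patchE; case: ifP => _.
    by rewrite expr0 mulr1 mulrA.
  by rewrite mul0r.
apply: measurable_funM; first exact: measurable_L2fun.
apply: measurable_funM; last exact: cont_meas (@cont_horner_cn R p).
by apply: measurable_funM; [exact: meas_sn|apply: measurable_funX; exact: meas_cn].
Qed.

(** Dominated convergence with bound |g|: the integrals of [g] against [step a n] are all 0 and tend
    to the one in question. *)
Let int_le a : 0 < a -> a < 1 -> (\int[mu]_(x in `]-oo, a]) (g x)%:E = 0)%E.
Proof.
move=> a0 a1.
pose s x : R := 2^-1 + (cos (pi * a) - cn 1 x) / 4.
have s01 x : 0 <= s x <= 1.
  have := cn_bound 1 x; rewrite ler_norml => /andP[].
  have := cos_geN1 (pi * a); have := cos_le1 (pi * a); rewrite /s; lra.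
have spi x : D01 x -> pi * x \in `[0, pi].
  rewrite /D01 /= in_itv /= => /andP[x0 x1]; rewrite in_itv /=.
  by rewrite mulr_ge0 ?pi_ge0 ?(ltW x0) //= ler_piMr ?pi_ge0 // ltW.
have ad : D01 a by rewrite /D01 /= in_itv /= a0.
have cnE x : cn 1 x = cos (pi * x) by rewrite /cn mul1r.
have [|||||_ _ H] := @dominated_convergence _ _ _ mu setT measurableT
  (fun n x => (g x * step a n x)%:E) (fun x => ((g \_ `]-oo, a]) x)%:E)
  (fun x => (`|g x|)%:E).
- move=> n; apply/measurable_EFinP; apply: measurable_funM => //.
  apply: measurable_funX; apply: measurable_funB => //; apply: measurable_funX.
  apply: measurable_funD => //; apply: measurable_funM => //.
  by apply: measurable_funB => //; exact: meas_cn.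
- apply/measurable_EFinP.
  by apply/(measurable_restrictT _ _).1 => //; exact: measurable_funTS.
(* At x = a the base is exactly 1/2, which neither limit covers. *)
- have na : {ae mu, forall x, x != a}.
    exists [set a]; split => //; first exact: lebesgue_measure_set1.
    by move=> x /= /negP; rewrite negbK => /eqP.
  apply: filterS na => x xa _; apply: cvg_EFin; first exact: nearW.
  rewrite /comp /=.
  have [Dx|Dx] := pselect (D01 x); last first.
    have -> : g x = 0 by rewrite /g patchE memNset.
    under eq_fun do rewrite mul0r.
    rewrite patchE (_ : g x = 0); last by rewrite /g patchE memNset.
    by rewrite if_same; exact: cvg_cst.
  rewrite patchE; case: (ltgtP x a) xa => // [xa|xa] _.
  + rewrite mem_set /=; last by rewrite in_itv /= ltW.
    rewrite -[X in _ --> X]mulr1; apply: cvgM; first exact: cvg_cst.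
    apply: step_cvg1; first by have /andP[] := s01 x.
    have : cos (pi * a) < cos (pi * x).
      by rewrite ltr_cos ?spi // ltr_pM2l // pi_gt0.
    by rewrite cnE; lra.
  + rewrite memNset /=; last by rewrite in_itv /= leNgt xa.
    rewrite -[X in _ --> X](mulr0 (g x)); apply: cvgM; first exact: cvg_cst.
    apply: step_cvg0; first by have /andP[] := s01 x.
    have : cos (pi * x) < cos (pi * a).
      by rewrite ltr_cos ?spi // ltr_pM2l // pi_gt0.
    by rewrite cnE; lra.
- exact: (integrable_abse ig).
- apply: aeW => x n _ /=; rewrite lee_fin normrM ler_piMr //.
  have /andP[s0 s1] := s01 x; have sn0 : 0 <= s x ^+ n by exact: exprn_ge0.
  have sn1 : s x ^+ n <= 1 by exact: exprn_ile1.
  rewrite /step -/(s x) ger0_norm ?exprn_ge0 ?subr_ge0 //.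
  by rewrite exprn_ile1 ?subr_ge0 // gerBl.
- have {}H : (\int[mu]_x ((g \_ `]-oo, a]) x)%:E = 0)%E.
    have := cvg_lim (@ereal_hausdorff R) H => <-.
    rewrite (_ : [sequence _]_n = cst 0%E); last by apply/funext => n; exact: step_orth.
    by apply: lim_cst; exact: ereal_hausdorff.
  by rewrite integral_mkcond; under eq_integral do rewrite restrict_EFin.
Qed.

(** All integrals of [g] over half-lines vanish, so [g] is 0 almost everywhere by Lebesgue
    differentiation, and sin(pi x) > 0 on (0, 1) can be divided out. *)
Lemma sine_complete : h = 0.
Proof.
have locg : locally_integrable [set: R] g.
  have -> : g = g \_ setT by apply/funext => x; rewrite patchE in_setT.
  exact: integrable_locally.
have F0 x : (\int[mu]_(t in `]-oo, x]) g t)%R = 0.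
  rewrite /Rintegral; case: (leP x 0) => [x0|x0].
    rewrite integral0_eq // => y; rewrite /= in_itv /= => yx.
    rewrite /g patchE memNset // /D01 /= in_itv /= => /andP[y0 _].
    by have := le_trans yx x0; rewrite leNgt y0.
  case: (ltP x 1) => [x1|x1]; first by rewrite int_le.
  (* For x >= 1 the half-line contains (0, 1), and the constant polynomial 1 gives the whole
     integral. *)
  have := orth_poly h_orth 1 0; rewrite /Rintegral => <-.
  rewrite int_patch; last first.
    under eq_fun do rewrite expr0 mulr1 hornerC mulr1.
    exact: mg0.
  rewrite integral_mkcond; congr fine; apply: eq_integral => y _.
  rewrite restrict_EFin /g !patchE expr0 mulr1 hornerC mulr1.
  rewrite /= ?patchE; have [yD|yD] := boolP (y \in D01); last by rewrite if_same.
  rewrite mem_set //=; move: yD; rewrite inE /D01 /= in_itv /= => /andP[_ y1].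
  by rewrite in_itv /= ltW // (lt_le_trans y1).
have ae0 : {ae mu, forall x, g x = 0}.
  have intg y : mu.-integrable `]-oo, y] (EFin \o g) by apply: integrableS ig.
  have := @FTC1Ny R g intg locg.
  apply: filterS => x [_]; rewrite (_ : (fun _ => _) = cst 0); last exact/funext.
  by rewrite derive1_cst => <-.
apply: L2_eq.
have ae1 : {ae mu01, forall x, g x = 0}.
  case: ae0 => N [mN N0 sub]; exists N; split => //.
  rewrite -[LHS]/(mu (N `&` D01)); apply/eqP; rewrite -measure_le0 -N0.
  apply: le_measure; rewrite ?inE; last exact: subIsetl.
    apply: measurableI => //; exact: measurable_D01.
  exact: mN.
have z0 : L2fun (0 : U) = 0 %[ae mu01].
  by have := L2funZ 0 (0 : U); rewrite scale0r; apply: filterS => x /= H I; rewrite H // mul0r.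
apply: filterS3 ae1 z0 (@ae01_D R) => x gx zx Dx I; rewrite zx //=.
move: gx; rewrite /g patchE mem_set // => /eqP; rewrite mulf_eq0 => /orP[/eqP //|].
move: Dx; rewrite /D01 /= in_itv /= => /andP[x0 x1].
rewrite gt_eqF // /sn mul1r sin_gt0_pi //.
by rewrite mulr_gt0 ?pi_gt0 //= gtr_pMr ?pi_gt0.
Qed.

End sine_complete.

(** * Integrals against densities, independence and Gaussian moments *)

Section density.
Local Open Scope ereal_scope.
Context d (T : measurableType d) (R : realType).
Variables (mu m : {measure set T -> \bar R}) (p : T -> R).
Hypotheses (mp : measurable_fun setT p) (p0 : forall x, (0 <= p x)%R).
Hypothesis mE : forall A, measurable A -> m A = \int[mu]_(x in A) (p x)%:E.

Import HBNNSimple.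

Let integral_density_nnsfun (f : {nnsfun T >-> R}) :
  \int[m]_x (f x)%:E = \int[mu]_x ((f x)%:E * (p x)%:E).
Proof.
under [LHS]eq_integral do rewrite fimfunE -fsumEFin//.
rewrite [LHS]ge0_integral_fsum//; last 2 first.
  - by move=> r; exact/measurable_EFinP/measurableT_comp.
  - by move=> n x _; rewrite EFinM nnfun_muleindic_ge0.
under [RHS]eq_integral.
  move=> x xD; rewrite fimfunE -fsumEFin// muleC ge0_mule_fsumr; last first.
    by move=> r; rewrite EFinM nnfun_muleindic_ge0.
  over.
rewrite [RHS]ge0_integral_fsum//; last 2 first.
  - move=> r; apply: emeasurable_funM; first exact/measurable_EFinP.
    by apply/measurable_EFinP; exact/measurableT_comp.
  - move=> n x _; apply: mule_ge0; first by rewrite lee_fin.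
    by rewrite EFinM nnfun_muleindic_ge0.
apply: eq_fsbigr => r _.
rewrite integralZl_indic_nnsfun//= integral_indic//= setIT mE//.
set E := f @^-1` [set r].
have -> : \int[mu]_(x in E) (p x)%:E = \int[mu]_x ((p x)%:E * (\1_E x)%:E).
  rewrite integral_mkcond; apply: eq_integral => x _.
  by rewrite patchE indicE; case: (x \in _); rewrite ?mule1 ?mule0.
transitivity (\int[mu]_x (r%:E * ((p x)%:E * (\1_E x)%:E))); last first.
  by apply: eq_integral => x _; rewrite -!EFinM mulrCA.
have mpE : measurable_fun setT (fun x => (p x)%:E * (\1_E x)%:E).
  by apply: emeasurable_funM; apply/measurable_EFinP => //; apply: measurable_indic; exact: measurable_funPTI.
have [r0|r0] := leP 0%R r.
  rewrite -ge0_integralZl // => x _.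
  by rewrite -EFinM lee_fin mulr_ge0 // indicE.
rewrite /E preimage_nnfun0 //.
by rewrite !integral0_eq ?mule0 // => x _; rewrite indic0 !mule0.
Qed.

(** From indicators to simple functions, then monotone convergence. *)
Lemma ge0_integral_density (f : T -> \bar R) :
  measurable_fun setT f -> (forall x, 0 <= f x) ->
  \int[m]_x f x = \int[mu]_x (f x * (p x)%:E).
Proof.
move=> mf f0.
pose f_ := nnsfun_approx measurableT mf.
have fE x : (f_ n x)%:E @[n --> \oo] --> f x.
  by apply: cvg_nnsfun_approx.
transitivity (lim (\int[m]_x (f_ n x)%:E @[n --> \oo])).
  rewrite -monotone_convergence//=.
  - by apply: eq_integral => x _; apply/esym/cvg_lim.
  - by move=> n; exact/measurable_EFinP.
  - by move=> n x _; rewrite lee_fin.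
  - by move=> x _ a b ab; rewrite lee_fin; exact/lefP/nd_nnsfun_approx.
under eq_fun do rewrite integral_density_nnsfun.
rewrite -monotone_convergence//=.
- apply: eq_integral => x _; apply/cvg_lim => //.
  by apply: cvgeZr.
- move=> n; apply: emeasurable_funM; exact/measurable_EFinP.
- by move=> n x _; rewrite mule_ge0 ?lee_fin.
- move=> x _ a b ab; rewrite lee_wpmul2r ?lee_fin//; exact/lefP/nd_nnsfun_approx.
Qed.

End density.

Section indep.
Local Open Scope ereal_scope.
Context d d1 d2 (Omega : measurableType d) (T1 : measurableType d1) (T2 : measurableType d2) (R : realType).
Variable P : probability Omega R.
Variables (X : Omega -> T1) (Z : Omega -> T2).
Hypotheses (mX : measurable_fun setT X) (mZ : measurable_fun setT Z).
Hypothesis XZ : forall A B, measurable A -> measurable B ->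
  P (X @^-1` A `&` Z @^-1` B) = P (X @^-1` A) * P (Z @^-1` B).

(** The law of the pair agrees with the product of the laws on rectangles, hence everywhere; Tonelli
    does the rest. The inner variable [v] acts as an independent copy of [w]. *)
Lemma ge0_integral_indep (f : T1 * T2 -> \bar R) :
  measurable_fun setT f -> (forall x, 0 <= f x) ->
  measurable_fun setT (fun w => \int[P]_v f (X w, Z v)) /\
  \int[P]_w f (X w, Z w) = \int[P]_w \int[P]_v f (X w, Z v).
Proof.
move=> mf f0.
have mXZ : measurable_fun setT (fun w => (X w, Z w)) by exact: measurable_fun_pair.
pose mXi := isMeasurableFun.Build _ _ _ _ _ mX.
pose Xp : {mfun Omega >-> T1} := HB.pack X mXi.
pose mZi := isMeasurableFun.Build _ _ _ _ _ mZ.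
pose Zp : {mfun Omega >-> T2} := HB.pack Z mZi.
pose mXZi := isMeasurableFun.Build _ _ _ _ _ mXZ.
pose XZp : {mfun Omega >-> (T1 * T2)%type} := HB.pack (fun w => (X w, Z w)) mXZi.
pose m1 := distribution P Xp.
pose m2 := distribution P Zp.
pose m := distribution P XZp.
have FE w : fubini_F m2 f (X w) = \int[P]_v f (X w, Z v).
  apply: (@ge0_integral_distribution _ _ _ _ _ P Zp (fun y => f (X w, y))) => //.
  by apply: measurableT_comp => //; exact: pair1_measurable.
have mF : measurable_fun setT (fubini_F m2 f) by exact: measurable_fun_fubini_tonelli_F.
split.
  rewrite (_ : (fun w => _) = fubini_F m2 f \o X); last by apply/funext => w; rewrite /= FE.
  exact: measurableT_comp mX.
have -> : \int[P]_w f (X w, Z w) = \int[m]_z f z.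
  by rewrite ge0_integral_distribution.
have -> : \int[m]_z f z = \int[m1 \x m2]_z f z.
  by apply: eq_measure_integral => A mA _; apply/esym/product_measure_unique.
rewrite fubini_tonelli1 // /m1 ge0_integral_distribution //; last first.
  by move=> x; apply: integral_ge0.
by apply: eq_integral => w _; exact: FE.
Qed.

End indep.

Section normal.
Variable R : realType.
Implicit Types (k s x : R).

Lemma ge0_integral_normal s (f : R -> \bar R) : measurable_fun setT f -> (forall x, 0 <= f x)%E ->
  (\int[normal_prob 0%R s]_x f x = \int[lebesgue_measure]_x (f x * (normal_pdf 0 s x)%:E))%E.
Proof.
move=> mf f0; apply: ge0_integral_density => //.
- exact: measurable_normal_pdf.
- by move=> x; exact: normal_pdf_ge0.
Qed.

(** Completing the square: the factor exp(k x) shifts the mean to k s^2. *)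
Lemma normal_mgf k s : 0 < s ->
  (\int[normal_prob 0%R s]_x (expR (k * x))%:E = (expR (k ^+ 2 * s ^+ 2 / 2))%:E)%E.
Proof.
move=> s0; have sn0 : s != 0 by rewrite gt_eqF.
rewrite ge0_integral_normal; last 2 first.
- by apply/measurable_EFinP; apply: measurableT_comp => //; exact: measurable_funM.
- by move=> x; rewrite lee_fin expR_ge0.
have mulE : (\int[lebesgue_measure]_x ((expR (k ^+ 2 * s ^+ 2 / 2))%:E * (normal_pdf (k * s ^+ 2) s x)%:E) =
    (expR (k ^+ 2 * s ^+ 2 / 2))%:E * \int[lebesgue_measure]_x (normal_pdf (k * s ^+ 2) s x)%:E)%E.
  apply: ge0_integralZl => //.
  - by apply/measurable_EFinP; exact: measurable_normal_pdf.
  - by move=> x _; rewrite lee_fin normal_pdf_ge0.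
rewrite integral_normal_pdf mule1 in mulE; rewrite -mulE.
apply: eq_integral => x _; rewrite -!EFinM; congr EFin.
  rewrite !normal_pdfE // /normal_fun mulrCA [RHS]mulrCA; congr (_ * _).
  rewrite -!expRD; congr expR; field; exact: sn0.
Qed.

(** The factor exp(x^2 / (4 s^2)) turns the density of variance s^2 into sqrt 2 times that of
    variance 2 s^2. *)
Lemma normal_qexp s : 0 < s ->
  (\int[normal_prob 0%R s]_x (expR (x ^+ 2 / (4 * s ^+ 2)))%:E = (Num.sqrt 2)%:E)%E.
Proof.
move=> s0; have sn0 : s != 0 by rewrite gt_eqF.
have t0 : 0 < Num.sqrt 2 * s :> R by rewrite mulr_gt0 // sqrtr_gt0.
have tn0 : Num.sqrt 2 * s != 0 :> R by rewrite gt_eqF.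
have t2 : (Num.sqrt 2 * s) ^+ 2 = 2 * s ^+ 2 :> R by rewrite exprMn sqr_sqrtr.
rewrite ge0_integral_normal; last 2 first.
- by apply/measurable_EFinP; apply: measurableT_comp => //; exact: measurable_funM.
- by move=> x; rewrite lee_fin expR_ge0.
have mulE : (\int[lebesgue_measure]_x ((Num.sqrt 2)%:E * (normal_pdf 0%R (Num.sqrt 2 * s) x)%:E) =
    (Num.sqrt 2)%:E * \int[lebesgue_measure]_x (normal_pdf 0%R (Num.sqrt 2 * s) x)%:E)%E.
  apply: ge0_integralZl => //.
  - by apply/measurable_EFinP; exact: measurable_normal_pdf.
  - by move=> x _; rewrite lee_fin normal_pdf_ge0.
rewrite integral_normal_pdf mule1 in mulE; rewrite -mulE.
apply: eq_integral => x _; rewrite -!EFinM; congr EFin.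
  rewrite !normal_pdfE // /normal_fun [LHS]mulrCA [RHS]mulrA; congr (_ * _).
    rewrite /normal_peak t2 (_ : 2 * s ^+ 2 * pi *+ 2 = 2 * (s ^+ 2 * pi *+ 2)); last by ring.
    rewrite (sqrtrM (s ^+ 2 * pi *+ 2) (ler0n R 2)) invfM mulrA divff ?mul1r //.
  by rewrite t2 -expRD; congr expR; field; exact: sn0.
Qed.

Context d (Omega : measurableType d) (P : probability Omega R).

Lemma integral_normal_rv s (N : Omega -> R) (f : R -> \bar R) :
  measurable_fun setT N ->
  (forall S : set R, measurable S -> P (N @^-1` S) = normal_prob 0 s S) ->
  measurable_fun setT f -> (forall x, 0 <= f x)%E ->
  (\int[P]_w f (N w) = \int[normal_prob 0%R s]_x f x)%E.
Proof.
move=> mN law mf f0.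
pose N' : Omega -> measurableTypeR R := N.
have mN' : measurable_fun setT N' by move=> mT Y mY; exact: mN.
have mf' : measurable_fun setT (f : measurableTypeR R -> \bar R).
  by move=> mT Y mY; exact: mf.
pose mNi := isMeasurableFun.Build _ _ _ _ _ mN'.
pose Np : {mfun Omega >-> measurableTypeR R} := HB.pack N' mNi.
rewrite -[LHS](@ge0_integral_distribution _ _ _ _ _ P Np f) //.
by apply: eq_measure_integral => A mA _; exact: law.
Qed.

End normal.

(** * Increments of the Wiener process along arbitrary vectors, and their independence of the
    past *)

Section wiener.
Context d (Omega : measurableType d) (R : realType) (P : probability Omega R).
Local Notation U := (L2 R).
Variables (T : R) (F_ : R -> set (set Omega)) (W : R -> U -> Omega -> R).
Hypotheses (hF : filtration T F_) (hW : cylindrical_wiener P T F_ W).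
Variables (s t : R).
Hypotheses (s0 : 0 <= s) (st : s < t) (tT : t <= T).
Implicit Types (u v w : U) (J : seq U).

Definition dW u (o : Omega) : R := W t u o - W s u o.

#[local] Instance aeP_filter : Filter (almost_everywhere P).
Proof. exact: ae_filter_ringOfSetsType. Qed.

Let sI : s \in `[0, T].
Proof. by rewrite in_itv /= s0 (le_trans (ltW st)). Qed.

Let tI : t \in `[0, T].
Proof. by rewrite in_itv /= (le_trans s0 (ltW st)). Qed.

Lemma Fs_sub A : F_ s A -> measurable A.
Proof. by case: hF => /(_ s sI) [_ h] _; exact: h. Qed.

Lemma Fs_setT : F_ s setT.
Proof.
case: hF => /(_ s sI) [[h0 hC hU] _] _; have := hC _ h0.
by rewrite setD0.
Qed.

Lemma meas_W r u : r \in `[0, T] -> measurable_fun setT (W r u).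
Proof.
move=> rI _ S mS; rewrite setTI.
by case: hF => /(_ r rI) [_ h] _; apply: h; exact: (wiener_adapted hW rI).
Qed.

Lemma meas_dW u : measurable_fun setT (dW u).
Proof. by apply: measurable_funB; exact: meas_W. Qed.

Lemma dW_law u : ip u u = 1 -> forall S : set R, measurable S ->
  P (dW u @^-1` S) = normal_prob 0 (Num.sqrt (t - s)) S.
Proof.
move=> u1 S mS.
have := @wiener_increments _ _ _ _ _ _ _ hW s t s0 st tT 1 (fun=> u) _ setT (fun=> S) Fs_setT.
rewrite big_ord1 probability_setT mul1e setTI => H; rewrite -H //.
- by congr (P _); apply/seteqP; split=> o; [move=> So i _|move=> h; exact: (h ord0 I)].
- by move=> i j; rewrite !ord1 u1.
Qed.

Lemma W0_ae r : r \in `[0, T] -> {ae P, forall o, W r 0 o = 0}.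
Proof.
move=> rI; have := wiener_linear hW rI 1 0 0; rewrite scaler0 addr0.
by apply: filterS => o /eqP; rewrite mul1r -subr_eq0 opprD addrA subrr sub0r oppr_eq0 => /eqP.
Qed.

Lemma dW0_ae : {ae P, forall o, dW 0 o = 0}.
Proof. by apply: filterS2 (W0_ae tI) (W0_ae sI) => o; rewrite /dW => H1 H2; rewrite H1 H2 subr0. Qed.

Lemma dW_lin a u v : {ae P, forall o, dW (a *: u + v) o = a * dW u o + dW v o}.
Proof.
apply: filterS2 (wiener_linear hW tI a u v) (wiener_linear hW sI a u v) => o.
by rewrite /dW => H1 H2; rewrite H1 H2; ring.
Qed.

Lemma dW_scale a u : {ae P, forall o, dW (a *: u) o = a * dW u o}.
Proof.
apply: filterS2 (dW_lin a u 0) dW0_ae => o; rewrite addr0 => H1 H2.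
by rewrite H1 H2 addr0.
Qed.

(** The exceptional null set depends on [c], so random coefficients must be frozen before this
    applies. *)
Lemma dW_sum J (c : U -> R) :
  {ae P, forall o, \sum_(u <- J) c u * dW u o = dW (\sum_(u <- J) c u *: u) o}.
Proof.
elim: J => [|u J IH].
  by apply: filterS dW0_ae => o H; rewrite !big_nil H.
by apply: filterS2 IH (dW_lin (c u) u (\sum_(v <- J) c v *: v)) => o H1 H2; rewrite !big_cons H2 H1.
Qed.

Lemma dW_normalize w : w != 0 -> ip (`|w|^-1 *: w) (`|w|^-1 *: w) = 1 /\
  {ae P, forall o, dW w o = `|w| * dW (`|w|^-1 *: w) o}.
Proof.
move=> w0; have nw : `|w| != 0 by rewrite normr_eq0.
split; first by rewrite ipZl ipZr ip_norm; field.
apply: filterS (dW_scale `|w|^-1 w) => o ->.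
by rewrite mulrA divff // mul1r.
Qed.

Lemma integral_cstP (c : R) : (\int[P]_o c%:E = c%:E)%E.
Proof.
rewrite integral_cst //; transitivity (c%:E * 1)%E; last exact: mule1.
congr (_ * _)%E; exact: probability_setT.
Qed.

Lemma dW_mgf k w :
  (\int[P]_o (expR (k * dW w o))%:E = (expR (k ^+ 2 * (t - s) * `|w| ^+ 2 / 2))%:E)%E.
Proof.
have mexp v c : measurable_fun setT (fun o => (expR (c * dW v o))%:E).
  apply/measurable_EFinP; apply: measurableT_comp => //; apply: measurable_funM => //.
  exact: meas_dW.
have [->|w0] := eqVneq w 0.
  rewrite normr0 expr0n !mulr0 mul0r expR0 (@ae_eq_integral _ _ _ _ _ (cst 1%E)) //.
    exact: integral_cstP.
  by apply: filterS dW0_ae => o -> _; rewrite mulr0 expR0.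
have [n1 nae] := dW_normalize w0.
rewrite (@ae_eq_integral _ _ _ _ _ (fun o => (expR (k * `|w| * dW (`|w|^-1 *: w) o))%:E)) //.
  rewrite (@integral_normal_rv _ _ _ P (Num.sqrt (t - s)) _ (fun x => (expR (k * `|w| * x))%:E)).
  - rewrite normal_mgf ?sqrtr_gt0 ?subr_gt0 // sqr_sqrtr ?subr_ge0 1?ltW //.
    by congr (expR _)%:E; ring.
  - exact: meas_dW.
  - exact: dW_law.
  - by apply/measurable_EFinP; apply: measurableT_comp => //; exact: measurable_funM.
  - by move=> x; rewrite lee_fin expR_ge0.
by apply: filterS nae => o -> _; rewrite mulrA.
Qed.

(** The increment has variance (t - s) |w|^2, so [normal_qexp] gives sqrt 2. For w = 0 the quotient
    in the exponent is 0 by the convention on division. *)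
Lemma dW_qexp w :
  (\int[P]_o (expR (dW w o ^+ 2 / (4 * (t - s) * `|w| ^+ 2)))%:E <= 2%:E)%E.
Proof.
have [->|w0] := eqVneq w 0.
  rewrite normr0 expr0n !mulr0 invr0.
  under eq_integral do rewrite mulr0 expR0.
  by rewrite integral_cstP lee_fin ler1n.
have [n1 nae] := dW_normalize w0; have nw : `|w| != 0 by rewrite normr_eq0.
have ts : t - s != 0 by rewrite subr_eq0 gt_eqF.
pose q := Num.sqrt (t - s).
have q2 : q ^+ 2 = t - s by rewrite sqr_sqrtr // subr_ge0 ltW.
have me v c : measurable_fun setT (fun o => (expR (dW v o ^+ 2 / c))%:E).
  apply/measurable_EFinP; apply: measurableT_comp => //; apply: measurable_funM => //.
  by apply: measurable_funX; exact: meas_dW.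
rewrite (@ae_eq_integral _ _ _ _ _ (fun o => (expR (dW (`|w|^-1 *: w) o ^+ 2 / (4 * q ^+ 2)))%:E)) //.
  rewrite (@integral_normal_rv _ _ _ P q _ (fun x => (expR (x ^+ 2 / (4 * q ^+ 2)))%:E)).
  - rewrite normal_qexp ?sqrtr_gt0 ?subr_gt0 // lee_fin -(@ler_pXn2r _ 2) ?nnegrE ?sqrtr_ge0 //.
    by rewrite sqr_sqrtr // expr2 ler_peMr // ler1n.
  - exact: meas_dW.
  - exact: dW_law.
  - by apply/measurable_EFinP; apply: measurableT_comp => //; exact: measurable_funM.
  - by move=> x; rewrite lee_fin expR_ge0.
apply: filterS nae => o -> _; congr (expR _)%:E; rewrite q2; field.
by rewrite nw ts.
Qed.

(** A pi-system generating the sigma-algebra of the increments along [J]; on its members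
    [wiener_increments] gives independence directly. *)
Definition dW_rect J : set (set Omega) :=
  [set B | exists S : 'I_(size J) -> set R, (forall i, measurable (S i)) /\
     B = \bigcap_(i in [set: 'I_(size J)]) (dW (nth 0%R J i) @^-1` S i)].

Lemma dW_rect_meas J : dW_rect J `<=` measurable.
Proof.
move=> _ [S [mS ->]]; apply: fin_bigcap_measurable => // i _.
by rewrite -[X in measurable X]setTI; exact: meas_dW.
Qed.

(** For fixed [A] both sides are finite measures in [B] that agree on the pi-system [dW_rect J]. *)
Lemma dW_indep J A B : onseq J -> F_ s A -> <<s dW_rect J >> B ->
  (P (A `&` B) = P A * P B)%E.
Proof.
move=> [uJ oJ] FA.
have on i j : ip (nth 0%R J (i : 'I_(size J))) (nth 0%R J (j : 'I_(size J))) = (i == j)%:R.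
  by rewrite oJ ?mem_nth // nth_uniq.
have rect (S : 'I_(size J) -> set R) : (forall i, measurable (S i)) -> F_ s A ->
  (P (A `&` \bigcap_(i in [set: 'I_(size J)]) (dW (nth 0%R J i) @^-1` S i)) =
  P A * \prod_(i < size J) normal_prob 0%R (Num.sqrt (t - s)) (S i))%E.
  move=> mS FA'.
  by have := @wiener_increments _ _ _ _ _ _ _ hW s t s0 st tT _ _ on A S FA' mS.
have rectT (S : 'I_(size J) -> set R) : (forall i, measurable (S i)) ->
  (P (\bigcap_(i in [set: 'I_(size J)]) (dW (nth 0%R J i) @^-1` S i)) =
   \prod_(i < size J) normal_prob 0%R (Num.sqrt (t - s)) (S i))%E.
  move=> mS; have := @wiener_increments _ _ _ _ _ _ _ hW s t s0 st tT _ _ on setT S Fs_setT mS.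
  by rewrite setTI probability_setT mul1e.
have mA := Fs_sub FA.
pose m1 := mrestr P mA.
pose m2 := mscale (NngNum (fine_ge0 (measure_ge0 P A))) P.
have PA : (fine (P A))%:E = P A by rewrite fineK // fin_num_measure.
move=> GB; rewrite setIC -PA.
apply: (@g_sigma_algebra_measure_unique _ _ _ (dW_rect J) (@dW_rect_meas J) (fun=> setT) _ _ m1 m2) => //.
- move=> _; exists (fun=> setT); split => //.
  by apply/seteqP; split.
- by rewrite bigcup_const //; exists 0%N.
- move=> _ _ [S1 [mS1 ->]] [S2 [mS2 ->]]; exists (fun i => S1 i `&` S2 i); split.
    by move=> i; exact: measurableI.
  by rewrite -bigcapI.
- move=> _ [S [mS ->]]; rewrite -[LHS]/(P (_ `&` A)) -[RHS]/((fine (P A))%:E * P _)%E setIC rect // rectT // PA; reflexivity.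
- by move=> _; rewrite -[X in (X < _)%E]/(P (setT `&` A)) setTI -ge0_fin_numE // fin_num_measure.
Qed.

End wiener.

Section meas_sum.
Context d (T : measurableType d) (R : realType) (I : eqType).

Lemma measurable_sum_seq (J : seq I) (h : I -> T -> R) :
  (forall u, u \in J -> measurable_fun setT (h u)) ->
  measurable_fun setT (fun x => \sum_(u <- J) h u x).
Proof.
elim: J => [|u J IH] mh.
  by rewrite (_ : (fun _ => _) = cst 0) //; apply/funext => x; rewrite big_nil.
rewrite (_ : (fun _ => _) = (fun x => h u x + \sum_(v <- J) h v x)); last first.
  by apply/funext => x; rewrite big_cons.
apply: measurable_funD; first by apply: mh; rewrite mem_head.
by apply: IH => v vJ; apply: mh; rewrite in_cons vJ orbT.
Qed.
End meas_sum.

(** Jensen's inequality with the missing mass placed at the point 0, where the exponential is 1; the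
    proof sums tangent inequalities at the mean. *)
Lemma expR_jensen (R : realType) (I : Type) (s : seq I) (p x : I -> R) :
  (forall i, 0 <= p i) -> \sum_(i <- s) p i <= 1 ->
  expR (\sum_(i <- s) p i * x i) <= \sum_(i <- s) p i * expR (x i) + (1 - \sum_(i <- s) p i).
Proof.
move=> p0 p1; set m := \sum_(i <- s) p i * x i.
have tang y : expR m * (1 + (y - m)) <= expR y.
  have -> : expR y = expR m * expR (y - m) by rewrite -expRD addrC subrK.
  by rewrite ler_wpM2l ?expR_ge0 // expR_ge1Dx.
have H : \sum_(i <- s) p i * (expR m * (1 + (x i - m))) <= \sum_(i <- s) p i * expR (x i).
  by apply: ler_sum => i _; exact: ler_wpM2l.
have E : \sum_(i <- s) p i * (expR m * (1 + (x i - m))) =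
    expR m * ((\sum_(i <- s) p i) * (1 - m) + m).
  have -> : m = \sum_(i <- s) p i * x i by [].
  rewrite [in RHS]mulr_suml -big_split /= mulr_sumr; apply: eq_bigr => i _; rewrite -/m; ring.
have := tang 0; rewrite expR0; move: H; rewrite E.
by have := expR_gt0 m; move: (\sum_(i <- s) p i) p1 => q; nra.
Qed.

(** * The noise factor of one step, integrated conditionally on the past *)

Section cond.
Context d (Omega : measurableType d) (R : realType) (P : probability Omega R).
Local Notation U := (L2 R).
Variables (T : R) (F_ : R -> set (set Omega)) (W : R -> U -> Omega -> R).
Hypotheses (hF : filtration T F_) (hW : cylindrical_wiener P T F_ W).
Variables (s t : R).
Hypotheses (s0 : 0 <= s) (st : s < t) (tT : t <= T).
Variables (J : seq U).
Hypothesis oJ : onseq J.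
Local Notation dW := (dW W s t).

Definition Fmeas (g : Omega -> R) := forall S : set R, measurable S -> F_ s (g @^-1` S).

(** Omega is equipped with two sigma-algebras, the past and the increments; the identity maps into
    [T1] and [T2] are the independent variables fed to [ge0_integral_indep]. *)
Let T1 := g_sigma_algebraType (F_ s).
Let T2 := g_sigma_algebraType (dW_rect W s t J).

Let measT1 (g : Omega -> R) : Fmeas g -> measurable_fun setT (g : T1 -> R).
Proof. by move=> mg _ S mS; rewrite setTI; apply: sub_sigma_algebra; exact: mg. Qed.

Let measT2 u : u \in J -> measurable_fun setT (dW u : T2 -> R).
Proof.
move=> uJ _ S mS; rewrite setTI; apply: sub_sigma_algebra.
exists (fun i => if nth 0%R J i == u then S else setT); split.
  by move=> i; case: ifP.
apply/seteqP; split=> o; first by move=> So i _ /=; case: eqP => // ->.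
have iu : (index u J < size J)%N by rewrite index_mem.
by move=> /(_ (Ordinal iu) I) /=; rewrite nth_index // eqxx.
Qed.

Let FsE (A : set T1) : measurable A -> F_ s A.
Proof.
move=> mA; have [sF _] := hF; have sI : s \in `[0, T].
  by rewrite in_itv /= s0 (le_trans (ltW st)).
exact: (smallest_sub (sF s sI).1 (@subset_refl _ _)) mA.
Qed.

Variables (I : seq U) (Phi : Omega -> R) (a : U -> Omega -> R) (M : U -> U -> Omega -> R).
Variables (k D th : R).
Hypotheses (mPhi : Fmeas Phi) (Phi0 : forall o, 0 <= Phi o).
Hypotheses (ma : forall u, u \in J -> Fmeas (a u)).
Hypotheses (mM : forall i u, i \in I -> u \in J -> Fmeas (M i u)).
Hypotheses (D0 : 0 <= D) (th0 : 0 < th).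
Hypothesis MB : forall o, Phi o != 0 -> \sum_(i <- I) \sum_(u <- J) M i u o ^+ 2 <= th.

(** The point [o] enters only through the coefficients and [v] only through the increments. *)
Let q o v : R := expR (k * \sum_(u <- J) a u o * dW u v) +
  D * expR (\sum_(i <- I) (\sum_(u <- J) M i u o * dW u v) ^+ 2 / (4 * th * (t - s))).

Let f (z : T1 * T2) : \bar R := (Phi z.1 * q z.1 z.2)%:E.

Let mfst (g : Omega -> R) : Fmeas g -> measurable_fun setT (fun z : T1 * T2 => g z.1).
Proof. by move=> /measT1 mg; exact: (measurableT_comp mg measurable_fst). Qed.

Let msnd u : u \in J -> measurable_fun setT (fun z : T1 * T2 => dW u z.2).
Proof. by move=> /measT2 mg; exact: (measurableT_comp mg measurable_snd). Qed.

Let mf : measurable_fun setT f.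
Proof.
apply/measurable_EFinP; apply: measurable_funM; first exact: mfst.
apply: measurable_funD.
  apply: measurableT_comp => //; apply: measurable_funM => //.
  apply: measurable_sum_seq => u uJ; apply: measurable_funM; [apply: mfst; exact: ma|exact: msnd].
apply: measurable_funM => //; apply: measurableT_comp => //.
apply: measurable_sum_seq => i iI; apply: measurable_funM => //; apply: measurable_funX.
apply: measurable_sum_seq => u uJ; apply: measurable_funM; [apply: mfst; exact: mM|exact: msnd].
Qed.

Let q0 o v : 0 <= q o v.
Proof. by rewrite addr_ge0 ?expR_ge0 // mulr_ge0 // expR_ge0. Qed.

Let mexp v c : measurable_fun setT (fun o => (expR (c * dW v o))%:E).
Proof.
apply/measurable_EFinP; apply: measurableT_comp => //; apply: measurable_funM => //.
exact: (meas_dW hF hW).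
Qed.

Let mqexp v c : measurable_fun setT (fun o => (expR (dW v o ^+ 2 / c))%:E).
Proof.
apply/measurable_EFinP; apply: measurableT_comp => //; apply: measurable_funM => //.
by apply: measurable_funX; exact: (meas_dW hF hW).
Qed.

(** With [o] fixed, each sum over [J] is the increment along one vector. The coordinates [w i] of
    the noise may be correlated; Jensen with the weights |w i|^2 / th separates them and leaves
    one-dimensional Gaussian integrals. The constant 2 bounds 2 sum p + (1 - sum p), as sum p <=
    1. *)
Let inner o : Phi o != 0 ->
  measurable_fun setT (fun v => (q o v)%:E) /\ (\int[P]_v (q o v)%:E <=
   (expR (k ^+ 2 * (t - s) * (\sum_(u <- J) a u o ^+ 2) / 2) + 2 * D)%:E)%E.
Proof.
move=> Po; have ts : 0 < t - s by rewrite subr_gt0.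
pose wa := \sum_(u <- J) a u o *: u.
pose w i := \sum_(u <- J) M i u o *: u.
have nwa : `|wa| ^+ 2 = \sum_(u <- J) a u o ^+ 2 by exact: (norm_lincomb (a^~ o) oJ).
have nw i : `|w i| ^+ 2 = \sum_(u <- J) M i u o ^+ 2 by exact: (norm_lincomb (fun u => M i u o) oJ).
pose p i := `|w i| ^+ 2 / th.
have p0 i : 0 <= p i by rewrite divr_ge0 // ?sqr_ge0 // ltW.
have p1 : \sum_(i <- I) p i <= 1.
  rewrite -mulr_suml ler_pdivrMr // mul1r; under eq_bigr do rewrite nw.
  exact: MB.
pose g v : R := expR (k * dW wa v) +
  D * (\sum_(i <- I) p i * expR (dW (w i) v ^+ 2 / (4 * (t - s) * `|w i| ^+ 2)) + (1 - \sum_(i <- I) p i)).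
have mq : measurable_fun setT (fun v => (q o v)%:E).
  apply/measurable_EFinP; apply: measurable_funD.
    apply: measurableT_comp => //; apply: measurable_funM => //.
    by apply: measurable_sum_seq => u uJ; apply: measurable_funM => //; exact: (meas_dW hF hW).
  apply: measurable_funM => //; apply: measurableT_comp => //.
  apply: measurable_sum_seq => i iI; apply: measurable_funM => //; apply: measurable_funX.
  by apply: measurable_sum_seq => u uJ; apply: measurable_funM => //; exact: (meas_dW hF hW).
split => //.
have mS : measurable_fun setT (fun v => \sum_(i <- I) p i * expR (dW (w i) v ^+ 2 / (4 * (t - s) * `|w i| ^+ 2))).
  by apply: measurable_sum_seq => i iI; apply: measurable_funM => //; exact/measurable_EFinP/mqexp.
have S0 v : 0 <= \sum_(i <- I) p i * expR (dW (w i) v ^+ 2 / (4 * (t - s) * `|w i| ^+ 2)).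
  by rewrite sumr_ge0 // => i _; rewrite mulr_ge0 // expR_ge0.
have mg : measurable_fun setT (fun v => (g v)%:E).
  apply/measurable_EFinP; apply: measurable_funD; first exact/measurable_EFinP/mexp.
  by apply: measurable_funM => //; apply: measurable_funD.
have aeP : Filter (almost_everywhere P) by exact: aeP_filter.
have qg : {ae P, forall v, q o v <= g v}.
  have H1 := dW_sum hW s0 st tT J (a^~ o).
  have H2 : {ae P, forall v, forall i, i \in I -> \sum_(u <- J) M i u o * dW u v = dW (w i) v /\
      (w i = 0 -> dW (w i) v = 0)}.
    elim: (I) => [|i I' IH]; first exact: aeW.
    have H3 := dW_sum hW s0 st tT J (fun u => M i u o).
    have H4 := dW0_ae hW s0 st tT.
    apply: filterS3 IH H3 H4 => v h1 h2 h3 j; rewrite in_cons => /predU1P[->|]; last exact: h1.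
    by split => // ->.
  apply: filterS2 H1 H2 => v h1 h2; rewrite /q /g h1 lerD2l ler_wpM2l //.
  apply: le_trans (expR_jensen _ p0 p1); rewrite ler_expR le_eqVlt; apply/orP; left; apply/eqP.
  rewrite big_seq [RHS]big_seq; apply: eq_bigr => i iI; have [-> h0] := h2 i iI.
  (* A zero vector has weight 0, and its increment vanishes almost surely, so the meaningless
     quotient does no harm. *)
  have [w0|w0] := eqVneq (w i) 0.
    by rewrite h0 // /p w0 normr0 expr0n /= !mul0r.
  have nz : `|w i| != 0 by rewrite normr_eq0.
  have tz : th != 0 by rewrite gt_eqF.
  have dz : t - s != 0 by rewrite gt_eqF.
  by rewrite /p; field; rewrite ?nz ?tz ?dz.
have i2 : (\int[P]_v (\sum_(i <- I) p i * expR (dW (w i) v ^+ 2 / (4 * (t - s) * `|w i| ^+ 2)))%:E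
    <= (2 * \sum_(i <- I) p i)%:E)%E.
  elim: (I) => [|i I' IH].
    rewrite big_nil mulr0; under eq_integral do rewrite big_nil.
    by rewrite integral0_eq.
  under eq_integral do rewrite big_cons EFinD.
  rewrite ge0_integralD //; last 4 first.
  - by move=> v _; rewrite lee_fin mulr_ge0 // expR_ge0.
  - by apply/measurable_EFinP; apply: measurable_funM => //; exact/measurable_EFinP/mqexp.
  - by move=> v _; rewrite lee_fin sumr_ge0 // => j _; rewrite mulr_ge0 // expR_ge0.
  - apply/measurable_EFinP; apply: measurable_sum_seq => j jI.
    by apply: measurable_funM => //; exact/measurable_EFinP/mqexp.
  rewrite [in leRHS]big_cons [in leRHS]mulrDr EFinD leeD //.
  under eq_integral do rewrite EFinM.
  rewrite ge0_integralZl //; last by rewrite lee_fin.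
  rewrite (mulrC 2 (p i)) (EFinM (p i) 2); apply: lee_wpmul2l; first by rewrite lee_fin.
  exact: (dW_qexp hF hW s0 st tT).
apply: (@le_trans _ _ (\int[P]_v (g v)%:E)%E).
  apply: ae_ge0_le_integral => //.
  - by move=> v _; rewrite lee_fin.
  - move=> v _; rewrite lee_fin addr_ge0 ?expR_ge0 // mulr_ge0 // addr_ge0 // subr_ge0 //.
  - by apply: filterS qg => v h _; rewrite lee_fin.
rewrite /g; under eq_integral do rewrite EFinD.
rewrite ge0_integralD //; last 2 first.
- by move=> v _; rewrite lee_fin mulr_ge0 // addr_ge0 // subr_ge0.
- by apply/measurable_EFinP; apply: measurable_funM => //; apply: measurable_funD.
rewrite (dW_mgf hF hW s0 st tT) nwa EFinD leeD2l //.
under eq_integral do rewrite EFinM.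
rewrite ge0_integralZl //; last 2 first.
- by apply/measurable_EFinP; apply: measurable_funD.
- by move=> v _; rewrite lee_fin addr_ge0 // subr_ge0.
rewrite (mulrC 2 D) (EFinM D 2); apply: lee_wpmul2l; first by rewrite lee_fin.
under eq_integral do rewrite EFinD.
rewrite ge0_integralD //; last 3 first.
- by move=> v _; rewrite lee_fin.
- exact/measurable_EFinP.
- by move=> v _; rewrite lee_fin subr_ge0.
rewrite integral_cstP; apply: le_trans (leeD2r _ i2) _.
by rewrite -EFinD lee_fin; lra.
Qed.

(* Coefficients that are F_s-measurable may be frozen, the increments over
   (s, t] being independent of F_s. *)
Lemma cond_bound :
  (\int[P]_o (Phi o * (expR (k * \sum_(u <- J) a u o * dW u o) +
     D * expR (\sum_(i <- I) (\sum_(u <- J) M i u o * dW u o) ^+ 2 / (4 * th * (t - s)))))%:E <=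
  \int[P]_o (Phi o * (expR (k ^+ 2 * (t - s) * (\sum_(u <- J) a u o ^+ 2) / 2) + 2 * D))%:E)%E.
Proof.
have f0 z : (0 <= f z)%E by rewrite lee_fin mulr_ge0.
have mid1 : measurable_fun setT (id : Omega -> T1).
  by move=> _ A mA; rewrite setTI; exact: (Fs_sub hF s0 st tT (FsE mA)).
have mid2 : measurable_fun setT (id : Omega -> T2).
  move=> _ A mA; rewrite setTI.
  exact: (smallest_sub (@sigma_algebra_measurable _ _) (@dW_rect_meas _ _ _ _ _ _ _ hF hW _ _ s0 st tT J)) mA.
have := @ge0_integral_indep _ _ _ Omega T1 T2 R P id id mid1 mid2 _ f mf f0.
move=> [|mint H]; first by move=> A B mA mB; exact: (dW_indep hF hW s0 st tT oJ (FsE mA) mB).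
rewrite -[X in (X <= _)%E]/(\int[P]_o f (o, o))%E {}H.
have mPhi' : measurable_fun setT Phi.
  move=> _ S mS; rewrite setTI; exact: (Fs_sub hF s0 st tT (mPhi mS)).
have ma' u : u \in J -> measurable_fun setT (a u).
  by move=> uJ _ S mS; rewrite setTI; exact: (Fs_sub hF s0 st tT (ma uJ mS)).
apply: ge0_le_integral => //.
- by move=> o _; apply: integral_ge0 => v _; exact: f0.
- apply/measurable_EFinP; apply: measurable_funM => //; apply: measurable_funD => //.
  apply: measurableT_comp => //; apply: measurable_funM => //; apply: measurable_funM => //.
  by apply: measurable_sum_seq => u uJ; apply: measurable_funX; exact: ma'.
- move=> o _; have [P0|P0] := eqVneq (Phi o) 0.
    by rewrite P0 mul0r integral0_eq // => v _; rewrite /f /= P0 mul0r.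
  have [mq inn] := inner P0.
  rewrite /f /=; under eq_integral do rewrite EFinM.
  rewrite ge0_integralZl //; [|by move=> v _; rewrite lee_fin|by rewrite lee_fin].
  by rewrite EFinM; apply: lee_wpmul2l; [rewrite lee_fin|].
Qed.

End cond.

(** * The deterministic inequality behind one tamed step *)

Section step_exp.
Variable R : realType.
Local Notation U := (L2 R).

Lemma expR_le_lin (X s : R) : expR X <= expR s + `|X - s| * expR (Num.max X s).
Proof.
have [Xs|sX] := leP X s.
  by rewrite (le_trans (_ : _ <= expR s)) ?ler_expR // lerDl mulr_ge0 // expR_ge0.
rewrite gtr0_norm ?subr_gt0 //.
have : expR X * (1 + (s - X)) <= expR s.
  have -> : expR s = expR X * expR (s - X) by rewrite -expRD addrC subrK.
  by rewrite ler_wpM2l ?expR_ge0 // expR_ge1Dx.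
by have := expR_gt0 X; nra.
Qed.

(** Each power of z is at most exp(3 z), and (C + 3) z <= th (C + 3)^2 + z^2 / (4 th) by completing
    the square. *)
Lemma poly_expR_bound (C th z : R) : 0 < th -> 0 <= z ->
  (z + z ^+ 2 + z ^+ 3) * expR (C * z) <= 3 * expR (th * (C + 3) ^+ 2) * expR (z ^+ 2 / (4 * th)).
Proof.
move=> th0 z0; have ez : z <= expR z by have := @expR_ge1Dx R z; lra.
have e1 : 1 <= expR z by have := @expR_ge1Dx R z; lra.
have p1 : z + z ^+ 2 + z ^+ 3 <= 3 * expR z ^+ 3.
  have e2 : z ^+ 2 <= expR z ^+ 2 by rewrite ler_pXn2r ?nnegrE ?expR_ge0.
  have e3 : z ^+ 3 <= expR z ^+ 3 by rewrite ler_pXn2r ?nnegrE ?expR_ge0.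
  have e4 : expR z ^+ 2 <= expR z ^+ 3 by rewrite [leRHS]exprS ler_peMl // exprn_ge0 // expR_ge0.
  have e5 : expR z <= expR z ^+ 2 by rewrite [leRHS]expr2 ler_peMl // expR_ge0.
  lra.
apply: (@le_trans _ _ (3 * expR z ^+ 3 * expR (C * z))).
  by rewrite ler_wpM2r // expR_ge0.
rewrite -(mulrA 3) -(mulrA 3) ler_wpM2l // -expRM_natl -!expRD ler_expR.
have th4 : 0 < 4 * th by rewrite mulr_gt0.
rewrite -subr_ge0 -(pmulr_rge0 _ th4).
have -> : 4 * th * (th * (C + 3) ^+ 2 + z ^+ 2 / (4 * th) - (3 * z + C * z)) =
  (2 * th * (C + 3) - z) ^+ 2.
  by field; rewrite gt_eqF.
exact: sqr_ge0.
Qed.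

(** With y = |Z| / sqrt h, the first factor bounds the change of the exponent by taming relative to
    h (y + y^2 + y^3). The second is the constant of [poly_expR_bound], where 2 eps K + 2 eps K^3 +
    eps K bounds both exponents relative to y. *)
Definition step_cst (eps K th : R) : R :=
  (4 * eps * K + eps) * (3 * expR (th * (2 * eps * K + 2 * eps * K ^+ 3 + eps * K + 3) ^+ 2)).

Lemma step_cst_ge0 eps K th : 0 <= eps -> 0 <= K -> 0 <= step_cst eps K th.
Proof.
by move=> e0 K0; rewrite /step_cst !(mulr_ge0, addr_ge0) // expR_ge0.
Qed.

(** The scalar content of [step_exp]: [a], [b], [z], [X0], [F0] stand for <x, Z>, <f, Z>, |Z|, |x|,
    |f|. *)
Lemma real_step (eps rho K th h a b z X0 F0 : R) :
  0 < th -> 0 <= rho -> rho <= eps -> 0 < h -> 0 <= K -> 0 <= z -> 0 <= X0 -> 0 <= F0 ->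
  `|a| <= X0 * z -> `|b| <= F0 * z ->
  X0 * Num.sqrt h <= K -> F0 * Num.sqrt h <= K -> Num.sqrt h <= K ->
  let g := (1 + z ^+ 2)^-1 in
  expR (rho * (2 * (a * g) + 2 * h * (b * g) + (g * z) ^+ 2)) <=
  expR (2 * rho * a) + step_cst eps K th * h * expR (z ^+ 2 / (4 * th * h)).
Proof.
move=> th0 r0 re h0 K0 z0 X00 F00 aX bF. move=> XK FK hK; set g := (1 + _)^-1; rewrite /=.
set q := Num.sqrt h in XK FK hK *.
have q0 : 0 < q by rewrite sqrtr_gt0.
have q2 : q ^+ 2 = h by rewrite sqr_sqrtr // ltW.
(* The noise in its natural scale: every estimate below is a power of h times a polynomial in y. *)
have [y yE y0] : exists2 y, z = q * y & 0 <= y.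
  by exists (z / q); [rewrite mulrCA divff ?mulr1 // gt_eqF|rewrite divr_ge0 // ltW].
have d0 : 0 < 1 + z ^+ 2 by have := sqr_ge0 z; lra.
have g0 : 0 < g by rewrite invr_gt0.
have g1 : g <= 1 by rewrite invf_le1 //; have := sqr_ge0 z; lra.
have gd : g * (1 + z ^+ 2) = 1 by rewrite mulVf // gt_eqF.
have gz1 : g * z <= 1 by have := sqr_ge0 (z - 1); nra.
have gz0 : 0 <= g * z by rewrite mulr_ge0 // ltW.
have gzz : g * z <= z by rewrite ler_piMl.
have aK : `|a| <= K * y.
  by apply: le_trans aX _; rewrite yE mulrA ler_wpM2r.
have bK : `|b| <= K * y.
  by apply: le_trans bF _; rewrite yE mulrA ler_wpM2r.
have e0 : 0 <= eps by exact: le_trans re.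
have Ky : 0 <= K * y by rewrite mulr_ge0.
have agK : `|a * g| <= K * y.
  by rewrite normrM (gtr0_norm g0) (le_trans _ aK) // ler_piMr.
have bgK : `|b * g| <= K * y.
  by rewrite normrM (gtr0_norm g0) (le_trans _ bK) // ler_piMr.
have hK2 : h <= K ^+ 2 by rewrite -q2 ler_pXn2r ?nnegrE // ltW.
set X := rho * _; set s := 2 * rho * a.
have s_le : s <= (2 * eps * K + 2 * eps * K ^+ 3 + eps * K) * y.
  have : s <= 2 * eps * (K * y).
    rewrite /s -!mulrA ler_wpM2l //.
    apply: (@le_trans _ _ (rho * (K * y))); last by rewrite ler_wpM2r.
    by rewrite ler_wpM2l // (le_trans (ler_norm _)).
  have : 0 <= 2 * eps * K ^+ 3 * y + eps * K * y.
    by rewrite !(addr_ge0, mulr_ge0) // exprn_ge0.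
  lra.
(* Taming gives g z <= 1, so even the quadratic term grows only linearly in y, and a Gaussian factor
   can dominate its exponential whatever the step size. *)
have z2K : (g * z) ^+ 2 <= K * y.
  apply: (@le_trans _ _ (1 * z)); first by rewrite expr2 ler_pM.
  by rewrite mul1r yE ler_wpM2r.
have hbK : `|h * (b * g)| <= K ^+ 3 * y.
  rewrite normrM (gtr0_norm h0).
  apply: (@le_trans _ _ (K ^+ 2 * (K * y))); first by rewrite ler_pM // ltW.
  by rewrite le_eqVlt; apply/orP; left; apply/eqP; ring.
have X_le : X <= (2 * eps * K + 2 * eps * K ^+ 3 + eps * K) * y.
  apply: (@le_trans _ _ (rho * (2 * (K * y) + 2 * (K ^+ 3 * y) + K * y))).
    rewrite ler_wpM2l //.
    have := le_trans (ler_norm _) agK; have := le_trans (ler_norm _) hbK; lra.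
  apply: (@le_trans _ _ (eps * (2 * (K * y) + 2 * (K ^+ 3 * y) + K * y))).
    rewrite ler_wpM2r // !(addr_ge0, mulr_ge0) // exprn_ge0 //.
  by rewrite le_eqVlt; apply/orP; left; apply/eqP; ring.
have Xs_le : `|X - s| <= (4 * eps * K + eps) * h * (y + y ^+ 2 + y ^+ 3).
  (* Since 1 - g = g z^2, the first-order part of [a] cancels and every remaining term is of order
     h. *)
  have E : X - s = rho * (- (2 * (a * (g * z ^+ 2))) + 2 * h * (b * g) + (g * z) ^+ 2).
    rewrite /X /s; have -> : g * z ^+ 2 = 1 - g by lra.
    ring.
  have h1 : `|a * (g * z ^+ 2)| <= h * (K * y ^+ 3).
    rewrite normrM; apply: (@le_trans _ _ (K * y * z ^+ 2)).
      rewrite ler_pM // ger0_norm ?mulr_ge0 ?sqr_ge0 // ?(ltW g0) //.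
      by rewrite ler_piMl ?sqr_ge0.
    by rewrite le_eqVlt; apply/orP; left; apply/eqP; rewrite -q2 yE; ring.
  have h2 : `|h * (b * g)| <= h * (K * y) by rewrite normrM (gtr0_norm h0) ler_wpM2l // ltW.
  have h3 : (g * z) ^+ 2 <= h * y ^+ 2.
    rewrite -q2 -exprMn -yE ler_pXn2r ?nnegrE //.
  rewrite E normrM (ger0_norm r0).
  have y2 : 0 <= y ^+ 2 by exact: sqr_ge0.
  have y3 : 0 <= y ^+ 3 by exact: exprn_ge0.
  apply: (@le_trans _ _ (rho * (2 * (h * (K * y ^+ 3)) + 2 * (h * (K * y)) + h * y ^+ 2))).
    rewrite ler_wpM2l // -mulrA.
    apply: le_trans (ler_normD _ _) _; apply: lerD; last by rewrite ger0_norm ?sqr_ge0.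
    apply: le_trans (ler_normD _ _) _; apply: lerD.
      by rewrite normrN normrM (ger0_norm (ler0n R 2)) ler_wpM2l.
    by rewrite normrM (ger0_norm (ler0n R 2)) ler_wpM2l.
  apply: (@le_trans _ _ (eps * (2 * (h * (K * y ^+ 3)) + 2 * (h * (K * y)) + h * y ^+ 2))).
    by rewrite ler_wpM2r // !(addr_ge0, mulr_ge0) // ltW.
  have h0' := ltW h0.
  have p1 : 0 <= eps * h * K * y by rewrite !mulr_ge0.
  have p2 : 0 <= eps * h * K * y ^+ 2 by rewrite !mulr_ge0.
  have p3 : 0 <= eps * h * K * y ^+ 3 by rewrite !mulr_ge0.
  have p4 : 0 <= eps * h * y by rewrite !mulr_ge0.
  have p5 : 0 <= eps * h * y ^+ 3 by rewrite !mulr_ge0.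
  lra.
apply: le_trans (expR_le_lin X s) _; rewrite lerD2l.
set C2 := 2 * eps * K + _ + _ in X_le s_le *.
apply: (@le_trans _ _ ((4 * eps * K + eps) * h * (y + y ^+ 2 + y ^+ 3) * expR (C2 * y))).
  by rewrite ler_pM // ?expR_ge0 // ler_expR ge_max X_le.
have -> : z ^+ 2 / (4 * th * h) = y ^+ 2 / (4 * th).
  by rewrite yE -q2; field; rewrite !gt_eqF.
rewrite -mulrA /step_cst -/C2 [leRHS]mulrAC.
have -> : (4 * eps * K + eps) * (3 * expR (th * (C2 + 3) ^+ 2)) * expR (y ^+ 2 / (4 * th)) * h =
  (4 * eps * K + eps) * h * (3 * expR (th * (C2 + 3) ^+ 2) * expR (y ^+ 2 / (4 * th))) by ring.
rewrite ler_wpM2l ?poly_expR_bound // mulr_ge0 ?(ltW h0) //.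
by rewrite addr_ge0 // !mulr_ge0.
Qed.

(** When the square is expanded, <x, f> = 0 removes the only drift term of order h without a sign,
    and h^2 |f|^2 <= K^2 h; the terms containing Z are left to [real_step]. *)
Lemma step_exp (eps rho K th h : R) (x f Z : U) :
  0 < th -> 0 <= rho -> rho <= eps -> 0 < h -> 0 <= K ->
  `|x| * Num.sqrt h <= K -> `|f| * Num.sqrt h <= K -> Num.sqrt h <= K -> ip x f = 0 ->
  expR (rho * `|x + (h *: f + (1 + `|Z| ^+ 2)^-1 *: Z)| ^+ 2) <=
  expR (rho * `|x| ^+ 2 + eps * K ^+ 2 * h) *
    (expR (2 * rho * ip x Z) + step_cst eps K th * h * expR (`|Z| ^+ 2 / (4 * th * h))).
Proof.
move=> th0 r0 re h0 K0 xK fK hK xf.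
set g := (1 + _)^-1.
have nE : `|x + (h *: f + g *: Z)| ^+ 2 = `|x| ^+ 2 + (h * `|f|) ^+ 2 +
   (2 * (ip x Z * g) + 2 * h * (ip f Z * g) + (g * `|Z|) ^+ 2).
  rewrite normD_sqr normD_sqr ipDr !ipZr ipZl xf -(ip_norm (h *: f)) -(ip_norm (g *: Z)).
  by rewrite !ipZl !ipZr !ip_norm; ring.
rewrite nE mulrDr expRD; apply: ler_pM; rewrite ?expR_ge0 //.
  rewrite ler_expR mulrDr lerD2l.
  apply: (@le_trans _ _ (eps * (h * `|f|) ^+ 2)); first by rewrite ler_wpM2r // sqr_ge0.
  rewrite -mulrA ler_wpM2l //; first exact: le_trans re.
  have -> : (h * `|f|) ^+ 2 = (`|f| * Num.sqrt h) ^+ 2 * h.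
    by rewrite exprMn [in RHS]exprMn sqr_sqrtr ?ltW //; ring.
  by rewrite ler_wpM2r ?(ltW h0) // ler_pXn2r ?nnegrE // mulr_ge0 // sqrtr_ge0.
apply: (@real_step eps rho K th h (ip x Z) (ip f Z) `|Z| `|x| `|f|) => //; exact: normr_ip_le.
Qed.

End step_exp.

Lemma mem_fset_set (T : choiceType) (I : set T) (fI : finite_set I) h :
  (h \in (fset_set I : seq T)) <-> I h.
Proof.
have -> : (h \in (fset_set I : seq T)) = (h \in I) by exact: in_fset_set.
by split=> [/set_mem//|]; exact: mem_set.
Qed.

(** * Finite spans of basis vectors, where semigroup and fractional powers are finite sums *)

Section span.
Variable R : realType.
Local Notation U := (L2 R).
Implicit Types (I HH H : set U) (u v w x : U).

Lemma fproj_seq I v : finite_set I -> fproj I v = \sum_(h <- fset_set I) ip h v *: h.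
Proof. by move=> fI; rewrite /fproj fsbig_finite. Qed.

Lemma onseq_basis H HH I : orthonormal_basis H HH -> I `<=` HH -> finite_set I ->
  onseq (fset_set I).
Proof.
move=> [_ on _] IH fI; split; first exact: fset_uniq.
by move=> u v /(mem_fset_set fI)/IH Hu /(mem_fset_set fI)/IH Hv; exact: on.
Qed.

(** Along the directed set of finite subsets the partial sums are constant from [I] on. *)
Lemma hsum_fin HH I (f : U -> U) : finite_set I -> I `<=` HH ->
  (forall h, HH h -> ~ I h -> f h = 0) ->
  hsum HH f = \sum_(h <- fset_set I) f h.
Proof.
move=> fI IH f0; rewrite /hsum /summability.sum; apply: lim_near_cst.
- exact: norm_hausdorff.
- exact: summability.totally_filter.
exists (fset_set I) => //= B IB.
rewrite /summability.partial_sum -(big_seq_fsetE _ B xpredT (f \_ HH)) /=.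
rewrite -(big_fset_incl _ IB) /=.
  apply: eq_big_seq => h /(mem_fset_set fI) Ih.
  by rewrite patchE mem_set //; exact: IH.
move=> h hB; rewrite in_fset_set // notin_setE => Ih.
by rewrite patchE; case: ifPn => // /set_mem Hh; exact: f0.
Qed.

Variables (H HH : set U) (lam : U -> R).
Hypotheses (hH : closed_subspace H) (hHH : orthonormal_basis H HH).
Variable I : set U.
Hypotheses (IH : I `<=` HH) (fI : finite_set I).
Let s : seq U := fset_set I.
Let os : onseq s. Proof. exact: onseq_basis hHH IH fI. Qed.

(** Membership in the span of [I] as a fixed point of P_I, which supplies the coordinates without an
    existential. *)
Definition inspan v := v = \sum_(h <- fset_set I) ip h v *: h.

Lemma inspan_lincomb (c : U -> R) : inspan (\sum_(h <- fset_set I) c h *: h).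
Proof.
by rewrite /inspan; apply: eq_big_seq => h hs; rewrite (ip_lincomb c os).
Qed.

Lemma inspan_fproj v : inspan (fproj I v).
Proof. by rewrite fproj_seq //; exact: inspan_lincomb. Qed.

Lemma inspan_lin a u v : inspan u -> inspan v -> inspan (a *: u + v).
Proof.
move=> su sv; rewrite /inspan {1}su {1}sv scaler_sumr -big_split /=.
by apply: eq_bigr => h _; rewrite ipDr ipZr scalerDl scalerA.
Qed.

Lemma inspan0 : inspan 0.
Proof. by rewrite /inspan big1 // => h _; rewrite ip0r scale0r. Qed.

Lemma inspanZ a u : inspan u -> inspan (a *: u).
Proof. by move=> su; rewrite -[_ *: _]addr0; apply: inspan_lin => //; exact: inspan0. Qed.

Lemma inspanD u v : inspan u -> inspan v -> inspan (u + v).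
Proof. by move=> su sv; rewrite -[u]scale1r; exact: inspan_lin. Qed.

Lemma inspan_sum (J : seq U) (f : U -> U) : (forall u, u \in J -> inspan (f u)) ->
  inspan (\sum_(u <- J) f u).
Proof.
move=> sf; rewrite big_seq; elim/big_ind : _ => //; first exact: inspan0.
exact: inspanD.
Qed.

Lemma inspan_ip0 v h : inspan v -> HH h -> ~ I h -> ip h v = 0.
Proof.
move=> -> Hh Ih; rewrite ip_sumr big_seq big1 // => u us.
have [_ on _] := hHH; have Iu : I u by exact/(mem_fset_set fI).
rewrite ipZr (on _ _ Hh (IH Iu)).
by case: eqP => [uh|]; rewrite ?mulr0 //; case: Ih; rewrite uh.
Qed.

Lemma inspan_norm v : inspan v -> `|v| ^+ 2 = \sum_(h <- fset_set I) ip h v ^+ 2.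
Proof. by move=> sv; rewrite {1}sv; exact: (norm_lincomb (fun h => ip h v) os). Qed.

Lemma fproj_norm v : `|fproj I v| <= `|v|.
Proof. by rewrite fproj_seq //; exact: norm_proj. Qed.

Lemma inspan_H v : inspan v -> H v.
Proof.
move=> ->; case: hH => H0 HL _; rewrite big_seq; elim/big_ind : _ => //.
  by move=> x y Hx Hy; rewrite -[x]scale1r; exact: HL.
move=> h /(mem_fset_set fI) Ih; rewrite -[_ *: _]addr0; apply: HL => //.
by case: hHH => HHH _ _; apply: HHH; exact: IH.
Qed.

Lemma ip_fproj v x : inspan x -> ip x (fproj I v) = ip x v.
Proof.
move=> sx; rewrite sx !ip_suml; apply: eq_big_seq => h hs.
by rewrite !ipZl fproj_seq // (ip_lincomb (fun u => ip u v) os).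
Qed.

Lemma inspan_Hspace g v : inspan v -> Hspace H HH lam g v.
Proof.
move=> sv; split; first exact: inspan_H.
set f := fun h => _.
have f0 h : (0 <= f h)%E.
  by rewrite /f lee_fin mulr_ge0 // ?powR_ge0 // sqr_ge0.
have -> : (\esum_(h in HH) f h = \esum_(h in I) f h)%E.
  rewrite -[in RHS](setIidr IH) esum_mkcondr; apply: eq_esum => h Hh.
  case: ifPn => // /negP Ih; rewrite /f (inspan_ip0 sv Hh) ?normr0 ?expr0n ?mulr0 //.
  by move=> Ih'; apply: Ih; exact: mem_set.
rewrite esum_fset // fsbig_finite //= sumEFin ltry //.
Qed.

Lemma semigroupE t v : inspan v ->
  semigroup HH lam t v = \sum_(h <- fset_set I) (expR (t * lam h) * ip h v) *: h.
Proof.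
move=> sv; rewrite /semigroup (hsum_fin fI IH) // => h Hh Ih.
by rewrite (inspan_ip0 sv Hh Ih) mulr0 scale0r.
Qed.

Lemma Hnorm_sqr g v : inspan v ->
  Hnorm HH lam g v ^+ 2 = \sum_(h <- fset_set I) (`|lam h| `^ g * ip h v) ^+ 2.
Proof.
move=> sv; rewrite /Hnorm /frac_power (hsum_fin fI IH); last first.
  by move=> h Hh Ih; rewrite (inspan_ip0 sv Hh Ih) mulr0 scale0r.
exact: norm_lincomb (fun h => `|lam h| `^ g * ip h v) os.
Qed.

Lemma semigroup_norm t v : (forall h, HH h -> lam h <= 0) -> 0 <= t -> inspan v ->
  `|semigroup HH lam t v| <= `|v|.
Proof.
move=> l0 t0 sv; rewrite semigroupE // -(@ler_pXn2r _ 2) ?nnegrE //.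
rewrite (norm_lincomb (fun h => expR (t * lam h) * ip h v) os) inspan_norm //.
rewrite big_seq [leRHS]big_seq; apply: ler_sum => h hs.
rewrite exprMn ler_piMl ?sqr_ge0 // exprn_ile1 ?expR_ge0 //.
rewrite -expR0 ler_expR mulr_ge0_le0 // l0 //; apply: IH; exact/(mem_fset_set fI).
Qed.

Lemma semigroup_lin t a u v : inspan u -> inspan v ->
  semigroup HH lam t (a *: u + v) = a *: semigroup HH lam t u + semigroup HH lam t v.
Proof.
move=> su sv; rewrite !semigroupE //; last exact: inspan_lin.
rewrite scaler_sumr -big_split /=; apply: eq_bigr => h _.
by rewrite ipDr ipZr scalerA -scalerDl; congr (_ *: _); ring.
Qed.

Lemma semigroup0 t : semigroup HH lam t 0 = 0.
Proof.
rewrite semigroupE; last exact: inspan0.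
by rewrite big1 // => h _; rewrite ip0r mulr0 scale0r.
Qed.

(** The scheme has the semigroup inside the stochastic integral; this takes it out. *)
Lemma semigroup_sum t (J : seq U) (c : U -> R) (f : U -> U) : (forall u, u \in J -> inspan (f u)) ->
  \sum_(u <- J) c u *: semigroup HH lam t (f u) =
  semigroup HH lam t (\sum_(u <- J) c u *: f u).
Proof.
elim: J => [|u J IHJ] sf; first by rewrite !big_nil semigroup0.
have sJ v : v \in J -> inspan (f v) by move=> vJ; apply: sf; rewrite in_cons vJ orbT.
rewrite !big_cons semigroup_lin ?IHJ //; first by apply: sf; rewrite mem_head.
by apply: inspan_sum => v vJ; apply: inspanZ; exact: sJ.
Qed.

End span.

(** * Sine polynomials and the nonlinearity F *)

Section lincomb_derive.
Variable R : realType.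
Implicit Types (T : eqType).

Lemma is_derive_sum_seq (T : Type) (s : seq T) (f df : T -> R -> R) (x : R) :
  (forall i, is_derive x 1 (f i) (df i x)) ->
  is_derive x 1 (fun y => \sum_(i <- s) f i y) (\sum_(i <- s) df i x).
Proof.
move=> fdf; elim: s => [|i s IH].
  rewrite big_nil (_ : (fun _ => _) = cst 0); first exact: is_derive_cst.
  by apply/funext => y; rewrite big_nil.
rewrite big_cons (_ : (fun _ => _) = f i + (fun y => \sum_(j <- s) f j y)).
  exact: is_deriveD.
by apply/funext => y; rewrite big_cons.
Qed.

Lemma is_derive_scalel (c : R) (f : R -> R) (df x : R) :
  is_derive x 1 f df -> is_derive x 1 (fun y => c * f y) (c * df).
Proof. by move=> fdf; exact: (@is_deriveZ _ _ _ f c x 1 df fdf). Qed.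

Lemma cls_sum (T : eqType) (s : seq T) (c : T -> R) (f : T -> R -> R) :
  (forall i, i \in s -> inL2 (f i)) ->
  inL2 (fun y => \sum_(i <- s) c i * f i y) /\
  cls (fun y => \sum_(i <- s) c i * f i y) = \sum_(i <- s) c i *: cls (f i).
Proof.
elim: s => [|i s IH] f2.
  have -> : (fun y => \sum_(i <- [::]) c i * f i y) = cst 0.
    by apply/funext => y; rewrite big_nil.
  have c0 : inL2 (cst (0 : R)) by apply: inL2_cont => x; exact: cst_continuous.
  split => //; rewrite big_nil.
  have [_] := @cls_lin R (-1) _ _ c0 c0; rewrite scaleN1r addNr => <-.
  by apply: cls_eq => x _ /=; rewrite mulr0 addr0.
have [s2 sE] := IH (fun j js => f2 j (@mem_behead _ (i :: s) _ js)).
have [r1 r2] := cls_lin (c i) (f2 i (mem_head _ _)) s2.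
have -> : (fun y => \sum_(j <- i :: s) c j * f j y) =
    (fun y => c i * f i y + \sum_(j <- s) c j * f j y).
  by apply/funext => y; rewrite big_cons.
by split => //; rewrite r2 big_cons sE.
Qed.
End lincomb_derive.

Section sine_basis.
Variable R : realType.
Local Notation U := (L2 R).
Implicit Types (I HH H : set U) (u v w : U).
Variables (H HH : set U) (lam : U -> R) (e : nat -> U).
Hypotheses (hHH : orthonormal_basis H HH).
Hypothesis heHH : forall n, (0 < n)%N -> HH (e n).
Hypothesis he : forall n, (0 < n)%N -> e n = cls (fun x => Num.sqrt 2 * sin (n%:R * pi * x)).
Hypothesis hlame : forall n, (0 < n)%N -> lam (e n) = - (pi ^+ 2 * n%:R ^+ 2).

Let sqn n : R -> R := fun x => Num.sqrt 2 * sn n x.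

Let cont_sqn n : continuous (sqn n).
Proof. by move=> x; apply: cvgM; [exact: cvg_cst|exact: cont_sn]. Qed.

(** Any other element of HH would be orthogonal to every sine, hence 0 by completeness, against its
    norm 1. *)
Lemma HH_sine h : HH h -> exists n, (0 < n)%N /\ e n = h.
Proof.
move=> Hh; apply: contrapT => nex.
have [_ on _] := hHH.
suff h0 : h = 0.
  have := on h h Hh Hh; rewrite eqxx h0 ip0l => /esym/eqP; by rewrite oner_eq0.
apply: sine_complete => n n0.
have eh : ip (e n) h = 0.
  rewrite on //; last exact: heHH.
  by case: eqP => // enh; case: nex; exists n.
have : ip (e n) h = Num.sqrt 2 * \int[mu01]_x (L2fun h x * sn n x).
  rewrite he // ip_clsE; last exact: inL2_cont (@cont_sqn n).
  rewrite -RintegralZl //; last by apply: integrable_hM; [exact: meas_sn|exists 1; exact: sn_bound].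
  have mS : measurable_fun setT (sqn n) by exact: cont_meas (@cont_sqn n).
  apply: ae_eq_Rintegral01.
  - apply: measurable_funM; last exact: measurable_L2fun.
    by apply: meas_patch01; exact: measurable_funTS.
  - apply: measurable_funM => //; apply: measurable_funM; [exact: measurable_L2fun|exact: meas_sn].
  - by apply: filterS (ae_eq_patch01 (sqn n)) => x hx I; rewrite hx // /sqn mulrAC -mulrA.
by rewrite eh => /esym/eqP; rewrite mulf_eq0 sqrtr_eq0 leNgt ltr0n /= => /eqP.
Qed.

Definition freq h : nat := xget 0%N [set n | (0 < n)%N /\ e n = h].

Lemma freqP h : HH h -> (0 < freq h)%N /\ e (freq h) = h.
Proof. by move=> /HH_sine ex; exact: (xgetPex 0%N ex). Qed.

Lemma lam_freq h : HH h -> `|lam h| = ((freq h)%:R * pi) ^+ 2.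
Proof.
move=> Hh; have [n0 eh] := freqP Hh; rewrite -{1}eh hlame // normrN exprMn mulrC.
by rewrite ger0_norm // mulr_ge0 // sqr_ge0.
Qed.

(** Makes powers of |lam h| increase with the exponent, so that the H_gamma norm controls the
    H_(1/2) norm. *)
Lemma lam_ge1 h : HH h -> 1 <= `|lam h|.
Proof.
move=> Hh; have [n0 _] := freqP Hh; rewrite lam_freq // exprn_ege1 //.
apply: (@le_trans _ _ (1 * 2)); first by rewrite mul1r ler1n.
by rewrite ler_pM ?pi_ge2 // ler1n.
Qed.

Variable I : set U.
Hypotheses (IH : I `<=` HH) (fI : finite_set I).
Let os : onseq (fset_set I). Proof. exact: onseq_basis hHH IH fI. Qed.
Let HHs h : h \in (fset_set I : seq U) -> HH h.
Proof. by move/(mem_fset_set fI); exact: IH. Qed.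

(** Elements of the span are only classes; this is the smooth representative on the whole line, and
    the next two definitions are its derivatives. *)
Definition sinf x (y : R) : R := \sum_(h <- fset_set I) ip h x * (Num.sqrt 2 * sn (freq h) y).
Definition dsinf x (y : R) : R :=
  \sum_(h <- fset_set I) ip h x * (Num.sqrt 2 * ((freq h)%:R * pi * cn (freq h) y)).
Definition ddsinf x (y : R) : R :=
  \sum_(h <- fset_set I) (- ((freq h)%:R * pi) ^+ 2 * ip h x) * (Num.sqrt 2 * sn (freq h) y).

Lemma is_derive_sinf x (y : R) : is_derive y 1 (sinf x) (dsinf x y).
Proof.
rewrite /sinf /dsinf.
apply: (@is_derive_sum_seq _ _ _ (fun h y => ip h x * (Num.sqrt 2 * sn (freq h) y))
  (fun h y => ip h x * (Num.sqrt 2 * ((freq h)%:R * pi * cn (freq h) y)))) => h.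
by do 2 apply: is_derive_scalel; exact: is_derive_sn.
Qed.

Lemma is_derive_dsinf x (y : R) : is_derive y 1 (dsinf x) (ddsinf x y).
Proof.
have -> : ddsinf x y = \sum_(h <- fset_set I) ip h x * (Num.sqrt 2 * ((freq h)%:R * pi * (- ((freq h)%:R * pi) * sn (freq h) y))).
  by apply: eq_bigr => h _; ring.
apply: (@is_derive_sum_seq _ _ _ (fun h y => ip h x * (Num.sqrt 2 * ((freq h)%:R * pi * cn (freq h) y)))
  (fun h y => ip h x * (Num.sqrt 2 * ((freq h)%:R * pi * (- ((freq h)%:R * pi) * sn (freq h) y))))) => h.
by do 3 apply: is_derive_scalel; exact: is_derive_cn.
Qed.

Lemma cont_sinf x : continuous (sinf x).
Proof. exact: deriv_cont (is_derive_sinf x). Qed.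

Lemma cont_dsinf x : continuous (dsinf x).
Proof. exact: deriv_cont (is_derive_dsinf x). Qed.

Lemma cls_sqn h : h \in (fset_set I : seq U) -> inL2 (sqn (freq h)) /\ cls (sqn (freq h)) = h.
Proof.
move=> hs; have [n0 eh] := freqP (HHs hs); split; first exact: inL2_cont (@cont_sqn _).
by rewrite -[RHS]eh he.
Qed.

Lemma cls_sinf x : inspan I x -> cls (sinf x) = x.
Proof.
move=> sx; have [|_ ->] := @cls_sum R _ (fset_set I) (fun h => ip h x) (fun h => sqn (freq h)).
  by move=> h /cls_sqn[].
by rewrite [RHS]sx; apply: eq_big_seq => h /cls_sqn[_ ->].
Qed.

Lemma sinf_ae x : inspan I x -> L2fun x = sinf x %[ae mu01].
Proof.
move=> sx; have := clsE (inL2_cont (@cont_sinf x)); rewrite cls_sinf //.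
Qed.

Lemma sinf0 x : sinf x 0 = 0.
Proof. by rewrite /sinf big1 // => h _; rewrite sn0 !mulr0. Qed.

Lemma sinf1 x : sinf x 1 = 0.
Proof. by rewrite /sinf big1 // => h _; rewrite sn1 !mulr0. Qed.

Lemma cont_ddsinf x : continuous (ddsinf x).
Proof.
have -> : ddsinf x = (fun y => - (sinf (\sum_(h <- fset_set I) (((freq h)%:R * pi) ^+ 2 * ip h x) *: h) y)).
  apply/funext => y; rewrite /sinf -sumrN; apply: eq_big_seq => h hs.
  by rewrite (ip_lincomb (fun h => ((freq h)%:R * pi) ^+ 2 * ip h x) os) // !mulNr.
by move=> y; apply: cvgN; exact: cont_sinf.
Qed.

(** Integration by parts without boundary terms, followed by the fact that the sines are
    eigenfunctions of the second derivative. *)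
Lemma int_dsinf_sqr x : inspan I x ->
  \int[mu01]_y (dsinf x y * dsinf x y) = \sum_(h <- fset_set I) `|lam h| * ip h x ^+ 2.
Proof.
move=> sx.
have P := parts01 (is_derive_sinf x) (@cont_dsinf x) (is_derive_dsinf x) (@cont_ddsinf x).
have -> : \int[mu01]_y (dsinf x y * dsinf x y) = - \int[mu01]_y (sinf x y * ddsinf x y).
  by rewrite P sinf0 sinf1 !mul0r subrr sub0r opprK.
rewrite -ip_cls_cont; [|exact: cont_sinf|exact: cont_ddsinf].
rewrite cls_sinf //.
have [|_ E] := @cls_sum R _ (fset_set I) (fun h => - ((freq h)%:R * pi) ^+ 2 * ip h x) (fun h => sqn (freq h)).
  by move=> h /cls_sqn[].
rewrite [cls (ddsinf x)]E ip_sumr -sumrN; apply: eq_big_seq => h hs.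
have [_ ->] := cls_sqn hs.
by rewrite ipZr (ipC x h) (lam_freq (HHs hs)); ring.
Qed.

Variables (x : U) (B : R).
Hypotheses (sx : inspan I x) (B0 : 0 < B).
Hypothesis xB : \sum_(h <- fset_set I) `|lam h| * ip h x ^+ 2 <= B ^+ 2.

Let d2 y := dsinf x y * dsinf x y.
Let cont_d2 : continuous d2.
Proof. by move=> y; apply: cvgM; exact: cont_dsinf. Qed.

(** As w(0) = 0, w(y) is the integral of w' over [0, y], and Young's inequality c w' <= (w'^2 / B +
    B) / 2 with c = 1 or -1 replaces Cauchy-Schwarz. The right side has integral at most B over (0,
    1). *)
Lemma sinf_bound (y : R) : 0 < y -> y < 1 -> `|sinf x y| <= B.
Proof.
move=> y0 y1.
suff main (c : R) : c ^+ 2 = 1 -> c * sinf x y <= B.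
  have := main 1; rewrite expr1n mul1r => /(_ erefl) h1.
  have := main (-1); rewrite sqrrN expr1n mulN1r => /(_ erefl) h2.
  by rewrite ler_norml h1 andbT lerNl.
move=> c1; pose f z := c * dsinf x z.
have cf : continuous f by move=> z; apply: cvgM; [exact: cvg_cst|exact: cont_dsinf].
have df (z : R) : is_derive z 1 (fun z => c * sinf x z) (f z) by apply: is_derive_scalel; exact: is_derive_sinf.
have cF := deriv_cont df.
have E : (\int[lebesgue_measure]_(z in `[0%R, y]) (f z)%:E = (c * sinf x y)%:E)%E.
  rewrite (@continuous_FTC2 _ f (fun z => c * sinf x z)) //.
  - by rewrite sinf0 mulr0 sube0.
  - exact: continuous_subspaceT.
  - split; first by move=> z _; have := df z => -[].
      by apply: cvg_at_right_filter; exact: cF.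
    by apply: cvg_at_left_filter; exact: cF.
  - by move=> z _; exact: derive1_is (df z).
pose k z := (d2 z / B + B) / 2.
have ck : continuous k.
  move=> z; apply: cvgM; last exact: cvg_cst.
  by apply: cvgD; last exact: cvg_cst; apply: cvgM; [exact: cont_d2|exact: cvg_cst].
have k0 z : 0 <= k z.
  by rewrite /k divr_ge0 // addr_ge0 ?(ltW B0) // divr_ge0 ?(ltW B0) // /d2 -expr2 sqr_ge0.
have fk z : f z <= k z.
  have : 0 <= (f z - B) ^+ 2 by exact: sqr_ge0.
  have -> : (f z - B) ^+ 2 = 2 * B * (k z - f z).
    rewrite /k /f /d2; have B1 : B != 0 by rewrite gt_eqF.
    have c2 : c * c = 1 by rewrite -expr2.
    transitivity ((c * c) * (dsinf x z * dsinf x z) - 2 * B * (c * dsinf x z) + B ^+ 2); first by ring.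
    by rewrite c2; field.
  by rewrite pmulr_rge0 ?mulr_gt0 // subr_ge0.
have kB : (\int[mu01]_z (k z)%:E <= B%:E)%E.
  have ik : mu01.-integrable setT (EFin \o k) by exact: integrable01_cont.
  rewrite -[leLHS]fineK ?(integrable_fin_num measurableT ik) // lee_fin.
  rewrite -[leLHS]/(\int[mu01]_z k z).
  have id2 := integrable01_cont cont_d2.
  have icB : mu01.-integrable setT (EFin \o cst B).
    by apply: integrable01_cont => z; exact: cvg_cst.
  rewrite /k RintegralZr //; last first.
    apply: integrable01_cont => z; apply: cvgD; last exact: cvg_cst.
    by apply: cvgM; [exact: cont_d2|exact: cvg_cst].
  rewrite RintegralD //; last first.
    by apply: integrable01_cont => z; apply: cvgM; [exact: cont_d2|exact: cvg_cst].
  rewrite RintegralZr // int_dsinf_sqr // Rintegral_cst //.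
  have -> : mu01 [set: R] = 1%E.
    rewrite -[LHS]/(lebesgue_measure ([set: R] `&` _)) setTI.
    by rewrite lebesgue_measure_itv /= lte_fin ltr01 sube0.
  rewrite mulr1 ler_pdivrMr // -lerBrDr ler_pdivrMr //.
  by apply: le_trans xB _; rewrite le_eqVlt; apply/orP; left; apply/eqP; ring.
rewrite -lee_fin -E; apply: le_trans kB; rewrite integral01_cont //.
apply: (@le_trans _ _ (\int[lebesgue_measure]_(z in `[0%R, y]) (k z)%:E)%E).
  apply: le_integral => //.
  - by apply: continuous_compact_integrable; [exact: segment_compact|exact: continuous_subspaceT].
  - by apply: continuous_compact_integrable; [exact: segment_compact|exact: continuous_subspaceT].
  - by move=> z _; rewrite lee_fin.
apply: ge0_subset_integral => //.
- by apply/measurable_EFinP; apply: measurable_funTS; exact: cont_meas.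
- by move=> z _; rewrite lee_fin.
- by apply: subset_itvl; rewrite bnd_simp ltW.
Qed.

Lemma in_Linfty_span : in_Linfty x.
Proof.
rewrite /in_Linfty /finite_norm unlock /Lnorm; case: ifP => // _.
apply: (@le_lt_trans _ _ B%:E); last exact: ltry.
apply/ess_supP; apply: filterS2 (sinf_ae sx) (@ae01_D R) => y h Dy; rewrite /= h //.
by move: Dy; rewrite /D01 /= in_itv /= => /andP[y0 y1]; rewrite lee_fin sinf_bound.
Qed.

(** Integration by parts; the boundary terms vanish with the sines at 0 and 1. *)
Lemma weak_derivative_span : is_weak_derivative x (cls (dsinf x)).
Proof.
move=> phi [dphi cphi phiD].
have d0 (y : R) : is_derive y 1 phi ((phi^`())%classic y).
  by rewrite derive1E; apply: derivableP; exact: (dphi 0%N).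
have c1 : continuous (phi^`())%classic.
  move=> y; apply: differentiable_continuous; apply/derivable1_diffP.
  exact: (dphi 1%N).
have c0 := deriv_cont d0.
have P := parts01 (is_derive_sinf x) (@cont_dsinf x) d0 c1.
transitivity (\int[mu01]_y (sinf x y * (phi^`())%classic y)).
  apply: ae_eq_Rintegral01.
  - by apply: measurable_funM; [exact: measurable_L2fun|exact: cont_meas].
  - by apply: measurable_funM; apply: cont_meas => //; exact: cont_sinf.
  - by apply: filterS (sinf_ae sx) => y h I'; rewrite h.
rewrite P sinf0 sinf1 !mul0r subrr sub0r; congr (- _).
apply: ae_eq_Rintegral01.
- by apply: measurable_funM; apply: cont_meas => //; exact: cont_dsinf.
- by apply: measurable_funM; [exact: measurable_L2fun|exact: cont_meas].
- by apply: filterS (clsE (inL2_cont (@cont_dsinf x))) => y h I'; rewrite h.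
Qed.

Lemma norm_orth_proj (Rproj : U -> U) v : orthogonal_projection H Rproj -> `|Rproj v| <= `|v|.
Proof.
move=> /(_ v)[HR /(_ _ HR) o]; rewrite -(@ler_pXn2r _ 2) ?nnegrE //.
have := normD_sqr (v - Rproj v) (Rproj v); rewrite subrK o mulr0 addr0 => ->.
by rewrite lerDr sqr_ge0.
Qed.

Lemma ip_orth_proj (Rproj : U -> U) v w : orthogonal_projection H Rproj -> H w -> ip w (Rproj v) = ip w v.
Proof.
move=> /(_ v)[_ o] /o; rewrite ipBl => /eqP; rewrite subr_eq0 => /eqP h.
by rewrite ipC -h ipC.
Qed.

(** The projection disappears from the pairing because x lies in H, and w^2 w' has the primitive w^3
    / 3. For the norm, |w w'| <= B |w'| pointwise and the integral of w'^2 is at most B^2. *)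
Lemma F_bound (gamma : R) (Rproj F : U -> U) : closed_subspace H -> orthogonal_projection H Rproj ->
  (forall w dw, Hspace H HH lam gamma w -> in_Linfty w -> is_weak_derivative w dw ->
    F w = - Rproj (cls (fun x => L2fun w x * L2fun dw x))) ->
  ip x (F x) = 0 /\ `|F x| <= B ^+ 2.
Proof.
move=> hH hR hFw.
rewrite (hFw x (cls (dsinf x))); [|exact: (inspan_Hspace lam hH hHH IH fI)|exact: in_Linfty_span|exact: weak_derivative_span].
pose f y := sinf x y * dsinf x y.
have cf : continuous f by move=> y; apply: cvgM; [exact: cont_sinf|exact: cont_dsinf].
have -> : cls (fun y => L2fun x y * L2fun (cls (dsinf x)) y) = cls f.
  have E : (fun y => L2fun x y * L2fun (cls (dsinf x)) y) = f %[ae mu01].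
    by apply: filterS2 (sinf_ae sx) (clsE (inL2_cont (@cont_dsinf x))) => y h1 h2 I'; rewrite h1 // h2.
  have f2 := inL2_cont cf.
  apply: cls_ae_eq => //; apply: inL2_ae f2 E.
  by apply: measurable_funM; apply: measurable_funTS; exact: measurable_L2fun.
have Hx : H x := inspan_H hH hHH IH fI sx.
split.
  rewrite ipNr ip_orth_proj // -{1}(cls_sinf sx) ip_cls_cont //; last exact: cont_sinf.
  pose G y := 3^-1 * (sinf x y) ^+ 3.
  have dG (y : R) : is_derive y 1 G (sinf x y * f y).
    have h := @is_deriveX _ _ (sinf x) 3 y 1 _ (is_derive_sinf x y).
    rewrite (_ : sinf x y * f y = 3^-1 * ((3%:R * sinf x y ^+ 3.-1) *: dsinf x y)); last first.
      by rewrite /f /GRing.scale /=; field.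
    exact: (@is_derive_scalel R 3^-1 (sinf x ^+ 3) _ y h).
  rewrite (FTC01 dG); first by rewrite /G sinf0 sinf1 expr0n !mulr0 subrr oppr0.
  by move=> y; apply: cvgM; [exact: cont_sinf|exact: cf].
rewrite normrN; apply: le_trans (norm_orth_proj _ hR) _.
rewrite -(@ler_pXn2r _ 2) ?nnegrE ?sqr_ge0 // -ip_norm ip_cls_cont //.
apply: (@le_trans _ _ (\int[mu01]_y (B ^+ 2 * d2 y))).
  have cff : continuous (fun y => f y * f y) by move=> y; apply: cvgM; exact: cf.
  have cBd : continuous (fun y => B ^+ 2 * d2 y).
    by move=> y; apply: cvgM; [exact: cvg_cst|exact: cont_d2].
  have i1 := integrable01_cont cff; have i2 := integrable01_cont cBd.
  rewrite -lee_fin /Rintegral !fineK ?(integrable_fin_num measurableT) //.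
  apply: ae_ge0_le_integral => //.
  - by move=> y _; rewrite lee_fin -expr2 sqr_ge0.
  - by apply/measurable_EFinP; exact: cont_meas.
  - by move=> y _; rewrite lee_fin mulr_ge0 ?sqr_ge0 // /d2 -expr2 sqr_ge0.
  - by apply/measurable_EFinP; exact: cont_meas.
  - apply: filterS (@ae01_D R) => y Dy _.
    move: Dy; rewrite /D01 /= in_itv /= => /andP[y0 y1]; have := sinf_bound y0 y1.
    rewrite lee_fin /f /d2 -!expr2 exprMn => h; rewrite ler_wpM2r ?sqr_ge0 //.
    by rewrite -[leLHS]real_normK ?num_real // ler_pXn2r ?nnegrE // ltW.
rewrite RintegralZl //; last exact: integrable01_cont.
by rewrite int_dsinf_sqr // [leRHS]expr2 ler_wpM2l ?sqr_ge0.
Qed.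

End sine_basis.

(** * The diffusion coefficient B on sine polynomials *)

Section Bop.
Variable R : realType.
Local Notation U := (L2 R).
Variables (H HH UU : set U) (lam : U -> R) (e : nat -> U) (gamma : R).
Hypotheses (hH : closed_subspace H) (hHH : orthonormal_basis H HH).
Hypothesis heHH : forall n, (0 < n)%N -> HH (e n).
Hypothesis he : forall n, (0 < n)%N -> e n = cls (fun x => Num.sqrt 2 * sin (n%:R * pi * x)).
Variables (Q : {linear U -> U}) (sqrtQ : {linear U -> U}).
Hypotheses (hQ : nonneg_symmetric Q) (hQtr : (trace UU Q < +oo)%E) (hsqrtQ : is_sqrt Q sqrtQ).
Variable Rproj : U -> U.
Hypothesis hRproj : orthogonal_projection H Rproj.
Variable b : R -> R -> R.
Hypothesis hbm : measurable_fun (D01 `*` setT) (fun z : R * R => b z.1 z.2).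
Hypothesis hb : (ereal_sup [set e | exists x y z, [/\ D01 x, z != y
           & e = (`|b x y| + `|b x y - b x z| / `|y - z|)%:E]] < +oo)%E.
Variable B : U -> U -> U.
Hypothesis hBb : forall v : R -> R, measurable_fun D01 v -> inL2 v ->
    Hspace H HH lam gamma (cls v) ->
    forall u, B (cls v) u = Rproj (cls (fun x => b x (v x) * L2fun (sqrtQ u) x)).

Lemma b_bound : exists2 L, 0 <= L & forall x y z, D01 x ->
  `|b x y| <= L /\ `|b x y - b x z| <= L * `|y - z|.
Proof.
move: hb; set A := [set _ | _]; move=> A_lty.
have memA x y z : D01 x -> z != y -> A (`|b x y| + `|b x y - b x z| / `|y - z|)%:E.
  by move=> Dx zy; exists x, y, z.
have D2 : D01 (2^-1 : R) by rewrite /D01 /= in_itv /= invr_gt0 ltr0n invf_lt1 // ltr1n.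
have n10 : (1 : R) != 0 by exact: oner_neq0.
have supfin : ereal_sup A \is a fin_num.
  rewrite fin_numElt A_lty andbT; apply: (lt_le_trans (ltNyr _)).
  exact: (ereal_sup_ubound (memA 2^-1 0 1 D2 n10)).
have key x y z : D01 x -> z != y -> `|b x y| + `|b x y - b x z| / `|y - z| <= fine (ereal_sup A).
  move=> Dx zy; rewrite -lee_fin fineK //.
  exact: (ereal_sup_ubound (memA x y z Dx zy)).
(* The supremum runs over pairs of distinct points; y + 1 serves as the second one. *)
have bd x y : D01 x -> `|b x y| <= fine (ereal_sup A).
  move=> Dx; apply: le_trans (key x y (y + 1) Dx _); first by rewrite lerDl divr_ge0.
  by rewrite -subr_eq0 addrAC subrr add0r.
exists (fine (ereal_sup A)); first exact: le_trans (bd 2^-1 0 D2).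
move=> x y z Dx; split; first exact: bd.
have [->|zy] := eqVneq z y; first by rewrite !subrr normr0 mulr0.
have yz0 : 0 < `|y - z| by rewrite normr_gt0 subr_eq0 eq_sym.
rewrite -ler_pdivrMr //; apply: le_trans (key x y z Dx zy).
by rewrite lerDr.
Qed.

Let bsup := sup [set `|b x y| ^+ 2 | x in D01 & y in setT].

Lemma bsup_ub x y : D01 x -> `|b x y| ^+ 2 <= bsup.
Proof.
move=> Dx; apply: ub_le_sup; last by exists x => //; exists y.
have [L L0 Lb] := b_bound; exists (L ^+ 2) => _ [x' Dx' [y' _ <-]].
by rewrite ler_pXn2r ?nnegrE //; have [] := Lb x' y' y' Dx'.
Qed.

Lemma bsup_ge0 : 0 <= bsup.
Proof.
have D2 : D01 (2^-1 : R) by rewrite /D01 /= in_itv /= invr_gt0 ltr0n invf_lt1 // ltr1n.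
by apply: le_trans (bsup_ub 0 D2); exact: sqr_ge0.
Qed.

Lemma sqrtQ_norm u : `|sqrtQ u| ^+ 2 = ip (Q u) u.
Proof. by case: hsqrtQ => [[sym _] sq]; rewrite -ip_norm -sym sq. Qed.

Lemma trace_sum (J : set U) : finite_set J -> J `<=` UU ->
  \sum_(u <- fset_set J) ip (Q u) u <= fine (trace UU Q).
Proof.
move=> fJ JU; have [_ Q0] := hQ.
have tf : trace UU Q \is a fin_num.
  by rewrite ge0_fin_numE //; apply: esum_ge0 => u _; rewrite lee_fin.
rewrite -lee_fin fineK // /trace.
apply: esum_ge; exists J; first by split.
by rewrite fsbig_finite //= sumEFin.
Qed.

Variables (I : set U).
Hypotheses (IH : I `<=` HH) (fI : finite_set I).
Local Notation w := (sinf e I).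

Let meas_bw x u : measurable_fun D01 (fun y => b y (w x y) * L2fun (sqrtQ u) y).
Proof.
apply: measurable_funM; last by apply: measurable_funTS; exact: measurable_L2fun.
have mp : measurable_fun D01 (fun y => (y, w x y)).
  apply: measurable_funTS; apply: measurable_fun_pair => //.
  by apply: cont_meas; exact: cont_sinf.
apply: (measurable_comp _ _ hbm mp).
- by apply: measurableX => //; exact: measurable_D01.
- by move=> _ [y Dy <-].
Qed.

(** [hBb] speaks of functions rather than classes; the smooth representative [sinf] is inserted. *)
Lemma BE x u : inspan I x -> B x u = Rproj (cls (fun y => b y (w x y) * L2fun (sqrtQ u) y)).
Proof.
move=> sx; have c := cls_sinf hHH heHH he IH fI sx.
have cw : continuous (w x) by exact: cont_sinf.
rewrite -{1}c hBb //.
- by apply: measurable_funTS; exact: cont_meas.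
- exact: inL2_cont.
- by rewrite c; exact: (inspan_Hspace lam hH hHH IH fI).
Qed.

Let Mb x u : inL2 (fun y => b y (w x y) * L2fun (sqrtQ u) y) /\
  `|cls (fun y => b y (w x y) * L2fun (sqrtQ u) y)| <= Num.sqrt bsup * `|sqrtQ u|.
Proof.
apply: inL2_dom => //.
move=> y Dy; rewrite normrM ler_wpM2r //.
by rewrite -(@ler_pXn2r _ 2) ?nnegrE ?sqrtr_ge0 // sqr_sqrtr ?bsup_ge0 // bsup_ub.
Qed.

(** Projection and multiplication give |B x u|^2 <= (sup b^2) |sqrtQ u|^2 = (sup b^2) <Q u, u>,
    whose sum over [J] is bounded by the trace. *)
Lemma B_trace x (J : set U) : inspan I x -> finite_set J -> J `<=` UU ->
  \sum_(u <- fset_set J) `|B x u| ^+ 2 <= vartheta UU Q b.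
Proof.
move=> sx fJ JU; rewrite /vartheta -/bsup mulrC.
apply: (@le_trans _ _ (\sum_(u <- fset_set J) bsup * ip (Q u) u)).
  apply: ler_sum => u _; rewrite BE // -sqrtQ_norm -{1}(sqr_sqrtr bsup_ge0) -exprMn.
  rewrite ler_pXn2r ?nnegrE ?mulr_ge0 ?sqrtr_ge0 //.
  by apply: le_trans (norm_orth_proj _ hRproj) _; have [] := Mb x u.
by rewrite -mulr_sumr ler_wpM2l ?bsup_ge0 // trace_sum.
Qed.

Lemma vartheta_ge0 : 0 <= vartheta UU Q b.
Proof.
rewrite /vartheta -/bsup mulr_ge0 ?bsup_ge0 //; have [_ Q0] := hQ.
by rewrite fine_ge0 // esum_ge0 // => u _; rewrite lee_fin.
Qed.

Lemma sinf_lip x x' y : `|w x y - w x' y| <= Num.sqrt 2 * (size (fset_set I : seq U))%:R * `|x - x'|.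
Proof.
rewrite /sinf -sumrB; apply: le_trans (ler_norm_sum _ _ _) _.
apply: (@le_trans _ _ (\sum_(h <- fset_set I) (Num.sqrt 2 * `|x - x'|))).
  rewrite big_seq [leRHS]big_seq; apply: ler_sum => h hs.
  have hI : HH h by apply: IH; exact/(mem_fset_set fI).
  have n1 : `|h| = 1.
    have [_ on _] := hHH; have := on h h hI hI; rewrite eqxx ip_norm => h2.
    by apply/eqP; rewrite -(@eqrXn2 _ 2) // h2 expr1n.
  rewrite -mulrBl -ipBr normrM mulrC ler_pM //.
    rewrite normrM (ger0_norm (sqrtr_ge0 _)) ler_piMr ?sqrtr_ge0 //; exact: sn_bound.
  by apply: le_trans (normr_ip_le _ _) _; rewrite n1 mul1r.
rewrite big_const_seq count_predT iter_addr_0 le_eqVlt; apply/orP; left; apply/eqP.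
by rewrite -[LHS]mulr_natr; ring.
Qed.

(** Serves only to make B(Y_s) u measurable with respect to F_s, so the dependence of [C] on [I] and
    [u] is harmless. *)
Lemma B_lip u : exists2 C, 0 <= C & forall x x', inspan I x -> inspan I x' ->
  `|B x u - B x' u| <= C * `|x - x'|.
Proof.
have [L L0 Lb] := b_bound.
pose C : R := Num.sqrt 2 * (size (fset_set I : seq U))%:R.
have C0 : 0 <= C by rewrite mulr_ge0 // sqrtr_ge0.
exists (L * C * `|sqrtQ u|); first by rewrite !mulr_ge0.
move=> x x' sx sx'; rewrite !BE //.
set f := fun y => _; set f' := fun y => _.
have [f2 _] := Mb x u; have [f2' _] := Mb x' u.
have [fd2 fdE] := cls_lin (-1) f2' f2.
(* Additivity of the projection is derived from its characterization: the defect z lies in H and is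
   orthogonal to itself. *)
have -> : Rproj (cls f) - Rproj (cls f') = Rproj (cls f - cls f').
  pose z := Rproj (cls f) - Rproj (cls f') - Rproj (cls f - cls f').
  case: hH => _ HL _.
  have Hz : H z.
    have H1 : H (Rproj (cls f) - Rproj (cls f')).
      by rewrite addrC -scaleN1r; apply: HL; exact: (hRproj _).1.
    by rewrite /z addrC -scaleN1r; apply: HL => //; exact: (hRproj _).1.
  apply/eqP; rewrite -subr_eq0; apply/eqP; apply: ip_eq0.
  rewrite -/z {2}/z !ipBr !(ip_orth_proj _ hRproj) // ipBr subrr //.
apply: le_trans (norm_orth_proj _ hRproj) _.
have -> : cls f - cls f' = cls (fun y => (b y (w x y) - b y (w x' y)) * L2fun (sqrtQ u) y).
  rewrite addrC -scaleN1r -fdE; apply: cls_eq => y _; rewrite /f /f'; ring.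
have [|||_ h] := @inL2_dom R (fun y => (b y (w x y) - b y (w x' y)) * L2fun (sqrtQ u) y) (sqrtQ u) (L * C * `|x - x'|).
- have -> : (fun y => (b y (w x y) - b y (w x' y)) * L2fun (sqrtQ u) y) = (fun y => f y - f' y).
    by apply/funext => y; rewrite /f /f' mulrBl.
  by apply: measurable_funB; [exact: (meas_bw x u)|exact: (meas_bw x' u)].
- move=> y Dy; rewrite normrM ler_wpM2r //.
  have [_ lb] := Lb y (w x y) (w x' y) Dy.
  by apply: le_trans lb _; rewrite -mulrA ler_wpM2l // sinf_lip.
- by rewrite !mulr_ge0.
- by rewrite mulrAC.
Qed.

End Bop.

(** * Measurability with respect to F_s of functions of the state *)

Section Fmeas_theory.
Context d (Omega : measurableType d) (R : realType).
Local Notation U := (L2 R).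
Variables (T : R) (F_ : R -> set (set Omega)).
Hypothesis hF : filtration T F_.
Variable s : R.
Hypothesis sI : s \in `[0, T].

Lemma Fs_sigma : sigma_algebra setT (F_ s).
Proof. by have [/(_ s sI)[]] := hF. Qed.

Lemma Fs_gen (A : set Omega) : <<s F_ s >> A -> F_ s A.
Proof. by move=> mA; exact: (smallest_sub Fs_sigma (@subset_refl _ _)) mA. Qed.

Lemma FmeasP (g : Omega -> R) : Fmeas F_ s g <-> measurable_fun setT (g : g_sigma_algebraType (F_ s) -> R).
Proof.
split=> [mg _ S mS|mg S mS]; first by rewrite setTI; apply: sub_sigma_algebra; exact: mg.
by apply: Fs_gen; rewrite -[X in <<s _ >> X]setTI; exact: mg.
Qed.

Variables (V : set U) (X : Omega -> U).
Hypothesis mX : measurable_into (F_ s) V (fun v => `|v|) X.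

(** Open rays generate the Borel sets of the line, and their preimages under [phi] are relatively
    open in [V]. *)
Lemma Fmeas_cont (phi : U -> R) :
  (forall u, V u -> forall e, 0 < e -> exists2 r, 0 < r & forall v, V v -> `|v - u| < r -> `|phi v - phi u| < e) ->
  Fmeas F_ s (phi \o X).
Proof.
move=> cphi; apply/FmeasP; have [VX mX'] := mX.
apply: (measurability _ (RGenOInfty.measurableE R)) => //.
move=> _ [_ [x ->] <-].
rewrite setTI; apply: sub_sigma_algebra.
have -> : (phi \o X) @^-1` `]x, +oo[ = X @^-1` [set v | V v /\ x < phi v].
  by apply/seteqP; split=> o /=; rewrite in_itv /= andbT; [move=> h|move=> []].
apply: mX'; apply: sub_sigma_algebra; split; first by move=> v [].
move=> u [Vu xu]; have [|r r0 hr] := cphi u Vu (phi u - x); first by rewrite subr_gt0.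
exists r => // v Vv vu; split => //; have := hr v Vv vu.
by rewrite ltr_norml => /andP[]; lra.
Qed.

Lemma Fmeas_lip (phi : U -> R) (C : R) : (forall u v, V u -> V v -> `|phi u - phi v| <= C * `|u - v|) ->
  Fmeas F_ s (phi \o X).
Proof.
move=> lphi; apply: Fmeas_cont => u Vu e e0.
have C0 : 0 < `|C| + 1 by rewrite ltr_wpDl.
exists (e / (`|C| + 1)); first by rewrite divr_gt0.
move=> v Vv; rewrite ltr_pdivlMr // mulrC => h; apply: le_lt_trans h.
apply: le_trans (lphi v u Vv Vu) _; rewrite ler_wpM2r //.
by rewrite (le_trans (ler_norm _)) // lerDl.
Qed.

(* Transfers the Borel measurability of the threshold r from (G, N) to V. *)
Lemma Fs_borel (G : set U) (N : U -> R) (C : R) (S : set U) : V `<=` G ->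
  (forall u v, V u -> V v -> N (v - u) <= C * `|v - u|) -> borel G N S -> F_ s (X @^-1` S).
Proof.
move=> VG NC; have [VX mX'] := mX; have [s0 sC sU] := Fs_sigma.
pose E : set (set U) := [set A | F_ s (X @^-1` A)].
suff : <<s G, [set A | A `<=` G /\ forall u, A u ->
    exists2 e, 0 < e & forall v, G v -> N (v - u) < e -> A v] >> `<=` E by apply.
apply: smallest_sub.
- split.
  + by rewrite /E /= preimage_set0.
  + move=> A EA; rewrite /E /=.
    have -> : X @^-1` (G `\` A) = setT `\` X @^-1` A.
      by apply/seteqP; split=> o /= [_ h]; split => //; exact: VG.
    exact: sC.
  + move=> A EA; rewrite /E /= preimage_bigcup; exact: sU.
- move=> A [AG Ao]; rewrite /E /=.
  have -> : X @^-1` A = X @^-1` [set v | V v /\ A v].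
    by apply/seteqP; split=> o /=; [move=> h|move=> []].
  apply: mX'; apply: sub_sigma_algebra; split; first by move=> v [].
  move=> u [Vu Au]; have [e e0 he] := Ao u Au.
  have C0 : 0 < `|C| + 1 by rewrite ltr_wpDl.
  exists (e / (`|C| + 1)); first by rewrite divr_gt0.
  move=> v Vv; rewrite ltr_pdivlMr // mulrC => h; split => //.
  apply: he; first exact: VG.
  apply: le_lt_trans h; apply: le_trans (NC _ _ Vu Vv) _.
  by rewrite ler_wpM2r // (le_trans (ler_norm _)) // lerDl.
Qed.

End Fmeas_theory.

Lemma linear_zero (R : realType) (f : L2 R -> L2 R) : linear f -> f 0 = 0.
Proof. by move=> lf; have := lf (-1) 0 0; rewrite scaler0 addr0 scaleN1r addNr. Qed.

Section fproj_basis.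
Variable R : realType.
Local Notation U := (L2 R).
Variables (V E : set U).
Hypothesis hE : orthonormal_basis V E.
Variable J : set U.
Hypotheses (JE : J `<=` E) (fJ : finite_set J).

Lemma fproj_in u : J u -> fproj J u = u.
Proof.
move=> Ju; have [_ on _] := hE; have uJ : u \in (fset_set J : seq U) by exact/(mem_fset_set fJ).
rewrite fproj_seq // (bigD1_seq u) //=; last exact: fset_uniq.
rewrite (on _ _ (JE Ju) (JE Ju)) eqxx scale1r big_seq_cond big1 ?addr0 // => h /andP[hJ hu].
have Jh : J h by exact/(mem_fset_set fJ).
by rewrite (on _ _ (JE Jh) (JE Ju)) (negbTE hu) scale0r.
Qed.

Lemma fproj_out u : E u -> ~ J u -> fproj J u = 0.
Proof.
move=> Eu Ju; have [_ on _] := hE.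
rewrite fproj_seq // big_seq big1 // => h hJ; have Jh : J h by exact/(mem_fset_set fJ).
rewrite (on _ _ (JE Jh) Eu); case: eqP => [hu|]; last by rewrite scale0r.
by case: Ju; rewrite -hu.
Qed.

(** [ito_const] sums over the whole basis [E]; the projection on [J] inside the integrand cuts it
    down to a finite sum. *)
Lemma ito_sum d (Omega : measurableType d) (W : R -> U -> Omega -> R) (s t : R) (Psi : Omega -> U -> U) o :
  (forall u, E u -> ~ J u -> Psi o u = 0) ->
  ito_const E W s t Psi o = \sum_(u <- fset_set J) dW W s t u o *: Psi o u.
Proof.
move=> P0; rewrite /ito_const -(fsbig_widen J E) //; first by rewrite fsbig_finite.
by move=> u [Eu Ju] /=; rewrite P0 // scaler0.
Qed.

End fproj_basis.

(** * One step of the scheme multiplies the exponential moment by at most exp(C (t - s)) *)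

Section one_step.
Context (R : realType) (gamma T eps delta : R).
Local Notation U := (L2 R).
Hypotheses (hgamma : 2^-1 <= gamma) (hT : 0 < T) (heps : 0 < eps) (hdelta : 0 < delta < 18^-1).
Variables (UU H HH : set U).
Hypotheses (hUU : orthonormal_basis setT UU) (hH : closed_subspace H) (hHH : orthonormal_basis H HH).
Variable (lam : U -> R) (e : nat -> U).
Hypothesis hlam0 : forall h, HH h -> lam h <= 0.
Hypothesis heHH : forall n, (0 < n)%N -> HH (e n).
Hypothesis he : forall n, (0 < n)%N -> e n = cls (fun x => Num.sqrt 2 * sin (n%:R * pi * x)).
Hypothesis hlame : forall n, (0 < n)%N -> lam (e n) = - (pi ^+ 2 * n%:R ^+ 2).
Context (d : measure_display) (Omega : measurableType d) (P : probability Omega R).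
Variables (F_ : R -> set (set Omega)) (W : R -> U -> Omega -> R).
Hypotheses (hF_ : filtration T F_) (hW : cylindrical_wiener P T F_ W).
Variables (Q sqrtQ : {linear U -> U}).
Hypotheses (hQ : nonneg_symmetric Q) (hQtr : (trace UU Q < +oo)%E) (hsqrtQ : is_sqrt Q sqrtQ).
Variable Rproj : U -> U.
Hypothesis hRproj : orthogonal_projection H Rproj.
Variable r : U -> R.
Hypothesis hrm : forall S : set R, measurable S ->
    borel (Hspace H HH lam gamma) (Hnorm HH lam gamma)
      (Hspace H HH lam gamma `&` r @^-1` S).
Variable b : R -> R -> R.
Hypothesis hbm : measurable_fun (D01 `*` setT) (fun z : R * R => b z.1 z.2).
Hypothesis hb : (ereal_sup [set e | exists x y z, [/\ D01 x, z != y
           & e = (`|b x y| + `|b x y - b x z| / `|y - z|)%:E]] < +oo)%E.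
Variable c : R.
Hypothesis c0 : 0 < c.
Variable F : U -> U.
Variable B : U -> U -> U.
Hypothesis hB : forall v, Hspace H HH lam gamma v -> hilbert_schmidt UU H (B v).
Hypothesis hBb : forall v : R -> R, measurable_fun D01 v -> inL2 v ->
    Hspace H HH lam gamma (cls v) ->
    forall u, B (cls v) u = Rproj (cls (fun x => b x (v x) * L2fun (sqrtQ u) x)).
Hypothesis hFw : forall w dw, Hspace H HH lam gamma w -> in_Linfty w ->
    is_weak_derivative w dw ->
    F w = - Rproj (cls (fun x => L2fun w x * L2fun dw x)).
Hypothesis hr : forall v, Hspace H HH lam gamma v ->
    Num.max (Num.sqrt (vartheta UU Q b) + eps * `|v| ^+ 2)
            ((Num.sqrt 3)^-1 * Hnorm HH lam gamma v ^+ 2) <= r v.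

Local Notation th := (vartheta UU Q b).

Let th0 : 0 <= th. Proof. exact: (vartheta_ge0 UU hQ hb). Qed.

(** A common bound for |x| sqrt h, |F x| sqrt h and sqrt h on the tamed event: the summands c / eps,
    3 c^2 and 1 belong to these in turn, and 1 + T bounds h M, h M^2 and h. *)
Definition Kstep : R := Num.sqrt ((1 + T) * (c / eps + 3 * c ^+ 2 + 1)).
(* th + 1 rather than th, which may be 0 and is divided by in [step_exp] *)
Definition Cstep (th : R) : R := eps * Kstep ^+ 2 + 2 * step_cst eps Kstep (th + 1).

Variables (I J : set U).
Hypotheses (IH : I `<=` HH) (fI : finite_set I) (JU : J `<=` UU) (fJ : finite_set J).
Variables (s t m : R).
Hypotheses (s0 : 0 <= s) (st : s < t) (tT : t <= T) (hm : t - s <= m) (mT : m <= T).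

Let h := t - s.
Let h0 : 0 < h. Proof. by rewrite subr_gt0. Qed.
Let m0 : 0 < m. Proof. exact: lt_le_trans hm. Qed.
Let M := m `^ (- delta).
Let M0 : 0 < M. Proof. exact: powR_gt0. Qed.
Let sI : s \in `[0, T]. Proof. by rewrite in_itv /= s0 (le_trans (ltW st)). Qed.
Let tI : t \in `[0, T]. Proof. by rewrite in_itv /= (le_trans s0 (ltW st)). Qed.

Let mpow (p : R) : 0 <= p -> p <= 1 -> m `^ p <= 1 + T.
Proof.
move=> p0 p1; case: (leP m 1) => m1.
  apply: (@le_trans _ _ 1); last by rewrite lerDl ltW.
  have -> : (1 : R) = 1 `^ p by rewrite powR1.
  by apply: ge0_ler_powR => //; rewrite nnegrE ltW.
apply: (@le_trans _ _ (m `^ 1)); first by apply: ler_powR => //; exact: ltW.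
by rewrite powRr1 ?(ltW m0) // (le_trans mT) // lerDr.
Qed.

Let hM : h * M <= 1 + T.
Proof.
have /andP[d0 d1] := hdelta.
apply: (@le_trans _ _ (m * M)); first by rewrite ler_wpM2r // ltW.
rewrite -{1}[m]powRr1 ?(ltW m0) // /M -powRD; last by rewrite (gt_eqF m0) implybT.
by apply: mpow; lra.
Qed.

(** Here h <= m gives m^(1 - 2 delta), whose exponent lies in [0, 1]: the squared threshold is
    compensated by the step size. *)
Let hM2 : h * M ^+ 2 <= 1 + T.
Proof.
have /andP[d0 d1] := hdelta.
apply: (@le_trans _ _ (m * M ^+ 2)); first by rewrite ler_wpM2r // sqr_ge0.
rewrite expr2 -{1}[m]powRr1 ?(ltW m0) // /M -!powRD; try by rewrite (gt_eqF m0) implybT.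
by apply: mpow; lra.
Qed.

Let K0 : 0 <= Kstep. Proof. exact: sqrtr_ge0. Qed.

Let Kbound (a : R) : 0 <= a -> a ^+ 2 * h <= (1 + T) * (c / eps + 3 * c ^+ 2 + 1) -> a * Num.sqrt h <= Kstep.
Proof.
move=> a0 ah; rewrite /Kstep -(ger0_norm a0) -sqrtr_sqr -sqrtrM ?sqr_ge0 //.
exact: ler_wsqrtr.
Qed.

Let c2 : 0 <= c ^+ 2. Proof. exact: sqr_ge0. Qed.
Let T1 : 0 < 1 + T. Proof. by rewrite addr_gt0. Qed.
Let ce0 : 0 <= c / eps. Proof. by rewrite divr_ge0 // ltW. Qed.

(* Bounds valid on the event where the taming indicator equals 1. *)
Section tamed.
Variable x : U.
Hypotheses (sx : inspan I x) (rx : r x <= c * M).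

Let rx1 : eps * `|x| ^+ 2 <= c * M.
Proof.
have := hr (inspan_Hspace lam hH hHH IH fI gamma sx).
rewrite ge_max => /andP[r1 _]; apply: le_trans rx; apply: le_trans r1.
by rewrite lerDr sqrtr_ge0.
Qed.

Let rx2 : Hnorm HH lam gamma x ^+ 2 <= Num.sqrt 3 * (c * M).
Proof.
have := hr (inspan_Hspace lam hH hHH IH fI gamma sx).
rewrite ge_max => /andP[_ r1]; have := le_trans r1 rx.
by rewrite mulrC ler_pdivrMr ?sqrtr_gt0 // mulrC.
Qed.

Lemma tamed_norm : `|x| * Num.sqrt h <= Kstep.
Proof.
apply: Kbound => //; apply: (@le_trans _ _ (c / eps * (h * M))).
  rewrite -(ler_pM2l heps); have -> : eps * (c / eps * (h * M)) = c * M * h by field; rewrite gt_eqF.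
  by rewrite mulrA ler_wpM2r // ltW.
apply: (@le_trans _ _ (c / eps * (1 + T))); first by rewrite ler_wpM2l.
by rewrite mulrC ler_wpM2l ?(ltW T1) //; have := c2; have := ce0; lra.
Qed.

(** From |lam g| >= 1 and gamma >= 1/2 follows |lam g| <= |lam g|^(2 gamma), so the H_gamma part of
    the threshold bounds the integral of w'^2. *)
Let Hsum : \sum_(g <- fset_set I) `|lam g| * ip g x ^+ 2 <= Num.sqrt (Num.sqrt 3 * (c * M)) ^+ 2.
Proof.
rewrite sqr_sqrtr; last by rewrite !mulr_ge0 ?sqrtr_ge0 // ltW.
apply: le_trans rx2; rewrite (Hnorm_sqr lam hHH IH fI) //.
rewrite big_seq [leRHS]big_seq; apply: ler_sum => g /(mem_fset_set fI)/IH Hg.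
rewrite exprMn ler_wpM2r ?sqr_ge0 //.
have l1 := lam_ge1 hHH heHH he hlame Hg.
rewrite -powR_mulrn ?powR_ge0 // -powRrM -{1}(powRr1 (normr_ge0 (lam g))) //.
by apply: ler_powR => //; move: hgamma; lra.
Qed.

Let Fb : ip x (F x) = 0 /\ `|F x| <= Num.sqrt 3 * (c * M).
Proof.
have B0 : 0 < Num.sqrt (Num.sqrt 3 * (c * M)) by rewrite sqrtr_gt0 !mulr_gt0 // sqrtr_gt0.
have := F_bound hHH heHH he hlame IH fI sx B0 Hsum hH hRproj hFw.
by rewrite sqr_sqrtr // !mulr_ge0 ?sqrtr_ge0 // ltW.
Qed.

Lemma tamed_F : ip x (fproj I (F x)) = 0 /\ `|fproj I (F x)| * Num.sqrt h <= Kstep.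
Proof.
have [F1 F2] := Fb; split; first by rewrite (ip_fproj hHH IH fI).
apply: Kbound => //.
have le : `|fproj I (F x)| <= Num.sqrt 3 * (c * M) by apply: le_trans F2; exact: (fproj_norm hHH IH fI).
apply: (@le_trans _ _ (3 * c ^+ 2 * (h * M ^+ 2))).
  have -> : 3 * c ^+ 2 * (h * M ^+ 2) = (Num.sqrt 3 * (c * M)) ^+ 2 * h.
    by rewrite exprMn sqr_sqrtr // exprMn; ring.
  by rewrite ler_wpM2r ?(ltW h0) // ler_pXn2r ?nnegrE // !mulr_ge0 ?sqrtr_ge0 // ltW.
apply: (@le_trans _ _ (3 * c ^+ 2 * (1 + T))); first by rewrite ler_wpM2l // mulr_ge0 // sqr_ge0.
by rewrite mulrC ler_wpM2l ?(ltW T1) //; have := c2; have := ce0; lra.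
Qed.

End tamed.

Lemma sqrth_le : Num.sqrt h <= Kstep.
Proof.
rewrite -[leLHS]mul1r; apply: Kbound => //; rewrite expr1n mul1r.
apply: (@le_trans _ _ (1 + T)); first by rewrite (le_trans hm) // (le_trans mT) // lerDr.
by rewrite -[leLHS]mulr1 ler_wpM2l ?(ltW T1) //; have := c2; have := ce0; lra.
Qed.

Section step.
Variables (X Yt : Omega -> U).
Hypothesis mX : measurable_into (F_ s) (fproj I @` H) (fun v => `|v|) X.
Hypothesis mY : measurable_into (F_ t) (fproj I @` H) (fun v => `|v|) Yt.
Let chi o : R := if r (X o) <= c * M then 1 else 0.
Let BJ o u := fproj I (B (X o) (fproj J u)).
Hypothesis hY : {ae P, forall o, Yt o =
  semigroup HH lam h (X o + chi o *: (h *: fproj I (F (X o))))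
  + (1 + `|ito_const UU W s t BJ o| ^+ 2)^-1 *:
    ito_const UU W s t (fun o u => semigroup HH lam h (chi o *: BJ o u)) o}.

Local Notation ips := (inspan I).
Let V_span v : (fproj I @` H) v -> ips v.
Proof. by move=> [w _ <-]; exact: (inspan_fproj hHH IH fI). Qed.
Let sX o : ips (X o). Proof. by apply: V_span; have [] := mX. Qed.
Let os : onseq (fset_set I). Proof. exact: onseq_basis hHH IH fI. Qed.
Let oJ : onseq (fset_set J). Proof. exact: onseq_basis hUU JU fJ. Qed.
Let Z o := \sum_(u <- fset_set J) dW W s t u o *: fproj I (B (X o) u).

Let sfp v : ips (fproj I v). Proof. exact: (inspan_fproj hHH IH fI). Qed.

Let sZ o : ips (Z o).
Proof. by apply: inspan_sum => u _; apply: inspanZ; exact: sfp. Qed.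

Let fproj0 : fproj I (0 : U) = 0.
Proof. by rewrite fproj_seq // big1 // => g _; rewrite ip0r scale0r. Qed.

Let BJ_in o u : J u -> BJ o u = fproj I (B (X o) u).
Proof. by move=> Ju; rewrite /BJ (fproj_in hUU JU fJ). Qed.

Let BJ_out o u : UU u -> ~ J u -> BJ o u = 0.
Proof.
move=> Uu Ju; rewrite /BJ (fproj_out hUU JU fJ) //.
have [lB _ _ _] := hB (inspan_Hspace lam hH hHH IH fI gamma (sX o)).
by rewrite (linear_zero lB) fproj0.
Qed.

Let ito1 o : ito_const UU W s t BJ o = Z o.
Proof.
rewrite (ito_sum JU fJ); last exact: BJ_out.
by apply: eq_big_seq => u /(mem_fset_set fJ) Ju; rewrite BJ_in.
Qed.

Let ito2 o : ito_const UU W s t (fun o u => semigroup HH lam h (chi o *: BJ o u)) o =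
  semigroup HH lam h (chi o *: Z o).
Proof.
rewrite (ito_sum JU fJ); last first.
  by move=> u Uu Ju; rewrite BJ_out // scaler0 (semigroup0 lam hHH IH fI).
transitivity (\sum_(u <- fset_set J) dW W s t u o *: semigroup HH lam h (chi o *: fproj I (B (X o) u))).
  by apply: eq_big_seq => u /(mem_fset_set fJ) Ju; rewrite BJ_in.
rewrite (semigroup_sum lam hHH IH fI); last by move=> u _; apply: inspanZ; exact: sfp.
congr (semigroup _ _ _ _); rewrite scaler_sumr; apply: eq_bigr => u _.
by rewrite !scalerA mulrC.
Qed.

(** Drift and noise carry the same semigroup and the same chi, so the step is one contraction
    applied to an explicit vector. *)
Let scheme_norm : {ae P, forall o,
  `|Yt o| <= `|X o + chi o *: (h *: fproj I (F (X o)) + (1 + `|Z o| ^+ 2)^-1 *: Z o)|}.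
Proof.
have aeP : Filter (almost_everywhere P) by exact: aeP_filter.
apply: filterS hY => o ->; rewrite ito1 ito2.
set g := (1 + _)^-1; set f := fproj I _.
have s1 : ips (X o + chi o *: (h *: f)).
  by apply: inspanD => //; do 2 apply: inspanZ; exact: sfp.
rewrite addrC -(semigroup_lin lam hHH IH fI) //; last exact: inspanZ.
apply: le_trans (semigroup_norm hHH IH fI hlam0 (ltW h0) _) _.
  by apply: inspanD => //; do 2 apply: inspanZ; exact: sZ.
rewrite le_eqVlt; apply/orP; left; apply/eqP; congr `|_|.
by rewrite scalerDr !scalerA addrC -addrA (mulrC g).
Qed.

(** With [Mx], the coefficients that express <X, Z> and the coordinates of Z as linear forms in the
    increments, as [cond_bound] requires. *)
Let a u o := ip (X o) (B (X o) u).
Let Mx i u o := ip i (B (X o) u).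

Let ip_Z o : ip (X o) (Z o) = \sum_(u <- fset_set J) a u o * dW W s t u o.
Proof. by rewrite ip_sumr; apply: eq_bigr => u _; rewrite ipZr (ip_fproj hHH IH fI) // mulrC. Qed.

Let norm_Z o : `|Z o| ^+ 2 = \sum_(i <- fset_set I) (\sum_(u <- fset_set J) Mx i u o * dW W s t u o) ^+ 2.
Proof.
rewrite (inspan_norm hHH IH fI) //; apply: eq_big_seq => i iI; congr (_ ^+ 2).
rewrite ip_sumr; apply: eq_bigr => u _; rewrite ipZr mulrC; congr (_ * _).
by rewrite fproj_seq // (ip_lincomb (fun v => ip v (B (X o) u)) os).
Qed.

Let Bth o : \sum_(u <- fset_set J) `|B (X o) u| ^+ 2 <= th.
Proof. exact: (B_trace hH hHH heHH he hQ hQtr hsqrtQ hRproj hbm hb hBb IH fI (sX o) fJ JU). Qed.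

Let a_bound o : \sum_(u <- fset_set J) a u o ^+ 2 <= th * `|X o| ^+ 2.
Proof.
apply: (@le_trans _ _ (\sum_(u <- fset_set J) `|B (X o) u| ^+ 2 * `|X o| ^+ 2)).
  apply: ler_sum => u _; rewrite -exprMn -[leLHS]real_normK ?num_real // ler_pXn2r ?nnegrE //.
    by rewrite mulrC; exact: normr_ip_le.
by rewrite -mulr_suml ler_wpM2r ?sqr_ge0.
Qed.

Let M_bound o : \sum_(i <- fset_set I) \sum_(u <- fset_set J) Mx i u o ^+ 2 <= th + 1.
Proof.
rewrite exchange_big /=; apply: (@le_trans _ _ th); last by rewrite lerDl.
by apply: le_trans (Bth o); apply: ler_sum => u _; exact: bessel.
Qed.

Let norm1 i : I i -> `|i| = 1.
Proof.
move=> Ii; have [_ on _] := hHH; have := on i i (IH Ii) (IH Ii); rewrite eqxx ip_norm => h2.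
by apply/eqP; rewrite -(@eqrXn2 _ 2) // h2 expr1n.
Qed.

Let mM i u : i \in (fset_set I : seq U) -> Fmeas F_ s (Mx i u).
Proof.
move=> /(mem_fset_set fI) Ii.
have [C C0 hC] := B_lip hH hHH heHH he hRproj hbm hb hBb IH fI u.
apply: (@Fmeas_lip _ _ _ _ _ hF_ _ sI _ _ mX (fun v => ip i (B v u)) C) => v v' /V_span sv /V_span sv'.
rewrite -ipBr; apply: le_trans (normr_ip_le _ _) _; rewrite norm1 // mul1r.
exact: hC.
Qed.

Let mipX i : i \in (fset_set I : seq U) -> Fmeas F_ s (fun o => ip i (X o)).
Proof.
move=> /(mem_fset_set fI) Ii.
apply: (@Fmeas_lip _ _ _ _ _ hF_ _ sI _ _ mX (fun v => ip i v) 1) => v v' _ _.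
by rewrite -ipBr; apply: le_trans (normr_ip_le _ _) _; rewrite norm1 // mul1r.
Qed.

(** The pairing <x, B(x) u> need not be Lipschitz in x, so it is expanded into products of Lipschitz
    coordinates. *)
Let ma u : Fmeas F_ s (a u).
Proof.
apply/(FmeasP hF_ sI).
have -> : a u = (fun o => \sum_(i <- fset_set I) ip i (X o) * Mx i u o).
  by apply/funext => o; rewrite /a {1}(sX o) ip_suml; apply: eq_bigr => i _; rewrite ipZl.
apply: measurable_sum_seq => i iI; apply: measurable_funM; apply/(FmeasP hF_ sI).
  exact: mipX.
exact: mM.
Qed.

Let mnX : Fmeas F_ s (fun o => `|X o|).
Proof.
apply: (@Fmeas_lip _ _ _ _ _ hF_ _ sI _ _ mX (fun v => `|v|) 1) => v v' _ _.
by rewrite mul1r ler_dist_dist.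
Qed.

Let A : set Omega := [set o | r (X o) <= c * M].

Let FA : F_ s A.
Proof.
have V_H v : (fproj I @` H) v -> Hspace H HH lam gamma v.
  by move/V_span => sv; exact: (inspan_Hspace lam hH hHH IH fI).
(* On the finite-dimensional span the H_gamma norm is at most C times the norm of H; thus Borel sets
   of H_gamma pull back to events of F_s. *)
pose C := Num.sqrt (\sum_(i <- fset_set I) (`|lam i| `^ gamma) ^+ 2).
have -> : A = X @^-1` (Hspace H HH lam gamma `&` r @^-1` `]-oo, c * M]).
  apply/seteqP; split=> o /=; rewrite in_itv /=; last by case.
  by move=> ro; split=> //; apply: V_H; have [] := mX.
apply: (@Fs_borel _ _ _ _ _ hF_ _ sI _ _ mX (Hspace H HH lam gamma) (Hnorm HH lam gamma) C) => //.
  move=> u v /V_span su /V_span sv.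
  have sw : ips (v - u) by rewrite addrC -scaleN1r; exact: inspan_lin.
  rewrite -(@ler_pXn2r _ 2) ?nnegrE ?mulr_ge0 ?sqrtr_ge0 ?normr_ge0 //.
  rewrite (Hnorm_sqr lam hHH IH fI) // exprMn sqr_sqrtr; last by rewrite sumr_ge0 // => i _; exact: sqr_ge0.
  rewrite mulr_suml big_seq [leRHS]big_seq; apply: ler_sum => i /(mem_fset_set fI) Ii.
  rewrite exprMn ler_wpM2l ?sqr_ge0 // -[leLHS]real_normK ?num_real // ler_pXn2r ?nnegrE //.
  by apply: le_trans (normr_ip_le _ _) _; rewrite norm1 // mul1r.
exact: hrm.
Qed.

Let rt := eps / expR (2 * eps * th * t).
Let rs := eps / expR (2 * eps * th * s).
Let D := step_cst eps Kstep (th + 1) * h.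
(** The part of the bound where chi = 1, known at time s and still to be multiplied by the noise
    factor; [Psi] is the part where chi = 0, which meets no noise. *)
Let Phi o : R := \1_A o * expR (rt * `|X o| ^+ 2 + eps * Kstep ^+ 2 * h).
Let Psi o : R := (1 - \1_A o) * expR (rs * `|X o| ^+ 2).

Let rt0 : 0 <= rt. Proof. by rewrite divr_ge0 ?expR_ge0 // ltW. Qed.

Let rt_eps : rt <= eps.
Proof.
rewrite ler_pdivrMr ?expR_gt0 // ler_peMr ?(ltW heps) //.
have t0 : 0 <= t by exact: le_trans s0 (ltW st).
rewrite -[leLHS]expR0 ler_expR; apply: mulr_ge0 => //; apply: mulr_ge0 => //; apply: mulr_ge0 => //; exact: ltW.
Qed.

(** The rate 2 eps vartheta of the weight is made for this: rs = rt exp(2 eps th h) >= rt (1 + 2 eps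
    th h), and rt <= eps. *)
Let rt_rs : rt + 2 * rt ^+ 2 * h * th <= rs.
Proof.
have rsE : rs = rt * expR (2 * eps * th * h).
  rewrite /rs /rt -!expRN -(mulrA eps (expR _)) -expRD; congr (_ * expR _); rewrite /h; ring.
have e1 : 1 + 2 * eps * th * h <= expR (2 * eps * th * h) by exact: expR_ge1Dx.
rewrite rsE; apply: (@le_trans _ _ (rt * (1 + 2 * eps * th * h))); last by rewrite ler_wpM2l.
have -> : rt + 2 * rt ^+ 2 * h * th = rt * (1 + 2 * rt * th * h) by ring.
rewrite ler_wpM2l // lerD2l !ler_wpM2r //; first exact: ltW.
by rewrite ler_wpM2l.
Qed.

Let rh0 : 0 <= 2 * rt ^+ 2 * h.
Proof. by apply: mulr_ge0; [apply: mulr_ge0 => //; exact: sqr_ge0 | exact: ltW]. Qed.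

Let A01 o : \1_A o = (if r (X o) <= c * M then 1 else 0) :> R.
Proof.
rewrite indicE; case: ifPn => [ro|ro]; first by rewrite mem_set.
by rewrite memNset //; apply/negP.
Qed.

Let pointwise : {ae P, forall o, expR (rt * `|Yt o| ^+ 2) <= Psi o +
  Phi o * (expR (2 * rt * \sum_(u <- fset_set J) a u o * dW W s t u o) +
     D * expR (\sum_(i <- fset_set I) (\sum_(u <- fset_set J) Mx i u o * dW W s t u o) ^+ 2 / (4 * (th + 1) * (t - s))))}.
Proof.
have aeP : Filter (almost_everywhere P) by exact: aeP_filter.
apply: filterS scheme_norm => o; rewrite /Psi /Phi A01 /chi; case: ifPn => [ro|ro].
  rewrite subrr mul0r add0r mul1r scale1r => Yle.
  apply: (@le_trans _ _ (expR (rt * `|X o + (h *: fproj I (F (X o)) + (1 + `|Z o| ^+ 2)^-1 *: Z o)| ^+ 2))).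
    by rewrite ler_expR ler_wpM2l // ler_pXn2r ?nnegrE.
  have [f1 f2] := tamed_F (sX o) ro.
  have th1 : 0 < th + 1 by rewrite ltr_wpDl.
  have := @step_exp R eps rt Kstep (th + 1) h (X o) (fproj I (F (X o))) (Z o) th1 rt0 rt_eps h0 K0 (tamed_norm (sX o) ro) f2 sqrth_le f1.
  by rewrite ip_Z norm_Z -mulr_suml.
rewrite subr0 !mul0r addr0 mul1r scale0r addr0 => Yle.
rewrite ler_expR; apply: ler_pM => //; rewrite ?sqr_ge0 //; last by rewrite ler_pXn2r ?nnegrE.
by apply: le_trans rt_rs; rewrite lerDl; apply: mulr_ge0 => //; exact: rh0.
Qed.

Let Cs := Cstep th.

(** Where chi = 1, the Gaussian term raises the weight from rt to at most rs by [rt_rs], and the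
    rest of the exponent adds up to [Cs * h]. Where chi = 0, the factor exp(Cs h) >= 1 suffices. *)
Let final_bound o : Psi o + Phi o * (expR ((2 * rt) ^+ 2 * h * (\sum_(u <- fset_set J) a u o ^+ 2) / 2) + 2 * D) <=
  expR (Cs * h) * expR (rs * `|X o| ^+ 2).
Proof.
have e0 := expR_ge0 (rs * `|X o| ^+ 2).
have sc0 : 0 <= step_cst eps Kstep (th + 1) by apply: step_cst_ge0 => //; exact: ltW.
have C1 : 1 <= expR (Cs * h).
  rewrite -[leLHS]expR0 ler_expR mulr_ge0 ?(ltW h0) // /Cs /Cstep; apply: addr_ge0; apply: mulr_ge0 => //; [exact: ltW|exact: sqr_ge0].
rewrite /Psi /Phi A01; case: ifPn => ro; last first.
  by rewrite subr0 mul1r !mul0r addr0 ler_peMl.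
rewrite subrr mul0r add0r mul1r.
set E1 := expR ((2 * rt) ^+ 2 * h * _ / 2).
have E1le : E1 <= expR (2 * rt ^+ 2 * h * th * `|X o| ^+ 2).
  rewrite ler_expR; have -> : (2 * rt) ^+ 2 * h * (\sum_(u <- fset_set J) a u o ^+ 2) / 2 =
     2 * rt ^+ 2 * h * (\sum_(u <- fset_set J) a u o ^+ 2) by field.
  by rewrite -(mulrA (2 * rt ^+ 2 * h) th) ler_wpM2l // rh0.
have E2 : 1 <= expR (2 * rt ^+ 2 * h * th * `|X o| ^+ 2).
  by rewrite -[leLHS]expR0 ler_expR; apply: mulr_ge0; [apply: mulr_ge0 => //; exact: rh0|exact: sqr_ge0].
have D0 : 0 <= D by rewrite mulr_ge0 // ltW.
have D1 : 1 + 2 * D <= expR (2 * D) by exact: expR_ge1Dx.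
(* The additive error becomes multiplicative: for E >= 1, E + 2 D <= E (1 + 2 D) <= E exp(2 D). *)
apply: (@le_trans _ _ (expR (rt * `|X o| ^+ 2 + eps * Kstep ^+ 2 * h) *
   (expR (2 * rt ^+ 2 * h * th * `|X o| ^+ 2) * expR (2 * D)))).
  rewrite ler_wpM2l ?expR_ge0 //.
  apply: (@le_trans _ _ (expR (2 * rt ^+ 2 * h * th * `|X o| ^+ 2) * (1 + 2 * D))); last first.
    by rewrite ler_wpM2l ?expR_ge0.
  rewrite mulrDr mulr1; apply: lerD => //.
  by rewrite ler_peMl // mulr_ge0.
rewrite -!expRD ler_expR.
have -> : rt * `|X o| ^+ 2 + eps * Kstep ^+ 2 * h + (2 * rt ^+ 2 * h * th * `|X o| ^+ 2 + 2 * D) =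
  Cs * h + (rt + 2 * rt ^+ 2 * h * th) * `|X o| ^+ 2.
  by rewrite /Cs /Cstep /D; ring.
by rewrite lerD2l ler_wpM2r ?sqr_ge0.
Qed.

Lemma step_bound :
  (\int[P]_o (expR (eps * `|Yt o| ^+ 2 / expR (2 * eps * th * t)))%:E <=
   (expR (Cstep th * (t - s)))%:E * \int[P]_o (expR (eps * `|X o| ^+ 2 / expR (2 * eps * th * s)))%:E)%E.
Proof.
have EY o : eps * `|Yt o| ^+ 2 / expR (2 * eps * th * t) = rt * `|Yt o| ^+ 2.
  by rewrite /rt mulrAC.
have EX o : eps * `|X o| ^+ 2 / expR (2 * eps * th * s) = rs * `|X o| ^+ 2.
  by rewrite /rs mulrAC.
under eq_integral do rewrite EY.
under [X in (_ <= _ * X)%E]eq_integral do rewrite EX.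
have meas g : Fmeas F_ s g -> measurable_fun setT g.
  by move=> mg _ S mS; rewrite setTI; exact: (Fs_sub hF_ s0 st tT (mg _ mS)).
have mnY : measurable_fun setT (fun o => `|Yt o|).
  have mg : Fmeas F_ t (fun o => `|Yt o|).
    apply: (@Fmeas_lip _ _ _ _ _ hF_ _ tI _ _ mY (fun v => `|v|) 1) => v v' _ _.
    by rewrite mul1r ler_dist_dist.
  move=> _ S mS; rewrite setTI; have [/(_ t tI)[_ sub] _] := hF_.
  by apply: sub; exact: mg.
have mA1 : Fmeas F_ s (\1_A : Omega -> R).
  apply/(FmeasP hF_ sI); apply: measurable_indic; apply: sub_sigma_algebra; exact: FA.
have mexpX (k k' : R) : Fmeas F_ s (fun o => expR (k * `|X o| ^+ 2 + k')).
  apply/(FmeasP hF_ sI); apply: measurableT_comp => //; apply: measurable_funD => //.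
  apply: measurable_funM => //; apply: measurable_funX; exact/(FmeasP hF_ sI).
have mPhi : Fmeas F_ s Phi.
  by apply/(FmeasP hF_ sI); apply: measurable_funM; apply/(FmeasP hF_ sI).
have mPsi : measurable_fun setT Psi.
  apply: measurable_funM; first by apply: measurable_funB => //; exact: meas.
  apply: measurableT_comp => //; apply: measurable_funM => //; apply: measurable_funX.
  exact: meas.
have A0 o : 0 <= \1_A o :> R by rewrite indicE.
have A1 o : \1_A o <= 1 :> R by rewrite indicE; case: (_ \in _).
have Phi0 o : 0 <= Phi o by rewrite mulr_ge0 // expR_ge0.
have Psi0 o : 0 <= Psi o by rewrite mulr_ge0 ?expR_ge0 // subr_ge0.
have D0 : 0 <= D.
  rewrite mulr_ge0 ?(ltW h0) //; apply: step_cst_ge0 => //; exact: ltW.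
have th1 : 0 < th + 1 by rewrite ltr_wpDl.
have CB := @cond_bound _ _ _ P T F_ W hF_ hW s t s0 st tT (fset_set J) oJ (fset_set I) Phi a Mx
  (2 * rt) D (th + 1) mPhi Phi0 (fun u _ => ma u) (fun i u iI _ => mM u iI) D0 th1 (fun o _ => M_bound o).
have mq : measurable_fun setT (fun o => Phi o * (expR (2 * rt * \sum_(u <- fset_set J) a u o * dW W s t u o) +
     D * expR (\sum_(i <- fset_set I) (\sum_(u <- fset_set J) Mx i u o * dW W s t u o) ^+ 2 / (4 * (th + 1) * (t - s))))).
  apply: measurable_funM; first exact: meas.
  apply: measurable_funD.
    apply: measurableT_comp => //; apply: measurable_funM => //.
    apply: measurable_sum_seq => u uJ; apply: measurable_funM; first exact: meas.
    exact: (meas_dW hF_ hW s0 st tT).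
  apply: measurable_funM => //; apply: measurableT_comp => //.
  apply: measurable_sum_seq => i iI; apply: measurable_funM => //; apply: measurable_funX.
  apply: measurable_sum_seq => u uJ; apply: measurable_funM; first by apply: meas; exact: mM.
  exact: (meas_dW hF_ hW s0 st tT).
have mq2 : measurable_fun setT (fun o => Phi o * (expR ((2 * rt) ^+ 2 * (t - s) * (\sum_(u <- fset_set J) a u o ^+ 2) / 2) + 2 * D)).
  apply: measurable_funM; first exact: meas.
  apply: measurable_funD => //; apply: measurableT_comp => //.
  apply: measurable_funM => //; apply: measurable_funM => //.
  by apply: measurable_sum_seq => u uJ; apply: measurable_funX; exact: meas.
have mX2 : measurable_fun setT (fun o => (expR (rs * `|X o| ^+ 2))%:E).
  apply/measurable_EFinP; apply: measurableT_comp => //; apply: measurable_funM => //.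
  by apply: measurable_funX; exact: meas.
have q0 (x y : R) : 0 <= expR x + D * expR y by rewrite addr_ge0 ?expR_ge0 // mulr_ge0 // expR_ge0.
apply: (@le_trans _ _ (\int[P]_o (Psi o)%:E + \int[P]_o (Phi o * (expR (2 * rt * \sum_(u <- fset_set J) a u o * dW W s t u o) +
     D * expR (\sum_(i <- fset_set I) (\sum_(u <- fset_set J) Mx i u o * dW W s t u o) ^+ 2 / (4 * (th + 1) * (t - s)))))%:E)%E).
  rewrite -ge0_integralD //; last 4 first.
  - by move=> o _; rewrite lee_fin.
  - exact/measurable_EFinP.
  - by move=> o _; rewrite lee_fin mulr_ge0.
  - exact/measurable_EFinP.
  apply: ae_ge0_le_integral => //.
  - apply/measurable_EFinP; apply: measurableT_comp => //; apply: measurable_funM => //.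
    exact: measurable_funX.
  - by move=> o _; rewrite -EFinD lee_fin addr_ge0 // mulr_ge0.
  - by apply: emeasurable_funD; exact/measurable_EFinP.
  - have aeP : Filter (almost_everywhere P) by exact: aeP_filter.
    by apply: filterS pointwise => o H1 _; rewrite -EFinD lee_fin.
apply: le_trans (leeD2l _ CB) _.
rewrite -ge0_integralD //; last 4 first.
- by move=> o _; rewrite lee_fin.
- exact/measurable_EFinP.
- by move=> o _; rewrite lee_fin mulr_ge0 // addr_ge0 ?expR_ge0 // mulr_ge0.
- exact/measurable_EFinP.
have <- : (\int[P]_o ((expR (Cs * h))%:E * (expR (rs * `|X o| ^+ 2))%:E) =
    (expR (Cs * h))%:E * \int[P]_o (expR (rs * `|X o| ^+ 2))%:E)%E.
  by apply: ge0_integralZl => //.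
apply: ge0_le_integral => //.
- by move=> o _; rewrite -EFinD lee_fin addr_ge0 // mulr_ge0 // addr_ge0 ?expR_ge0 // mulr_ge0.
- by apply: emeasurable_funD; exact/measurable_EFinP.
- exact: emeasurable_funM.
- by move=> o _; rewrite -EFinD -EFinM lee_fin; exact: final_bound.
Qed.

End step.

End one_step.

(** * Time grids and induction along them *)

Lemma finite_set_max (R : realType) (A : set R) : finite_set A -> A !=set0 ->
  exists2 m, A m & ubound A m.
Proof.
move=> fA [a Aa].
have aux (s : seq R) x : exists2 m, m \in x :: s & forall y, y \in x :: s -> y <= m.
  elim: s x => [|y s IHs] x; first by exists x => [|z]; rewrite !inE // => /eqP ->.
  have [m ms mm] := IHs y; exists (Num.max x m).
    by rewrite inE; case: leP => _; rewrite ?ms ?orbT ?eqxx.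
  move=> z; rewrite inE => /orP[/eqP ->|/mm zm]; rewrite le_max ?lexx //.
  by rewrite zm orbT.
have aI : a \in (fset_set A : seq R) by exact/(mem_fset_set fA).
case E : (fset_set A : seq R) aI => [//|x s] _.
have [m ms mm] := aux s x; exists m; first by apply/(mem_fset_set fA); rewrite E.
by move=> y /(mem_fset_set fA); rewrite E; exact: mm.
Qed.

Section grid.
Variables (R : realType) (T : R) (theta : set R).
Hypothesis gth : grids T theta.

Lemma grid_floorP (t : R) : 0 < t ->
  [/\ theta (grid_floor theta t), 0 <= grid_floor theta t, grid_floor theta t < t
    & forall u, theta u -> 0 <= u < t -> u <= grid_floor theta t].
Proof.
move=> t0; have [fth _ th0 _] := gth.
have fA : finite_set (`[0, t[ `&` theta) by exact: finite_setIr.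
have A0 : (`[0, t[ `&` theta) 0 by split => //=; rewrite in_itv /= lexx.
have [m [/= mt thm] mm] := finite_set_max fA (ex_intro _ _ A0).
have -> : grid_floor theta t = m.
  apply/eqP; rewrite eq_le; apply/andP; split; first by apply: ge_sup => //; exists 0.
  by apply: ub_le_sup; [exists m|].
move: mt; rewrite in_itv /= => /andP[m0 mt]; split => // u thu ut.
by apply: mm; split => //=; rewrite in_itv.
Qed.

Lemma grid_step (t : R) : 0 < t -> t <= T ->
  t - grid_floor theta t <= mesh theta /\ mesh theta <= T.
Proof.
move=> t0 tT; have [fth th01 th0 thT] := gth.
have [thf f0 ft fm] := grid_floorP t0; set f := grid_floor theta t in thf f0 ft fm *.
(* The first grid point not before t, found as a maximum of negatives; with the floor of t it spans
   a gap that the mesh bounds. *)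
have fA : finite_set (-%R @` (theta `&` `[t, +oo[)) by apply: finite_image; exact: finite_setIl.
have AT : (-%R @` (theta `&` `[t, +oo[)) (- T) by exists T => //; split => //=; rewrite in_itv /= tT.
have [_ [b [thb /= tb] <-] bm] := finite_set_max fA (ex_intro _ _ AT).
rewrite in_itv /= andbT in tb.
have gap : [set x | exists a b, [/\ theta a, theta b, a < b, x = b - a
    & forall s, theta s -> ~~ (a < s < b)]] (b - f).
  exists f, b; split => //; first exact: lt_le_trans tb.
  move=> s ths; apply/negP => /andP[fs sb]; case: (ltP s t) => st.
    have := fm s ths; rewrite (le_trans f0 (ltW fs)) st => /(_ isT).
    by rewrite leNgt fs.
  have : - s <= - b by apply: bm; exists s => //; split => //=; rewrite in_itv /= st.
  by rewrite lerN2 leNgt sb.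
have ubT : ubound [set x | exists a b, [/\ theta a, theta b, a < b, x = b - a
    & forall s, theta s -> ~~ (a < s < b)]] T.
  move=> _ [a [b' [/th01 /= + /th01 /= + _ -> _]]]; rewrite !in_itv /= => /andP[a0 _] /andP[_ bT].
  by rewrite lerBlDr (le_trans bT) // lerDl.
split; last by apply: ge_sup => //; exists (b - f).
apply: (@le_trans _ _ (b - f)); first by rewrite lerD2r.
by apply: ub_le_sup => //; exists T.
Qed.

(** Induction on the number of grid points in [0, t[, which drops on passing to the floor. The time
    t need not be a grid point, since the scheme is defined between them as well. *)
Lemma grid_ind (Pr : R -> Prop) : Pr 0 ->
  (forall t, 0 < t -> t <= T -> Pr (grid_floor theta t) -> Pr t) ->
  forall t, 0 <= t -> t <= T -> Pr t.
Proof.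
move=> P0 PS t; have [fth th01 th0 thT] := gth.
have fA (u : R) : finite_set (`[0, u[ `&` theta) by exact: finite_setIr.
have [n] := ubnP #|` fset_set (`[0, t[ `&` theta)|.
elim: n t => // n IHn t; rewrite ltnS => tn; rewrite le_eqVlt => /orP[/eqP <- //|t0] tT.
have [thf f0 ft fm] := grid_floorP t0; apply: PS => //; apply: IHn => //; last exact: le_trans (ltW ft) tT.
apply: leq_trans tn; apply: fproper_ltn_card; rewrite fproperE; apply/andP; split.
  apply/fsubsetP => u /(mem_fset_set (fA _)) [/= + thu]; rewrite in_itv /= => /andP[u0 uf].
  by apply/(mem_fset_set (fA _)); split => //=; rewrite in_itv /= u0 (lt_trans uf).
apply/negP => /fsubsetP /(_ (grid_floor theta t)) sub.
have /sub/(mem_fset_set (fA _)) [/=] : grid_floor theta t \in (fset_set (`[0, t[ `&` theta) : seq R).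
  by apply/(mem_fset_set (fA _)); split => //=; rewrite in_itv /= f0.
by rewrite in_itv /= ltxx andbF.
Qed.

End grid.

(* Applied to |xi|, where xi is Borel for the H_gamma norm and not for |.| *)
Lemma ge0_le_integral_nomeas d (T : measurableType d) (R : realType)
    (mu : {measure set T -> \bar R}) (f g : T -> \bar R) :
  (forall x, (0 <= f x)%E) -> (forall x, (f x <= g x)%E) ->
  (\int[mu]_x f x <= \int[mu]_x g x)%E.
Proof.
move=> f0 fg; have g0 x : (0 <= g x)%E by exact: le_trans (fg x).
rewrite !ge0_integralTE //; apply: ereal_sup_le => _ [h /= hf <-].
by exists h => //= x; exact: le_trans (fg x).
Qed.

Theorem corollary4p11 (R : realType)
  (gamma T eps delta : R)
  (hgamma : 2^-1 <= gamma) (hT : 0 < T) (heps : 0 < eps)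
  (hdelta : 0 < delta < 18^-1)
  (* U = L^2((0, 1)), its basis UU, the subspace H and its basis HH *)
  (UU H HH : set (L2 R))
  (hUU : orthonormal_basis setT UU)
  (hH : closed_subspace H)
  (hHH : orthonormal_basis H HH) (hHH0 : HH !=set0)
  (lam : L2 R -> R)
  (hlam : (ereal_sup [set (lam h)%:E | h in HH] < 0)%E)
  (* the filtered probability space and the Wiener process *)
  (d : measure_display) (Omega : measurableType d) (P : probability Omega R)
  (F_ : R -> set (set Omega)) (hF_ : filtration T F_)
  (W : R -> L2 R -> Omega -> R) (hW : cylindrical_wiener P T F_ W)
  (* the covariance operator Q, its square root and the projection on H *)
  (Q : {linear L2 R -> L2 R}) (hQc : continuous Q)
  (hQ : nonneg_symmetric Q) (hQtr : (trace UU Q < +oo)%E)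
  (sqrtQ : {linear L2 R -> L2 R}) (hsqrtQc : continuous sqrtQ)
  (hsqrtQ : is_sqrt Q sqrtQ)
  (Rproj : L2 R -> L2 R) (hRproj : orthogonal_projection H Rproj)
  (* the functions r and b and the constant c *)
  (r : L2 R -> R)
  (hr0 : forall v, Hspace H HH lam gamma v -> 0 <= r v)
  (hrm : forall S : set R, measurable S ->
    borel (Hspace H HH lam gamma) (Hnorm HH lam gamma)
      (Hspace H HH lam gamma `&` r @^-1` S))
  (b : R -> R -> R)
  (hbm : measurable_fun (D01 `*` setT) (fun z : R * R => b z.1 z.2))
  (hb : (ereal_sup [set e | exists x y z, [/\ D01 x, z != y
           & e = (`|b x y| + `|b x y - b x z| / `|y - z|)%:E]] < +oo)%E)
  (c : R)
  (hc : 2 * Num.max 1 (Num.max (eps * Num.sqrt (vartheta UU Q b)) eps) <= c)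
  (* the coefficients F and B and the initial value xi *)
  (F : L2 R -> L2 R) (hF : forall v, Hspace H HH lam gamma v -> H (F v))
  (B : L2 R -> L2 R -> L2 R)
  (hB : forall v, Hspace H HH lam gamma v -> hilbert_schmidt UU H (B v))
  (xi : Omega -> L2 R)
  (hxi : measurable_into (F_ 0)
           (Hspace H HH lam gamma) (Hnorm HH lam gamma) xi)
  (hxi_exp : ('E_P[fun omega => expR (eps * `|xi omega| ^+ 2)] < +oo)%E)
  (hBb : forall v : R -> R, measurable_fun D01 v -> inL2 v ->
    Hspace H HH lam gamma (cls v) ->
    forall u, B (cls v) u = Rproj (cls (fun x => b x (v x) * L2fun (sqrtQ u) x)))
  (hFw : forall w dw, Hspace H HH lam gamma w -> in_Linfty w ->
    is_weak_derivative w dw ->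
    F w = - Rproj (cls (fun x => L2fun w x * L2fun dw x)))
  (* the numerical scheme *)
  (Y : set R -> set (L2 R) -> set (L2 R) -> R -> Omega -> L2 R)
  (hYadapted : forall theta I J, grids T theta -> fsets HH I -> fsets UU J ->
    forall t : R, t \in `[0, T] ->
    measurable_into (F_ t) (fproj I @` H) (fun v => `|v|) (Y theta I J t))
  (hYcont : forall theta I J, grids T theta -> fsets HH I -> fsets UU J ->
    forall omega, {within `[0, T], continuous (fun t => Y theta I J t omega)})
  (hY0 : forall theta I J, grids T theta -> fsets HH I -> fsets UU J ->
    forall omega, Y theta I J 0 omega = fproj I (xi omega))
  (hY : forall theta I J, grids T theta -> fsets HH I -> fsets UU J ->
    forall t : R, t \in `]0, T] ->
    let tau := grid_floor theta t in
    let Ytau := Y theta I J tau in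
    let chi := fun omega =>
      if r (Ytau omega) <= c * mesh theta `^ (- delta) then 1 else 0 : R in
    let BJ := fun omega u => fproj I (B (Ytau omega) (fproj J u)) in
    {ae P, forall omega,
      Y theta I J t omega =
        semigroup HH lam (t - tau)
          (Ytau omega
           + chi omega *: ((t - tau) *: fproj I (F (Ytau omega))))
        + (1 + `|ito_const UU W tau t BJ omega| ^+ 2)^-1 *:
          ito_const UU W tau t (fun omega u =>
            semigroup HH lam (t - tau) (chi omega *: BJ omega u)) omega})
  (* the hypotheses of the corollary *)
  (e : nat -> L2 R)
  (heHH : forall n, (0 < n)%N -> HH (e n))
  (he : forall n, (0 < n)%N ->
    e n = cls (fun x => Num.sqrt 2 * sin (n%:R * pi * x)))
  (hlame : forall n, (0 < n)%N -> lam (e n) = - (pi ^+ 2 * n%:R ^+ 2))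
  (hr : forall v, Hspace H HH lam gamma v ->
    Num.max (Num.sqrt (vartheta UU Q b) + eps * `|v| ^+ 2)
            ((Num.sqrt 3)^-1 * Hnorm HH lam gamma v ^+ 2) <= r v) :
  (ereal_sup [set ereal_sup [set ereal_sup [set ereal_sup
     [set 'E_P[fun omega =>
             expR (eps * `|Y theta I J t omega| ^+ 2
                   / expR (2 * eps * vartheta UU Q b * t))]
     | t in `[0%R, T]%classic] | J in fsets UU] | I in fsets HH]
     | theta in grids T] < +oo)%E.
Proof.
have hlam0 h : HH h -> lam h <= 0.
  move=> Hh; rewrite -lee_fin; apply: le_trans (ltW hlam).
  by apply: ereal_sup_ubound; exists h.
have c0 : 0 < c.
  apply: lt_le_trans hc; apply: mulr_gt0 => //.
  by apply: lt_le_trans ltr01 _; rewrite le_max lexx.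
set th := vartheta UU Q b; pose K := Cstep T eps c th.
have th0 : 0 <= th by exact: (vartheta_ge0 UU hQ hb).
have K0 : 0 <= K.
  rewrite /K /Cstep addr_ge0 //; apply: mulr_ge0 => //.
  - exact: ltW.
  - exact: sqr_ge0.
  - apply: step_cst_ge0 => //; [exact: ltW|exact: sqrtr_ge0].
(* A bound free of the grid, [I], [J] and t, finite by the moment assumption on the initial
   value. *)
apply: (@le_lt_trans _ _ ((expR (K * T))%:E * 'E_P[fun omega => expR (eps * `|xi omega| ^+ 2)])%E); last first.
  have : (0 <= 'E_P[fun omega => expR (eps * `|xi omega| ^+ 2)])%E.
    by apply: expectation_ge0 => o; exact: expR_ge0.
  case: 'E_P[_]%E hxi_exp => [x _ _| |] //.
  by rewrite -EFinM ltry.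
apply: ge_ereal_sup => _ [theta gth <-].
apply: ge_ereal_sup => _ [I [fI IH] <-].
apply: ge_ereal_sup => _ [J [fJ JU] <-].
apply: ge_ereal_sup => _ [t /= + <-]; rewrite in_itv /= => /andP[t0 tT].
pose E u := (\int[P]_o (expR (eps * `|Y theta I J u o| ^+ 2 / expR (2 * eps * th * u)))%:E)%E.
have E0 : (E 0%R <= 'E_P[fun omega => expR (eps * `|xi omega| ^+ 2)])%E.
  rewrite unlock /E; apply: ge0_le_integral_nomeas => o /=; first by rewrite lee_fin expR_ge0.
  rewrite lee_fin ler_expR mulr0 expR0 divr1 hY0 //.
  rewrite ler_wpM2l ?(ltW heps) // ler_pXn2r ?nnegrE //.
  exact: (fproj_norm hHH IH fI).
have Et : (E t <= (expR (K * t))%:E * E 0%R)%E.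
  apply: (grid_ind gth (Pr := fun u => (E u <= (expR (K * u))%:E * E 0%R)%E)) => //.
    by rewrite mulr0 expR0 mul1e.
  move=> u u0 uT IHu.
  have [thf f0 fu _] := grid_floorP gth u0; have [mh mT] := grid_step gth u0 uT.
  have fIt : grid_floor theta u \in `[0, T] by rewrite in_itv /= f0 (le_trans (ltW fu)).
  have uI : u \in `[0, T] by rewrite in_itv /= (ltW u0).
  have uI' : u \in `]0, T] by rewrite in_itv /= u0.
  have sb := step_bound hgamma hT heps hdelta hUU hH hHH hlam0 heHH he hlame hF_ hW hQ hQtr hsqrtQ hRproj
    hrm hbm hb c0 hB hBb hFw hr IH fI JU fJ f0 fu uT mh mT
    (hYadapted _ _ _ gth (conj fI IH) (conj fJ JU) _ fIt) (hYadapted _ _ _ gth (conj fI IH) (conj fJ JU) _ uI)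
    (hY _ _ _ gth (conj fI IH) (conj fJ JU) _ uI').
  apply: (le_trans sb).
  (* The growth factors of the successive steps telescope to exp(K u). *)
  have -> : expR (K * u) = expR (K * (u - grid_floor theta u)) * expR (K * grid_floor theta u).
    by rewrite -expRD -mulrDr subrK.
  rewrite EFinM -(muleA (expR (K * (u - grid_floor theta u)))%:E).
  by apply: lee_wpmul2l; [rewrite lee_fin expR_ge0 | exact: IHu].
rewrite unlock; apply: (le_trans Et).
apply: lee_pmul => //.
- by apply: integral_ge0 => o _; rewrite lee_fin expR_ge0.
- by rewrite lee_fin ler_expR ler_wpM2l.
- by move: E0; rewrite unlock.
Qed.
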